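(* Let $m\ge3$, $n\ge1$, $\alpha\in\mathbb{R}^m_{>0}$, let $\mathscr{M}=\mathcal{H}^{(\alpha)}(\mathbb{D}^m)$, and let $\mathscr{M}^{(n)}_q=\mathscr{M}\ominus\mathscr{M}^{(n)}$, where $\mathscr{M}^{(n)}$ is the submodule of functions in $\mathscr{M}$ vanishing to order $n$ along $\Delta=\{z\in\mathbb{D}^m:z_1=\cdots=z_m\}$. Then, up to unitary equivalence, $$M_q=\bigoplus_{l_{m-2}=0}^{n-1}\left(\bigoplus_{l_{m-3}=0}^{n-1-l_{m-2}}\cdots\left(\bigoplus_{l_1=0}^{n-1-l_{m-2}-\cdots-l_2}M_q^{(\ell)}\right)\right),\qquad \ell=(l_1,\dots,l_{m-2}),$$ where $M_q$ is the compression of the multiplication operator $M_{z_1}$ on $\mathscr{M}$ onto $\mathscr{M}^{(n)}_q$, and $M_q^{(\ell)}$ is the compression of the multiplication operator $M_{z_1}$ on $\mathscr{M}_\ell$ onto the quotient module $(\mathscr{M}_\ell)^{(n-|\ell|)}_q=\mathscr{M}_\ell\ominus\mathscr{M}_\ell^{(n-|\ell|)}$. Here $|\ell|=l_1+\cdots+l_{m-2}$, $\mathscr{M}_\ell$ is the Hilbert module with reproducing kernel $$K_\ell(z,w)=C_\ell\,(1-z_1\bar w_1)^{-\alpha_1}(1-z_2\bar w_2)^{-\alpha_2-\cdots-\alpha_m-2|\ell|},\qquad z,w\in\mathcal{Z}=\{z\in\mathbb{D}^m:z_2=\cdots=z_m\},$$ with $C_\ell>0$ a constant, and $\mathscr{M}_\ell^{(n-|\ell|)}$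 is the submodule of functions in $\mathscr{M}_\ell$ vanishing to order $n-|\ell|$ along $\Delta\subset\mathcal{Z}$. Moreover, each $M_q^{(\ell)}$ is irreducible.
   Context: $\mathcal{H}^{(\alpha)}(\mathbb{D}^m)$ is the reproducing kernel Hilbert space on $\mathbb{D}^m$ with kernel $\prod_{j=1}^m(1-z_j\bar w_j)^{-\alpha_j}$. $\mathcal{Z}$ is identified with $\mathbb{D}^2$ via $z\mapsto(z_1,z_2)$, under which $\Delta$ becomes $\{z_1=z_2\}$. A holomorphic function vanishes to order $k$ along $\Delta$ if all its partial derivatives of order $\le k-1$ vanish on $\Delta$ (for functions on $\mathcal{Z}$, derivatives in the coordinates $(z_1,z_2)$). The compression of $T$ onto a closed subspace $\mathcal{S}$ is $P_{\mathcal{S}}T|_{\mathcal{S}}$. An operator is irreducible if it has no nontrivial reducing subspace. The constant is $C_\ell=\prod_{j=1}^{m-2}c_j$ where, with $p=l_{m-j-1}$, $a_j=\alpha_{m-j}$, $b_j=\alpha_{m-j+1}+\cdots+\alpha_m+2(l_{m-2}+\cdots+l_{m-j})$ (the sum of $l$'s being empty for $j=1$), $c_j=p!\sum_{i=0}^p\binom pi\frac{((a_j)_p)^2((b_j)_p)^2}{(a_j)_{p-i}(b_j)_i}$ and $(x)_k=x(x+1)\cdots(x+k-1)$. *)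

(* Defs.v *)
From mathcomp Require Import all_boot all_order all_algebra.
From mathcomp Require Import complex.
From mathcomp Require Import all_classical all_reals all_analysis.

Set Implicit Arguments.
Unset Strict Implicit.
Unset Printing Implicit Defensive.

Import Order.TTheory GRing.Theory Num.Theory.
Import numFieldNormedType.Exports.

Local Open Scope classical_set_scope.
Local Open Scope ring_scope.

(* Hilbert spaces are linear subsets of an ambient module V; the value of the
   inner product outside the carrier is irrelevant, and so are the values of
   operators (functions V -> V).  The inner product is linear on the left. *)
Record hspace (C : numClosedFieldType) (V : lmodType C) := HSpace {
  hcar :> V -> Prop;
  hip : V -> V -> C }.

Section Hilbert.
Variables (C : numClosedFieldType) (V : lmodType C).
Implicit Types (H : hspace V) (S N : set V) (T : V -> V).

Definition is_subspace S :=
  S 0 /\ forall (a : C) x y, S x -> S y -> S (a *: x + y).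

Definition hnorm H (x : V) : C := sqrtC (hip H x x).

Definition hcvg H (u : nat -> V) (l : V) :=
  forall e : C, 0 < e ->
    exists n : nat, forall k : nat, (n <= k)%N -> hnorm H (u k - l) < e.

Definition hcauchy H (u : nat -> V) :=
  forall e : C, 0 < e ->
    exists n : nat, forall j k : nat, (n <= j)%N -> (n <= k)%N -> hnorm H (u j - u k) < e.

Record is_hilbert H : Prop := IsHilbert {
  hilbert_subspace : is_subspace (hcar H);
  hip_linear : forall (a : C) x y z, H x -> H y -> H z ->
    hip H (a *: x + y) z = a * hip H x z + hip H y z;
  hip_herm : forall x y, H x -> H y -> hip H y x = (hip H x y)^*;
  hip_ge0 : forall x, H x -> 0 <= hip H x x;
  hip_def : forall x, H x -> hip H x x = 0 -> x = 0;
  hilbert_complete : forall u : nat -> V, (forall k, H (u k)) ->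
    hcauchy H u -> exists2 l, H l & hcvg H u l }.

Definition hominus H S : hspace V :=
  HSpace [set x | H x /\ forall s, S s -> hip H x s = 0] (hip H).

Definition hproj H (x : V) : V :=
  xget 0 [set p | H p /\ forall s, H s -> hip H (x - p) s = 0].

Definition compression H T : V -> V := fun x => hproj H (T x).

Definition closed_subspace H N :=
  [/\ N `<=` hcar H, is_subspace N &
      forall u l, (forall k, N (u k)) -> H l -> hcvg H u l -> N l].

Definition reducing H T N :=
  [/\ closed_subspace H N, (forall x, N x -> N (T x)) &
      forall x, hominus H N x -> hominus H N (T x)].

Definition irreducible H T :=
  forall N, reducing H T N -> N = [set 0] \/ N = hcar H.

End Hilbert.

Definition unitarily_equivalent (C : numClosedFieldType) (V1 V2 : lmodType C)
    (H1 : hspace V1) (T1 : V1 -> V1) (H2 : hspace V2) (T2 : V2 -> V2) :=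
  exists U : V1 -> V2,
    [/\ forall (a : C) x y, H1 x -> H1 y -> U (a *: x + y) = a *: U x + U y,
        U @` hcar H1 = hcar H2,
        forall x y, H1 x -> H1 y -> hip H2 (U x) (U y) = hip H1 x y &
        forall x, H1 x -> U (T1 x) = T2 (U x)].

Definition hsum (C : numClosedFieldType) (V : lmodType C) (I : finType)
    (H : I -> hspace V) : hspace (I -> V) :=
  HSpace [set x : I -> V | forall i, H i (x i)]
         (fun x y => \sum_i hip (H i) (x i) (y i)).

Definition opsum (V : Type) (I : Type) (T : I -> V -> V) :
    (I -> V) -> (I -> V) :=
  fun x i => T i (x i).

(* v_k, with the 1-based indexing of the usual notation (v_1, ..., v_d);
   only used for 1 <= k <= d *)
Definition ent (A : nmodType) (d : nat) (v : 'rV[A]_d) (k : nat) : A :=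
  if insub k.-1 is Some j then v 0 j else 0.

Section Functions.
Variable R : realType.
Local Notation C := R[i].

(* principal branches of the argument and of the real powers *)
Definition carg (z : C) : R :=
  let t := acos (complex.Re z / Normc.normc z) in
  if 0 <= complex.Im z then t else - t.

Definition cpow (z : C) (s : R) : C :=
  ((Normc.normc z `^ s)%:C * (cos (s * carg z) +i* sin (s * carg z)))%C.

Variable d : nat.
Local Notation fn := ('rV[C]_d -> C^o).

Definition polydisc : set 'rV[C]_d := [set z | forall j, `|z 0 j| < 1].

Definition diag_set : set 'rV[C]_d :=
  [set z | polydisc z /\ forall i j, z 0 i = z 0 j].

(* H is the reproducing kernel Hilbert space on X with kernel K; a function
   on X is represented by its extension by 0 outside X *)
Definition is_rkhs (X : set 'rV[C]_d) (K : 'rV[C]_d -> 'rV[C]_d -> C)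
    (H : hspace fn) :=
  [/\ is_hilbert H,
      (forall f : fn, H f -> forall z, ~ X z -> f z = 0) &
      forall w, X w ->
        let Kw : fn := fun z => if z \in X then K z w else 0 in
        H Kw /\ forall f : fn, H f -> f w = hip H f Kw].

Definition Mz (k : nat) (f : fn) : fn := fun z => ent z k * f z.

Definition partials (s : seq 'I_d) (f : fn) : fn :=
  foldr (fun j (g : fn) z => 'D_(delta_mx 0 j) g z) f s.

Definition vanishes_to_order (k : nat) (f : fn) :=
  forall s : seq 'I_d, (size s < k)%N ->
    forall z, diag_set z -> partials s f z = 0.

Definition submodule (H : hspace fn) (k : nat) : set fn :=
  [set f | H f /\ vanishes_to_order k f].

Definition quotient_module (H : hspace fn) (k : nat) : hspace fn :=
  hominus H (submodule H k).

Definition Mq (H : hspace fn) (k : nat) : fn -> fn :=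
  compression (quotient_module H k) (Mz 1).

Definition weighted_kernel (alpha : 'rV[R]_d) (z w : 'rV[C]_d) : C :=
  \prod_(j < d) cpow (1 - z 0 j * (w 0 j)^*) (- alpha 0 j).

End Functions.

Section Constants.
Variables (R : realType) (m : nat).

Definition poch (x : R) (k : nat) : R := \prod_(0 <= i < k) (x + i%:R).

Definition absl (l : 'rV[nat]_(m - 2)) : nat := (\sum_j l ord0 j)%N.

Definition cfactor (p : nat) (a b : R) : R :=
  p`!%:R * \sum_(0 <= i < p.+1)
    'C(p, i)%:R * (poch a p ^+ 2 * poch b p ^+ 2
                     / (poch a (p - i) * poch b i)).

Definition Cell (alpha : 'rV[R]_m) (l : 'rV[nat]_(m - 2)) : R :=
  \prod_(1 <= j < m - 1)
    cfactor (ent l (m - j - 1))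
      (ent alpha (m - j))
      (\sum_(m - j + 1 <= k < m.+1) ent alpha k
        + 2 * (\sum_(m - j <= k < m - 1) ent l k)%N%:R).

(* Z is identified with D^2 through its coordinates (z_1, z_2) *)
Definition Kell (alpha : 'rV[R]_m) (l : 'rV[nat]_(m - 2))
    (z w : 'rV[R[i]]_2) : R[i] :=
  ((Cell alpha l)%:C)%C
  * cpow (1 - ent z 1 * (ent w 1)^*) (- ent alpha 1)
  * cpow (1 - ent z 2 * (ent w 2)^*)
      (- (\sum_(2 <= k < m.+1) ent alpha k) - 2 * (absl l)%:R).

(* the indices of the iterated direct sum: for every k,
   0 <= l_k <= n - 1 - l_{m-2} - ... - l_{k+1} *)
Definition index_ok (n : nat) (l : 'rV['I_n]_(m - 2)) : bool :=
  [forall k, (l ord0 k + \sum_(j : 'I_(m - 2) | (k < j)%N) l ord0 j <= n - 1)%N].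

Definition ell_index (n : nat) := {l : 'rV['I_n]_(m - 2) | index_ok l}.

Definition ell (n : nat) (x : ell_index n) : 'rV[nat]_(m - 2) :=
  map_mx (@nat_of_ord n) (val x).

End Constants.

(* Main.v *)
Require Import Defs.
From mathcomp Require Import all_boot all_order all_algebra.
From mathcomp Require Import complex.
From mathcomp Require Import all_classical all_reals all_analysis.
From mathcomp Require Import ring lra zify.
Set Implicit Arguments.
Unset Strict Implicit.
Unset Printing Implicit Defensive.
Import Order.TTheory GRing.Theory Num.Theory.
Import numFieldNormedType.Exports.
Local Open Scope classical_set_scope.
Local Open Scope ring_scope.

(* In the orthogonal basis of monomials, restricting a function and its normal
   derivatives to the diagonal is encoded by the powers of L = d/dz_1 + ... + d/dz_m:
   f vanishes to order n along the diagonal iff all L^N f have no Taylor coefficient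
   of degree < n.  The adjoint L* = sum_j (z_j^2 d/dz_j + alpha_j z_j) generates with
   L a copy of sl_2, and the space of polynomials in z_2, ..., z_m splits orthogonally
   into lowest weight modules, one for each (l_1, ..., l_{m-2}), of weight
   alpha_2 + ... + alpha_m + 2 |l|.  Replacing the powers of the second variable of a
   function of two variables by the vectors L*^j Q of such a module commutes with L, L*
   and z_1, and is isometric up to a constant.  Hence the vectors L*^N(z_1^p z_2^q),
   p + q < n - |l|, of the two-variable quotient modules and their images have the same
   Gram matrix and the same matrix of z_1; both families are total, which yields the
   unitary equivalence.

   Irreducibility: let T be the compression of z_1 to the two-variable quotient with
   order r, s = (z_1 - z_2)^r and e = z_2^(r-1).  The cokernel of
   T is spanned by the z_2^q with q < r, and T z_2^q = z_1 z_2^q except that T e is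
   corrected by a nonzero multiple of s.  For u, v in the cokernel, <Tu, Tv> thus differs
   from a multiple of <u, v> by a nonzero multiple of <u, e> <e, v>, so that a reducing
   subspace or its complement contains e; comparing T e with the T^k w for w in the
   cokernel of the other one shows that the latter is 0. *)

(** * Multi-indexed sums and formal power series *)

(** The spaces are given only through kernels in closed form, with principal powers: their members
    are not known to be power series, nor is multiplication by z_1 known to be bounded. Hence the
    monomials and their norms are first extracted from the kernels, through the binomial series and
    a Riesz lemma; afterwards every function is its coefficient family, and the argument is algebra
    in the homogeneous components, where all sums are finite.

    The operator L serves because it is the derivative along (1,...,1) and commutes with all partial
    derivatives: the value at 0 of L^N f is N! times the sum of the coefficients of f of degree N,
    so the restriction of f to the diagonal can be read off at the origin.

    The variable z_1 stays out of the splitting into lowest weight modules, since the operator under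
    study multiplies by it: it then acts on one tensor factor and the splitting takes place in the
    other. The constant of the kernel of a summand divides squared norms there, and a scalar factor
    of the embedding compensates for it. *)

Section MultiSum.
Variable V : nmodType.
Implicit Types F G : seq nat -> V.

(* The sum over the multi-indices of length d and degree D. *)
Fixpoint msum (d D : nat) F : V :=
  if d is d'.+1 then \sum_(i < D.+1) msum d' (D - i) (fun k => F (nat_of_ord i :: k))
  else if D == 0%N then F [::] else 0.

Lemma eq_msum d D F G :
  (forall k, size k = d -> sumn k = D -> F k = G k) -> msum d D F = msum d D G.
Proof.
elim: d D F G => [|d IH] D F G FG /=.
  by case: eqP => // D0; apply: FG.
apply: eq_bigr => i _; apply: IH => k sk kD; apply: FG; rewrite /= ?sk //.
by rewrite kD subnKC // -ltnS.
Qed.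

Lemma msumD d D F G : msum d D (fun k => F k + G k) = msum d D F + msum d D G.
Proof.
elim: d D F G => [|d IH] D F G /=; first by case: eqP; rewrite ?addr0.
by rewrite -big_split; apply: eq_bigr => i _; rewrite IH.
Qed.

Lemma msum0 d D F :
  (forall k, size k = d -> sumn k = D -> F k = 0) -> msum d D F = 0.
Proof.
elim: d D F => [|d IH] D F F0 /=; first by case: eqP => // D0; apply: F0.
apply: big1 => i _; apply: IH => k sk kD; apply: F0; rewrite /= ?sk //.
by rewrite kD subnKC // -ltnS.
Qed.

Lemma msum_single d D F k0 : size k0 = d -> sumn k0 = D ->
  (forall k, size k = d -> sumn k = D -> k != k0 -> F k = 0) -> msum d D F = F k0.
Proof.
elim: d D F k0 => [|d IH] D F [|i0 k0] //=; first by move=> _ <-.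
case=> sk kD F0.
have i0D : (i0 < D.+1)%N by rewrite ltnS -kD leq_addr.
rewrite (bigD1 (Ordinal i0D)) //= big1 => [|i ii0].
  rewrite addr0 (IH _ _ k0) //; first by rewrite -kD addKn.
  move=> k sk' kD' kk0; apply: F0; rewrite /= ?sk' ?kD' ?subnKC //.
  by rewrite eqseq_cons eqxx.
apply: msum0 => k sk' kD'; apply: F0; rewrite /= ?sk' ?kD' ?subnKC //.
  by rewrite -ltnS.
rewrite eqseq_cons negb_and; apply/orP; left; apply: contraNN ii0 => /eqP e.
by apply/eqP/val_inj.
Qed.

Lemma msum_in_degree0 d F : msum d 0 F = F (nseq d 0%N).
Proof. by elim: d F => [|d IH] F //=; rewrite big_ord1 subnn IH. Qed.

Lemma exchange_msum (I : Type) (r : seq I) d D (F : I -> seq nat -> V) :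
  msum d D (fun k => \sum_(x <- r) F x k) = \sum_(x <- r) msum d D (F x).
Proof.
elim: r => [|x r IH]; first by rewrite big_nil; apply: msum0 => *; rewrite big_nil.
rewrite big_cons -IH -msumD; apply: eq_msum => k _ _; by rewrite big_cons.
Qed.

End MultiSum.

Lemma raddf_msum (V W : nmodType) (f : {additive V -> W}) d D F :
  f (msum d D F) = msum d D (fun k => f (F k)).
Proof.
elim: d D F => [|d IH] D F /=; first by case: eqP => _; rewrite ?raddf0.
by rewrite raddf_sum; apply: eq_bigr => i _; rewrite IH.
Qed.

Lemma morph_msum (V W : nmodType) (f : V -> W) d D F :
  f 0 = 0 -> {morph f : x y / x + y} ->
  f (msum d D F) = msum d D (fun k => f (F k)).
Proof.
move=> f0 fD; elim: d D F => [|d IH] D F /=; first by case: eqP.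
by rewrite (big_morph f fD f0); apply: eq_bigr => i _; rewrite IH.
Qed.

Lemma mulr_msumr (R : pzSemiRingType) (x : R) d D F :
  x * msum d D F = msum d D (fun k => x * F k).
Proof. by apply: (morph_msum (f := *%R x)); [rewrite mulr0|move=> y z; rewrite mulrDr]. Qed.

Lemma mulr_msuml (R : pzSemiRingType) (x : R) d D F :
  msum d D F * x = msum d D (fun k => F k * x).
Proof. by apply: (morph_msum (f := *%R^~ x)); [rewrite mul0r|move=> y z; rewrite mulrDl]. Qed.

Section MultiSumOrder.
Variable C : numDomainType.

Lemma msum_ge0 d D (F : seq nat -> C) :
  (forall k, size k = d -> sumn k = D -> 0 <= F k) -> 0 <= msum d D F.
Proof.
elim: d D F => [|d IH] D F F0 /=; first by case: eqP => // D0; apply: F0.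
apply: sumr_ge0 => i _; apply: IH => k sk kD; apply: F0; rewrite /= ?sk //.
by rewrite kD subnKC // -ltnS.
Qed.

Lemma ler_msum d D (F G : seq nat -> C) :
  (forall k, size k = d -> sumn k = D -> F k <= G k) -> msum d D F <= msum d D G.
Proof.
elim: d D F G => [|d IH] D F G FG /=; first by case: eqP => // D0; apply: FG.
apply: ler_sum => i _; apply: IH => k sk kD; apply: FG; rewrite /= ?sk //.
by rewrite kD subnKC // -ltnS.
Qed.

Lemma msum_eq0 d D (F : seq nat -> C) :
  (forall k, size k = d -> sumn k = D -> 0 <= F k) -> msum d D F = 0 ->
  forall k, size k = d -> sumn k = D -> F k = 0.
Proof.
move=> F0 /eqP s0 k sk kD; apply/eqP; apply: contraLR s0 => Fk.
rewrite gt_eqF //; apply: lt_le_trans (_ : F k <= _).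
  by rewrite lt_def Fk F0.
have <- : msum d D (fun x => if x == k then F x else 0) = F k.
  by rewrite (msum_single sk kD) ?eqxx // => x _ _ /negPf ->.
by apply: ler_msum => x sx xD; case: eqP => // _; apply: F0.
Qed.

End MultiSumOrder.

(** * Weighted forms on homogeneous components and the action of sl_2 *)

Section Formal.
Variable C : numClosedFieldType.
Implicit Types (al : seq C) (b c : seq nat -> C) (k l : seq nat).

Definition rf (a : C) (n : nat) : C := \prod_(0 <= i < n) (a + i%:R).

Lemma rf0 a : rf a 0 = 1. Proof. by rewrite /rf big_nil. Qed.

Lemma rfS a n : rf a n.+1 = rf a n * (a + n%:R).
Proof. by rewrite /rf big_nat_recr. Qed.

Lemma rf_gt0 a n : 0 < a -> 0 < rf a n.
Proof. by move=> a0; apply: prodr_gt0 => i _; rewrite ltr_wpDr ?ler0n. Qed.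

Definition wt1 a n : C := n`!%:R / rf a n.

Lemma wt1_gt0 a n : 0 < a -> 0 < wt1 a n.
Proof. by move=> a0; rewrite divr_gt0 ?rf_gt0 // ltr0n fact_gt0. Qed.

Lemma wt1S a n : 0 < a -> wt1 a n.+1 * (a + n%:R) = wt1 a n * n.+1%:R.
Proof.
move=> a0; rewrite /wt1 rfS factS natrM; field.
by rewrite !gt_eqF ?rf_gt0 // ltr_wpDr ?ler0n.
Qed.

Fixpoint wt al k : C :=
  match al, k with a :: al', i :: k' => wt1 a i * wt al' k' | _, _ => 1 end.

Definition pos al := all (fun a => 0 < a) al.

Lemma wt_gt0 al k : pos al -> 0 < wt al k.
Proof.
elim: al k => [|a al IH] [|i k] //= /andP[a0 p0].
by rewrite mulr_gt0 ?wt1_gt0 ?IH.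
Qed.

Lemma wt_conj al k : pos al -> (wt al k)^* = wt al k.
Proof. by move=> p; apply/CrealP/gtr0_real/wt_gt0. Qed.

(** The inner product of the weighted space on the component of degree D. Different degrees are
    orthogonal, so nothing is lost by fixing one. *)
Definition form al D b c : C :=
  msum (size al) D (fun k => b k * (c k)^* * wt al k).

Lemma form_cons a al D b c :
  form (a :: al) D b c = \sum_(i < D.+1)
    wt1 a i * form al (D - i) (fun k => b (nat_of_ord i :: k)) (fun k => c (nat_of_ord i :: k)).
Proof.
apply: eq_bigr => i _; rewrite /form mulr_msumr; apply: eq_msum => k _ _ /=.
by rewrite mulrCA.
Qed.

Lemma eq_form al D b c b' c' :
  (forall k, size k = size al -> sumn k = D -> b k = b' k) ->
  (forall k, size k = size al -> sumn k = D -> c k = c' k) ->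
  form al D b c = form al D b' c'.
Proof. by move=> e1 e2; apply: eq_msum => k sk kD; rewrite e1 ?e2. Qed.

Lemma formDl al D b b' c :
  form al D (fun k => b k + b' k) c = form al D b c + form al D b' c.
Proof. by rewrite -msumD; apply: eq_msum => k _ _; rewrite !mulrDl. Qed.

Lemma formZl al D x b c : form al D (fun k => x * b k) c = x * form al D b c.
Proof. by rewrite mulr_msumr; apply: eq_msum => k _ _; rewrite !mulrA. Qed.

Lemma formC al D b c : pos al -> form al D c b = (form al D b c)^*.
Proof.
move=> p; rewrite /form (raddf_msum (Num.conj_op : {additive C -> C})); apply: eq_msum => k _ _ /=.
by rewrite !rmorphM /= conjCK wt_conj // [c k * _]mulrC.
Qed.

Lemma formDr al D b c c' :
  form al D b (fun k => c k + c' k) = form al D b c + form al D b c'.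
Proof. by rewrite -msumD; apply: eq_msum => k _ _; rewrite rmorphD mulrDr mulrDl. Qed.

Lemma formZr al D x b c : form al D b (fun k => x * c k) = x^* * form al D b c.
Proof.
by rewrite mulr_msumr; apply: eq_msum => k _ _; rewrite rmorphM mulrCA !mulrA.
Qed.

Lemma form0l al D b c :
  (forall k, size k = size al -> sumn k = D -> b k = 0) -> form al D b c = 0.
Proof. by move=> b0; apply: msum0 => k sk kD; rewrite b0 // !mul0r. Qed.

Lemma form0r al D b c :
  (forall k, size k = size al -> sumn k = D -> c k = 0) -> form al D b c = 0.
Proof. by move=> c0; apply: msum0 => k sk kD; rewrite c0 // conjC0 mulr0 mul0r. Qed.

Lemma form_ge0 al D b : pos al -> 0 <= form al D b b.
Proof.
by move=> p; apply: msum_ge0 => k _ _; rewrite mulr_ge0 ?mul_conjC_ge0 // ltW ?wt_gt0.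
Qed.

Lemma form_def al D b : pos al -> form al D b b = 0 ->
  forall k, size k = size al -> sumn k = D -> b k = 0.
Proof.
move=> p f0 k sk kD.
have ge0 k0 : 0 <= b k0 * (b k0)^* * wt al k0.
  by rewrite mulr_ge0 ?mul_conjC_ge0 // ltW ?wt_gt0.
have /eqP := msum_eq0 (fun k0 _ _ => ge0 k0) f0 sk kD.
by rewrite mulf_eq0 mul_conjC_eq0 (gt_eqF (wt_gt0 _ p)) orbF => /eqP.
Qed.

Definition delta l : seq nat -> C := fun k => (k == l)%:R.

Lemma form_delta al b l : size l = size al ->
  form al (sumn l) b (delta l) = b l * wt al l.
Proof.
move=> sl; rewrite /form (msum_single (k0 := l)) // /delta => [|k _ _ /negPf ->].
  by rewrite eqxx conjC1 mulr1.
by rewrite conjC0 mulr0 mul0r.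
Qed.

(* [b] stands for the series with coefficients [b k]: [Lm] is [sum_j d/dz_j] and [Lp al]
   its adjoint [sum_j (z_j^2 d/dz_j + al_j z_j)]. *)
Fixpoint Lm b k : C :=
  if k is i :: k' then i.+1%:R * b (i.+1 :: k') + Lm (fun x => b (i :: x)) k' else 0.

(** Raises the first exponent from i to i + 1 with the factor [f i]. The factor a + i gives the
    first summand of [Lp], the factor 1 multiplication by z_1. *)
Definition wshift (f : nat -> C) b k : C :=
  if k is i.+1 :: k' then f i * b (i :: k') else 0.

Fixpoint Lp al b k : C :=
  match al, k with
  | a :: al', i :: k' => wshift (fun j => a + j%:R) b k + Lp al' (fun x => b (i :: x)) k'
  | _, _ => 0
  end.

Lemma eq_Lm b c k :
  (forall x, size x = size k -> sumn x = (sumn k).+1 -> b x = c x) -> Lm b k = Lm c k.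
Proof.
elim: k b c => [|i k IH] b c bc //=; congr (_ * _ + _).
  by apply: bc.
by apply: IH => x sx xk; apply: bc => /=; rewrite ?sx // xk addnS.
Qed.

Lemma LmD b c k : Lm (fun x => b x + c x) k = Lm b k + Lm c k.
Proof. by elim: k b c => [|i k IH] b c /=; rewrite ?addr0 // IH; ring. Qed.

Lemma LmZ x b k : Lm (fun y => x * b y) k = x * Lm b k.
Proof. by elim: k b => [|i k IH] b /=; rewrite ?mulr0 // IH; ring. Qed.

Lemma Lm_0 k : Lm (fun=> 0) k = 0.
Proof. by elim: k => [|i k IH] //=; rewrite IH mulr0 addr0. Qed.

Lemma eq_Lp al b c k :
  (forall x, size x = size k -> (sumn x).+1 = sumn k -> b x = c x) -> Lp al b k = Lp al c k.
Proof.
elim: al b c k => [|a al IH] b c [|i k] //= bc; congr (_ + _).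
  by case: i bc => // i bc; rewrite /= bc //.
by apply: IH => x sx xk; apply: bc => /=; rewrite ?sx // -xk addnS.
Qed.

Lemma LpD al b c k : Lp al (fun x => b x + c x) k = Lp al b k + Lp al c k.
Proof.
elim: al b c k => [|a al IH] b c [|[|i] k] //=; rewrite ?addr0 // IH; ring.
Qed.

Lemma LpZ al x b k : Lp al (fun y => x * b y) k = x * Lp al b k.
Proof.
elim: al b k => [|a al IH] b [|[|i] k] //=; rewrite ?mulr0 // IH; ring.
Qed.

Lemma Lp_deg0 al b k : sumn k = 0%N -> Lp al b k = 0.
Proof.
elim: al b k => [|a al IH] b [|[|i] k] //= k0.
by rewrite IH // addr0.
Qed.

(** In the first variable, raising on the left becomes lowering on the right after an index shift,
    by [wt1S]; the other variables are the induction hypothesis. The raised terms have no summand i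
    = 0, the others none at i = D + 1, where the remaining degree is 0. *)
Lemma form_adj al D b c : pos al ->
  form al D.+1 (Lp al b) c = form al D b (Lm c).
Proof.
elim: al D b c => [|a al IH] D b c.
  by move=> _; rewrite /form /=; case: eqP => // _; rewrite conjC0 mulr0 mul0r.
case/andP=> a0 p; rewrite !form_cons.
under eq_bigr => i _ do rewrite /= formDl mulrDr.
rewrite big_split /= big_ord_recl /= [X in wt1 a 0 * X]form0l // mulr0 add0r.
rewrite [X in _ + X]big_ord_recr /= subnn.
rewrite [form al 0 _ _]form0l ?mulr0 ?addr0 => [|k _ k0]; last by rewrite Lp_deg0.
rewrite -big_split /=; apply: eq_bigr => i _.
rewrite /bump /= add1n subSS formDr mulrDr; congr (_ + _).
  rewrite formZl formZr mulrA wt1S // conjC_nat; ring.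
have iD : (i <= D)%N by rewrite -ltnS.
by rewrite subSn // IH.
Qed.

(** The sl_2 relation. In one variable the commutator of d/dz and z^2 d/dz + a z is 2 z d/dz + a,
    and operators in different variables commute. *)
Lemma LmLp al b k : size k = size al ->
  Lm (Lp al b) k = Lp al (Lm b) k + (2 * (sumn k)%:R + \sum_(a <- al) a) * b k.
Proof.
elim: al b k => [|a al IH] b [|i k] //=; first by rewrite big_nil mulr0 addr0 mul0r addr0.
case=> sk; rewrite (LmD (fun x => wshift _ b (i :: x))) IH // LpD LpZ big_cons natrD.
have -> : Lm (fun x => wshift (fun j => a + j%:R) b (i :: x)) k =
          wshift (fun j => a + j%:R) (fun y => Lm (fun x => b (head 0%N y :: x)) (behead y)) (i :: k).
  by case: i => [|i] /=; rewrite ?LmZ // Lm_0.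
by case: i => [|i] /=; rewrite ?natr1 -?natr1; ring.
Qed.

Lemma Lp_0 al k : Lp al (fun=> 0) k = 0.
Proof. by elim: al k => [|a al IH] [|[|i] k] //=; rewrite IH ?mulr0 addr0. Qed.

Definition homog (e : nat) (Q : seq nat -> C) := forall k, sumn k <> e -> Q k = 0.

Lemma homog_iter_Lp al e Q j : homog e Q -> homog (e + j) (iter j (Lp al) Q).
Proof.
elim: j => [|j IH] hQ k; first by rewrite addn0 => /hQ.
move=> kD; rewrite iterS (@eq_Lp _ _ (fun=> 0)) ?Lp_0 // => x _ xk.
by apply: IH => // xj; apply: kD; rewrite -xk xj addnS.
Qed.

Section Tower.
Variables (al : seq C) (e : nat).
Let be : C := \sum_(a <- al) a + 2 * e%:R.

(* The series sum_j Lp^j Q / (be)_j : for a lowest weight vector Q its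
   homogeneous components behave under Lp and Lm as the powers z^j do in one
   variable with weight be. *)
Definition tower Q : seq nat -> C := fun k =>
  if (e <= sumn k)%N then iter (sumn k - e) (Lp al) Q k / rf be (sumn k - e) else 0.

(** Only lists of length [size al] are exponents here, so annihilation by [Lm] is asked for at these
    alone. *)
Definition lowest Q := homog e Q /\ forall k, size k = size al -> Lm Q k = 0.

Lemma tower_bottom Q k : sumn k = e -> tower Q k = Q k.
Proof. by move=> ke; rewrite /tower ke leqnn subnn rf0 divr1. Qed.

Lemma tower_below Q k : (sumn k < e)%N -> tower Q k = 0.
Proof. by rewrite /tower ltnNge => /negPf ->. Qed.

Hypothesis al_pos : pos al.
Hypothesis al_neq0 : al != [::].

Lemma be_gt0 : 0 < be.
Proof.
rewrite ltr_wpDr ?mulr_ge0 ?ler0n //.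
case: al al_pos al_neq0 => // a al' /= /andP[a0 p] _; rewrite big_cons ltr_wpDr //.
by rewrite big_seq sumr_ge0 // => x xal; rewrite ltW // (allP p).
Qed.

Let beD_neq0 j : be + j%:R != 0.
Proof. by rewrite gt_eqF // ltr_wpDr ?ler0n ?be_gt0. Qed.

(** Moving [Lm] through j + 1 factors [Lp] collects the commutators be + 2 i for i = 0, ..., j,
    whose sum is (j + 1) (be + j). *)
Lemma Lm_iter_Lp Q j k : lowest Q -> size k = size al ->
  Lm (iter j.+1 (Lp al) Q) k = j.+1%:R * (be + j%:R) * iter j (Lp al) Q k.
Proof.
move=> [hQ lQ]; elim: j k => [|j IH] k sk; rewrite iterS LmLp //.
  rewrite (@eq_Lp _ _ (fun=> 0)) ?Lp_0 /= => [|x sx _]; last by rewrite lQ ?sx.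
  case: (eqVneq (sumn k) e) => [->|/eqP/hQ ->]; last by rewrite !mulr0 addr0.
  by rewrite /be /=; ring.
rewrite (@eq_Lp _ _ (fun x => j.+1%:R * (be + j%:R) * iter j (Lp al) Q x)); last first.
  by move=> x sx _; rewrite IH ?sx.
rewrite LpZ -iterS; case: (eqVneq (sumn k) (e + j.+1)%N) => [->|/eqP ke].
  by rewrite /be natrD -!natr1; ring.
by rewrite (homog_iter_Lp al hQ ke) !mulr0 addr0.
Qed.

Lemma Lp_tower Q k : size k = size al ->
  Lp al (tower Q) k = (if (e < sumn k)%N then be + (sumn k - e).-1%:R else 0) * tower Q k.
Proof.
move=> sk; case: ltnP => [ek|ke]; last first.
  rewrite mul0r (@eq_Lp _ _ (fun=> 0)) ?Lp_0 // => x _ xk.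
  by rewrite tower_below // xk.
set j := (sumn k - e).-1; have kj : sumn k = (e + j).+1 by rewrite /j; lia.
rewrite (@eq_Lp _ _ (fun x => (rf be j)^-1 * iter j (Lp al) Q x)) => [|x sx xk].
  rewrite LpZ /tower ltnW // kj -addnS addKn rfS /=; field.
  by rewrite beD_neq0 gt_eqF // rf_gt0 // be_gt0.
have xj : sumn x = (e + j)%N by lia.
by rewrite /tower xj leq_addr addKn mulrC.
Qed.

Lemma Lm_tower Q k : lowest Q -> size k = size al ->
  Lm (tower Q) k = (sumn k - e).+1%:R * tower Q k.
Proof.
move=> lQ sk; case: (leqP e (sumn k)) => [ek|ke].
  set j := (sumn k - e)%N; have kj : sumn k = (e + j)%N by rewrite /j; lia.
  rewrite (@eq_Lm _ (fun x => (rf be j.+1)^-1 * iter j.+1 (Lp al) Q x)) => [|x sx xk].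
    rewrite LmZ Lm_iter_Lp // /tower ek -/j rfS; field.
    by rewrite beD_neq0 gt_eqF // rf_gt0 // be_gt0.
  have xj : sumn x = (e + j.+1)%N by lia.
  by rewrite /tower xj leq_addr addKn mulrC.
rewrite tower_below // mulr0.
rewrite -[RHS](lQ.2 k sk); apply: eq_Lm => x sx xk; case: (eqVneq (sumn x) e) => [xe|/eqP xe].
  by rewrite tower_bottom.
by rewrite (lQ.1 x xe) tower_below //; lia.
Qed.

(** Moving one [Lp] across by adjunction passes from degree e + j + 1 to e + j with the recursion
    [wt1S]. A tower thus has the norms of the powers of a single variable of weight [be], up to the
    norm of its bottom vector. *)
Lemma form_tower Q Q' D : lowest Q -> lowest Q' ->
  form al D (tower Q) (tower Q') =
  if (e <= D)%N then wt1 be (D - e) * form al e Q Q' else 0.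
Proof.
move=> lQ lQ'; case: leqP => [eD|De]; last first.
  by apply: form0l => k _ kD; rewrite tower_below // kD.
rewrite -(subnKC eD); elim: (D - e)%N => {D eD} [|j IH].
  rewrite addn0 subnn /wt1 rf0 fact0 divr1 mul1r.
  by apply: eq_form => k _ ke; apply: tower_bottom.
have E := form_adj (e + j) (tower Q) (tower Q') al_pos.
rewrite (@eq_form _ _ (Lp _ _) _ (fun k => (be + j%:R) * tower Q k) (tower Q')) // in E; last first.
  by move=> k sk kD; rewrite Lp_tower // ifT ?kD; [congr ((_ + _%:R) * _)|]; lia.
rewrite (@eq_form _ _ _ (Lm _) (tower Q) (fun k => j.+1%:R * tower Q' k)) // in E; last first.
  by move=> k sk kD; rewrite Lm_tower // kD addKn.
rewrite formZl formZr IH conjC_nat addKn in E.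
apply: (mulfI (beD_neq0 j)); rewrite addnS E -addnS addKn.
by rewrite mulrA [_ * wt1 _ _]mulrC -(wt1S _ be_gt0) /=; ring.
Qed.

End Tower.

(** With e < e', adjunction lowers the degree step by step, with a nonzero factor on the side of Q,
    until the tower over Q' has no component left. *)
Lemma form_tower_neq al e e' Q Q' D : pos al -> al != [::] -> e <> e' ->
  lowest al e Q -> lowest al e' Q' -> form al D (tower al e Q) (tower al e' Q') = 0.
Proof.
move=> p n; wlog lt : e e' Q Q' / (e < e')%N => [wl|_ lQ lQ'].
  move=> ne lQ lQ'; case: (ltngtP e e') => // [lt|lt]; first exact: wl.
  by rewrite formC // wl ?conjC0 // => /esym.
elim: D => [|D IH].
  by apply: form0r => k _ kD; rewrite tower_below // kD; lia.
case: (leqP D.+1 e) => De.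
  by apply: form0r => k _ kD; rewrite tower_below // kD; lia.
have E := form_adj D (tower al e Q) (tower al e' Q') p.
set be := \sum_(a <- al) a + 2 * e%:R.
rewrite (@eq_form _ _ (Lp _ _) _ (fun k => (be + (D - e)%:R) * tower al e Q k) (tower al e' Q')) // in E; last first.
  by move=> k sk kD; rewrite Lp_tower // ifT ?kD; [congr ((_ + _%:R) * _)|]; lia.
rewrite (@eq_form _ _ _ (Lm _) (tower al e Q) (fun k => (D - e').+1%:R * tower al e' Q' k)) // in E; last first.
  by move=> k sk kD; rewrite Lm_tower // kD.
rewrite formZl formZr IH mulr0 in E; move/eqP: E; rewrite mulf_eq0 => /orP[|/eqP //].
by rewrite gt_eqF // ltr_wpDr ?ler0n ?be_gt0.
Qed.

(** * Replacing the powers of a variable by the components of a tower *)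

Section Embed.
Variables (a : C) (al : seq C) (e : nat).
Let be : C := \sum_(x <- al) x + 2 * e%:R.

(* Sends z_1^i z_2^j to z_1^i times the component of degree e + j of T. *)
Definition embed (T : seq nat -> C) b k : C :=
  if k is i :: k' then b [:: i; (sumn k' - e)%N] * T k' else 0.

(** The first variable is untouched, and on the others [Lp_tower] is the one-variable formula with
    weight [be]. Below degree e the truncated subtraction gives exponent 0, but there the tower
    vanishes. *)
Lemma Lp_embed Q b k : pos al -> al != [::] -> size k = (size al).+1 ->
  Lp (a :: al) (embed (tower al e Q) b) k = embed (tower al e Q) (Lp [:: a; be] b) k.
Proof.
case: k => [|i k] // p n [sk] /=; rewrite addr0 mulrDl; congr (_ + _).
  by case: i => [|i] /=; rewrite ?mul0r // mulrA.
case: (ltnP e (sumn k)) => [ek|ke]; last first.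
  rewrite (@eq_Lp _ _ (fun=> 0)) ?Lp_0 => [|x sx xk]; last by rewrite tower_below ?mulr0 // xk.
  by move: ke; rewrite /leq => /eqP -> /=; rewrite mul0r.
have -> : (sumn k - e = (sumn k - e).-1.+1)%N by lia.
rewrite (@eq_Lp _ _ (fun x => b [:: i; (sumn k - e).-1] * tower al e Q x)) => [|x sx xk].
  by rewrite LpZ Lp_tower // ek /= -/be; ring.
by congr (b [:: i; _] * _); lia.
Qed.

Lemma Lm_embed Q b k : pos al -> al != [::] -> lowest al e Q -> size k = (size al).+1 ->
  Lm (embed (tower al e Q) b) k = embed (tower al e Q) (Lm b) k.
Proof.
case: k => [|i k] // p n lQ [sk] /=; rewrite addr0 mulrDl mulrA; congr (_ + _).
case: (leqP e (sumn k)) => [ek|ke]; last first.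
  rewrite tower_below // mulr0 (@eq_Lm _ (fun x => b [:: i; 0%N] * tower al e Q x)); last first.
    by move=> x sx xk; congr (b [:: i; _] * _); lia.
  by rewrite LmZ Lm_tower // tower_below // !mulr0.
rewrite (@eq_Lm _ (fun x => b [:: i; (sumn k - e).+1] * tower al e Q x)); last first.
  by move=> x sx xk; congr (b [:: i; _] * _); lia.
by rewrite LmZ Lm_tower //; ring.
Qed.

End Embed.

Lemma form2 x y D b b' :
  form [:: x; y] D b b' = \sum_(i < D.+1)
    wt1 x i * (b [:: nat_of_ord i; (D - i)%N] * (b' [:: nat_of_ord i; (D - i)%N])^* * wt1 y (D - i)).
Proof.
rewrite form_cons; apply: eq_bigr => i _; congr (_ * _).
rewrite /form (msum_single (k0 := [:: (D - i)%N])) //= ?addn0 ?mulr1 //.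
by move=> [|j []] //= _; rewrite addn0 => ->; rewrite eqxx.
Qed.

Lemma form_embed_layer a al e e' T T' b b' D :
  form (a :: al) D (embed e T b) (embed e' T' b') = \sum_(i < D.+1)
    wt1 a i * (b [:: nat_of_ord i; (D - i - e)%N] * (b' [:: nat_of_ord i; (D - i - e')%N])^*
    * form al (D - i) T T').
Proof.
rewrite form_cons; apply: eq_bigr => i _; congr (_ * _); rewrite -mulrA -formZr -formZl.
by apply: eq_form => k _ kD /=; rewrite kD.
Qed.

(** The hypothesis on [T] is the norm formula of a tower. The layers of degree D - i >= e in the
    last variables are then those of the two-variable form in degree D - e; the other layers
    vanish. *)
Lemma form_embed a al e T N b b' D :
  let be := \sum_(x <- al) x + 2 * e%:R in
  (forall K, form al K T T = if (e <= K)%N then wt1 be (K - e) * N else 0) ->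
  form (a :: al) D (embed e T b) (embed e T b') =
  if (e <= D)%N then N * form [:: a; be] (D - e) b b' else 0.
Proof.
move=> be fT; rewrite form_embed_layer.
case: leqP => [eD|De]; last first.
  by apply: big1 => i _; rewrite fT ifF ?mulr0 //; lia.
rewrite form2 mulr_sumr.
rewrite -(big_mkord xpredT (fun i => wt1 a i * (b [:: i; (D - i - e)%N] * (b' [:: i; (D - i - e)%N])^*
    * form al (D - i) T T))).
rewrite (big_cat_nat (n := (D - e).+1)) //=; last by rewrite ltnS leq_subr.
rewrite [X in _ + X]big1_seq ?addr0 => [|i]; last first.
  by rewrite mem_index_iota => /andP[_ /andP[i1 i2]]; rewrite fT ifF ?mulr0 //; lia.
rewrite big_mkord; apply: eq_bigr => i _; have iD := ltn_ord i.
rewrite fT ifT; last by lia.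
have -> : (D - i - e = D - e - i)%N by lia.
ring.
Qed.

(* The coefficients of (z_2 - z_1)^n. *)
Definition low2 (n : nat) k : C :=
  if k is [:: i; j] then if (i + j == n)%N then (-1) ^+ i * 'C(n, i)%:R else 0 else 0.

(** (z_2 - z_1)^n is invariant under translations along the diagonal. *)
Lemma Lm_low2 n k : size k = 2 -> Lm (low2 n) k = 0.
Proof.
case: k => [|i [|j []]] //= _; rewrite addr0 addSn addnS.
case: eqP => [nE|_]; last by rewrite !mulr0 addr0.
have : (i.+1 * 'C(n, i.+1) = j.+1 * 'C(n, i))%N.
  by rewrite mul_bin_left -nE subSn ?leq_addr // addKn.
move/(congr1 (fun x : nat => x%:R : C)); rewrite !natrM => E.
by rewrite [X in _ + X]mulrCA -E exprS; ring.
Qed.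

(* The lowest weight vector of the module of index l: it is built from that of the
   tail of l in one variable less by applying [embed] to [low2]. *)
Fixpoint Qf al l : seq nat -> C :=
  match al with
  | [::] => fun=> 0
  | a :: al' =>
    if al' is [::] then delta [:: 0%N] else
    if l is n :: l' then embed (sumn l') (tower al' (sumn l') (Qf al' l')) (low2 n) else fun=> 0
  end.

Lemma Qf_cons a a' al n l : Qf [:: a, a' & al] (n :: l) =
  embed (sumn l) (tower (a' :: al) (sumn l) (Qf (a' :: al) l)) (low2 n).
Proof. by []. Qed.

Definition Tf al l := tower al (sumn l) (Qf al l).

Lemma Qf_lowest al l : pos al -> al != [::] -> size l = (size al).-1 -> lowest al (sumn l) (Qf al l).
Proof.
elim: al l => [|a [|a' al] IH] l // /andP[a0 p] _.
  case: l => // _; split=> [k k0 | [|i []] //= _]; last first.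
    by rewrite addr0 /delta eqseq_cons mulr0.
  change (delta [:: 0%N] k = 0).
  by rewrite /delta; case: (eqVneq k [:: 0%N]) => // kE; case: k0; rewrite kE.
case: l => // n l [sl]; have lQ := IH l p isT sl; rewrite -/(Qf [:: a, a' & al] (n :: l)) Qf_cons.
split=> [[|i k] //= |[|i k] // [sk]].
  case: (leqP (sumn l) (sumn k)) => [lk|kl]; last by rewrite tower_below ?mulr0.
  by move=> kD; rewrite ifF ?mul0r //; lia.
rewrite Lm_embed //; last by rewrite /= sk.
by rewrite -[LHS]/(Lm (low2 n) [:: i; (sumn k - sumn l)%N] * _) Lm_low2 // mul0r.
Qed.

Lemma form_Tf al l D : pos al -> al != [::] -> size l = (size al).-1 ->
  form al D (Tf al l) (Tf al l) = if (sumn l <= D)%N then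
    wt1 (\sum_(a <- al) a + 2 * (sumn l)%:R) (D - sumn l) * form al (sumn l) (Qf al l) (Qf al l) else 0.
Proof. by move=> p n sl; rewrite form_tower //; apply: Qf_lowest. Qed.

Lemma form_low2_gt0 x y n : 0 < x -> 0 < y -> 0 < form [:: x; y] n (low2 n) (low2 n).
Proof.
move=> x0 y0; rewrite lt_def form_ge0 /= ?x0 ?y0 // andbT; apply/eqP => f0.
have := @form_def [:: x; y] n (low2 n) _ f0 [:: 0%N; n]; rewrite /= x0 y0 addn0 eqxx bin0 => /(_ isT erefl erefl).
by apply/eqP; rewrite expr0 mulr1 oner_eq0.
Qed.

Lemma form_Qf_gt0 al l : pos al -> al != [::] -> size l = (size al).-1 ->
  0 < form al (sumn l) (Qf al l) (Qf al l).
Proof.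
elim: al l => [|a [|a' al] IH] l // /andP[a0 p] _.
  case: l => // _; rewrite (form_delta (al := [:: a]) (delta [:: 0%N]) (l := [:: 0%N])) //.
  by rewrite /delta eqxx mul1r wt_gt0 //= a0.
case: l => // n l [sl]; rewrite -[sumn (n :: l)]/(n + sumn l)%N.
have F := form_embed a (e := sumn l) (T := Tf (a' :: al) l) (low2 n) (low2 n) (n + sumn l)
  (fun K => @form_Tf (a' :: al) l K p isT sl).
rewrite F leq_addl addnK mulr_gt0 ?IH // form_low2_gt0 //.
by apply: be_gt0.
Qed.

(** If the tails agree, the first entries differ and the two vectors live in different degrees. If
    not, the towers over the tails are orthogonal, either by induction or because they start in
    different degrees. *)
Lemma form_Qf_neq al l l' D : pos al -> al != [::] -> size l = (size al).-1 ->
  size l' = (size al).-1 -> l <> l' -> form al D (Qf al l) (Qf al l') = 0.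
Proof.
elim: al l l' D => [|a [|a' al] IH] l l' D // /andP[a0 p] _; first by case: l; case: l'.
have n1 : a' :: al != [::] by [].
case: l => // n l; case: l' => // n' l' [sl] [sl'] ll'.
have lw := @Qf_lowest (a :: a' :: al).
case: (eqVneq l l') => [E|/eqP nE].
  have nn : n <> n' by move=> nE; apply: ll'; rewrite nE E.
  case: (eqVneq D (sumn (n :: l))) => [DE|/eqP DE].
    apply: form0r => k sk kD; apply: (lw (n' :: l') _ _ _).1 => //=; first by rewrite a0.
      by rewrite sl'.
    by rewrite kD DE /= E; lia.
  apply: form0l => k sk kD; apply: (lw (n :: l) _ _ _).1 => //=; first by rewrite a0.
    by rewrite sl.
  by rewrite kD.
rewrite /= form_embed_layer big1 // => i _.
suff -> : form (a' :: al) (D - i) (tower (a' :: al) (sumn l) (Qf (a' :: al) l))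
   (tower (a' :: al) (sumn l') (Qf (a' :: al) l')) = 0 by rewrite !mulr0.
case: (eqVneq (sumn l) (sumn l')) => [E|/eqP ne]; last by rewrite form_tower_neq //; apply: Qf_lowest.
rewrite -E form_tower //; [|exact: Qf_lowest|rewrite E; exact: Qf_lowest].
by rewrite IH // mulr0 if_same.
Qed.

Lemma form_Tf_neq al l l' D : pos al -> al != [::] -> size l = (size al).-1 ->
  size l' = (size al).-1 -> l <> l' -> form al D (Tf al l) (Tf al l') = 0.
Proof.
move=> p n sl sl' ll'.
case: (eqVneq (sumn l) (sumn l')) => [E|/eqP ne]; last by rewrite form_tower_neq //; apply: Qf_lowest.
rewrite /Tf -E form_tower //; [|exact: Qf_lowest|rewrite E; exact: Qf_lowest].
by rewrite form_Qf_neq // mulr0 if_same.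
Qed.

Lemma form_adjr al D b c : pos al -> form al D.+1 c (Lp al b) = form al D (Lm c) b.
Proof. by move=> p; rewrite formC // form_adj // -formC. Qed.

Lemma form_Lp_tower al e Q h D : pos al -> al != [::] -> (e <= D)%N ->
  form al D (Lm h) (tower al e Q) =
  (\sum_(a <- al) a + 2 * e%:R + (D - e)%:R) * form al D.+1 h (tower al e Q).
Proof.
move=> p n eD; set x := _ + _%:R.
have <- : x^* = x.
  by apply/CrealP/gtr0_real; rewrite ltr_wpDr ?ler0n // be_gt0.
rewrite -form_adjr // -formZr; apply: eq_form => // k sk kD.
by rewrite Lp_tower // ifT kD ?ltnS // subSn.
Qed.

(** If h of degree D + 1 is orthogonal to all towers, then so is [Lm h] in degree D, by adjunction.
    By induction [Lm h] is 0, so h is of lowest weight and is detected by the bottoms [Qf] of the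
    towers. *)
Lemma Tf_complete_of_Qf al : pos al -> al != [::] ->
  (forall D h, (forall k, size k = size al -> (sumn k).+1 = D -> Lm h k = 0) ->
    (forall l, size l = (size al).-1 -> sumn l = D -> form al D h (Qf al l) = 0) ->
    forall k, size k = size al -> sumn k = D -> h k = 0) ->
  forall D h, (forall l, size l = (size al).-1 -> (sumn l <= D)%N -> form al D h (Tf al l) = 0) ->
    forall k, size k = size al -> sumn k = D -> h k = 0.
Proof.
move=> p n Qc; elim=> [|D IH] h hT; apply: Qc => //.
  move=> l sl lD; rewrite -(hT l) ?lD //; apply: eq_form => // k sk kD.
  by rewrite /Tf tower_bottom ?lD.
- move=> k sk [kD]; apply: IH kD => // l sl lD.
  by rewrite form_Lp_tower // hT ?mulr0 // leqW.
- move=> l sl lD; rewrite -(hT l) ?lD //; apply: eq_form => // k sk kD.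
  by rewrite /Tf tower_bottom ?lD.
Qed.

(** A lowest weight h is cut into slices by its first exponent. Translation invariance determines
    the pairing of every slice with a tower from that of the slice 0, and orthogonality to one
    vector [Qf] kills the latter. *)
Lemma Qf_complete al : pos al -> al != [::] ->
  forall D h, (forall k, size k = size al -> (sumn k).+1 = D -> Lm h k = 0) ->
    (forall l, size l = (size al).-1 -> sumn l = D -> form al D h (Qf al l) = 0) ->
    forall k, size k = size al -> sumn k = D -> h k = 0.
Proof.
elim: al => [|a [|a' al] IH] // /andP[a0 p] _ D h hL hQ.
  case=> [|i []] // _; rewrite /= addn0 => iD; case: D iD hL hQ => [|D] -> hL hQ.
    have /eqP := hQ [::] erefl erefl.
    rewrite (form_delta (al := [:: a]) h (l := [:: 0%N])) // mulf_eq0 [X in _ || X]gt_eqF ?orbF.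
      by move/eqP.
    by rewrite wt_gt0 //= a0.
  have := hL [:: D] erefl; rewrite /= addn0 addr0 => /(_ erefl)/eqP.
  by rewrite mulf_eq0 pnatr_eq0 => /eqP.
have n1 : a' :: al != [::] by [].
have Tc := @Tf_complete_of_Qf (a' :: al) p n1 (IH p n1).
case=> [|i0 k0] // [sk0] kD0.
apply: (Tc (D - i0)%N (fun k => h (i0 :: k))) => //; last by rewrite -kD0 /= addKn.
move=> l sl; set e := sumn l; set al' := a' :: al => eD.
(* By completeness in one variable less, it suffices that each slice of h is orthogonal to each
   tower. *)
pose x i := form al' (D - i) (fun k => h (i :: k)) (Tf al' l).
rewrite -/(x i0); have i0D : (i0 + e <= D)%N by move: kD0 => /=; lia.
pose be := \sum_(a <- al') a + 2 * e%:R.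
have be0 : 0 < be by apply: be_gt0.
have step i : (i + e < D)%N -> i.+1%:R * x i.+1 + (be + (D - i.+1 - e)%:R) * x i = 0.
  move=> iD; have Di : (D - i = (D - i.+1).+1)%N by lia.
  rewrite /x [in X in _ + X]Di -form_Lp_tower //; last by rewrite -/e; lia.
  rewrite -formZl -formDl; apply: form0l => k sk kD.
  rewrite -[LHS]/(Lm h (i :: k)); apply: hL; rewrite /= ?sk // kD; lia.
have closed i : (i + e <= D)%N -> exists2 r, 0 <= r & x i = (-1) ^+ i * r * x 0%N.
  elim: i => [|i IHi] iD; first by exists 1; rewrite ?ler01 // !mul1r.
  have [r r0 xr] := IHi (ltnW iD).
  exists ((be + (D - i.+1 - e)%:R) * r / i.+1%:R).
    by rewrite divr_ge0 ?ler0n // mulr_ge0 // addr_ge0 ?ler0n // ltW.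
  apply: (mulfI (x := i.+1%:R)); first by rewrite pnatr_eq0.
  apply/eqP; rewrite -subr_eq0 -(step i iD) xr exprS; apply/eqP; field.
  by rewrite ?natr1 ?nat1r pnatr_eq0.
have eD' : (e <= D)%N by apply: leq_trans i0D; rewrite leq_addl.
have := hQ ((D - e)%N :: l); rewrite /= sl -/e subnK // => /(_ erefl erefl).
rewrite -[tower _ _ _]/(Tf al' l) form_cons /=.
under eq_bigr => i _.
  rewrite (@eq_form _ _ _ _ (fun k => h (nat_of_ord i :: k))
     (fun k => low2 (D - e) [:: nat_of_ord i; (D - i - e)%N] * Tf al' l k)) //; last first.
    by move=> k _ kD; rewrite /embed kD.
  rewrite formZr -/(x i).
  over.
move=> S0.
(* The sign of [low2] at i cancels the sign in [closed], so every term is a nonnegative multiple of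
   [x 0]; the term with i = 0 is a positive one, and no cancellation can occur. *)
have term (i : 'I_D.+1) : exists2 r, 0 <= r &
   wt1 a i * ((low2 (D - e) [:: nat_of_ord i; (D - i - e)%N])^* * x i) = r * x 0%N.
  case: (leqP (i + e) D) => iD.
    have [r r0 ->] := closed i iD; exists (wt1 a i * 'C(D - e, i)%:R * r).
      by apply: mulr_ge0 => //; apply: mulr_ge0; rewrite ?ler0n // ltW // wt1_gt0.
    rewrite /= ifT ?rmorphM ?rmorphXn ?rmorphN1 ?conjC_nat /=; last by lia.
    rewrite -signr_odd; case: odd; rewrite ?expr0 ?expr1; ring.
  by exists 0 => //; rewrite /= ifF ?conjC0 ?mul0r ?mulr0 //; lia.
have x00 : x 0%N = 0.
  rewrite big_ord_recl /= subn0 add0n eqxx bin0 mulr1 rmorphXn expr0 mul1r in S0.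
  have [r r0 Er] : exists2 r, 0 <= r & \sum_(i < D)
      wt1 a (lift ord0 i) * ((low2 (D - e) [:: nat_of_ord (lift ord0 i); (D - (lift ord0 i) - e)%N])^* * x (lift ord0 i)) = r * x 0%N.
    elim/big_ind: _ => [|u v [r r0 ->] [r' r'0 ->]|i _]; last exact: term.
      by exists 0; rewrite ?mul0r.
    by exists (r + r'); rewrite ?addr_ge0 ?mulrDl.
  rewrite /= in Er; rewrite Er -mulrDl in S0.
  move/eqP: S0; rewrite mulf_eq0 => /orP[|/eqP //].
  by rewrite gt_eqF // ltr_wpDr // wt1_gt0.
by have [r _ ->] := closed i0 i0D; rewrite x00 mulr0.
Qed.

Lemma Tf_complete al D h : pos al -> al != [::] ->
  (forall l, size l = (size al).-1 -> (sumn l <= D)%N -> form al D h (Tf al l) = 0) ->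
  forall k, size k = size al -> sumn k = D -> h k = 0.
Proof. by move=> p n; apply: Tf_complete_of_Qf => //; apply: Qf_complete. Qed.

End Formal.

Notation normc := Normc.normc.

(** * Hilbert spaces *)

Section ComplexNumbers.
Variable R : realType.
Local Notation C := R[i].
Implicit Types x y z : C.

Lemma normE x : `|x| = (normc x)%:C%C. Proof. by case: x. Qed.

Lemma normc_ge0 x : 0 <= normc x.
Proof. by case: x => a b; rewrite sqrtr_ge0. Qed.
Hint Resolve normc_ge0 : core.

Lemma normcM x y : normc (x * y) = normc x * normc y.
Proof. exact: Normc.normcM. Qed.

Lemma ler_normcD x y : normc (x + y) <= normc x + normc y.
Proof. exact: le_normcD. Qed.

Lemma normcN x : normc (- x) = normc x. Proof. exact: normcN. Qed.

Lemma normcB x y : normc (x - y) = normc (y - x).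
Proof. by rewrite -normcN opprB. Qed.

Lemma ler_normcB x y : normc (x - y) <= normc x + normc y.
Proof. by rewrite -(normcN y) ler_normcD. Qed.

Lemma normc0 : normc (0 : C) = 0. Proof. exact: Normc.normc0. Qed.

Lemma normc1 : normc (1 : C) = 1. Proof. exact: Normc.normc1. Qed.

Lemma normcJ x : normc x^* = normc x.
Proof. by case: x => a b /=; rewrite sqrrN. Qed.

Lemma normcR (a : R) : normc (a%:C)%C = `|a|.
Proof. by rewrite /= expr0n addr0 sqrtr_sqr. Qed.

Lemma normcX x n : normc (x ^+ n) = normc x ^+ n.
Proof. by elim: n => [|n IH]; rewrite ?normc1 // !exprS normcM IH. Qed.

Lemma normcn n : normc (n%:R : C) = n%:R.
Proof. by rewrite -[n%:R](rmorph_nat (real_complex R)) normcR ger0_norm ?ler0n. Qed.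

Lemma normc_prod (I : Type) (r : seq I) (P : pred I) (F : I -> C) :
  normc (\prod_(i <- r | P i) F i) = \prod_(i <- r | P i) normc (F i).
Proof. by apply: (big_morph _ normcM normc1). Qed.

Lemma ler_normc_sum (I : Type) (r : seq I) (P : pred I) (F : I -> C) :
  normc (\sum_(i <- r | P i) F i) <= \sum_(i <- r | P i) normc (F i).
Proof.
elim/big_ind2: _ => [|x a y b xa yb|//]; first by rewrite normc0.
by apply: le_trans (ler_normcD _ _) _; apply: lerD.
Qed.

Lemma ler_Re_normc x : complex.Re x <= normc x.
Proof.
case: x => a b /=; apply: le_trans (ler_norm a) _; rewrite -sqrtr_sqr.
by rewrite ler_wsqrtr // lerDl sqr_ge0.
Qed.

Lemma mulC_conj x : x * x^* = (normc x ^+ 2)%:C%C.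
Proof. by rewrite -normCK normE rmorphXn. Qed.

Lemma ge0_Re x : 0 <= x -> x = (complex.Re x)%:C%C.
Proof. by move=> /ger0_Im; case: x => a b /= ->. Qed.

Lemma Re_ge0 x : 0 <= x -> 0 <= complex.Re x.
Proof. by move=> x0; rewrite -ler0c -ge0_Re. Qed.

Lemma ReD x y : complex.Re (x + y) = complex.Re x + complex.Re y.
Proof. by case: x; case: y. Qed.

Lemma ReN x : complex.Re (- x) = - complex.Re x.
Proof. by case: x. Qed.

Lemma ReB x y : complex.Re (x - y) = complex.Re x - complex.Re y.
Proof. by rewrite ReD ReN. Qed.

Lemma normc_le_ReIm x : normc x <= `|complex.Re x| + `|complex.Im x|.
Proof.
rewrite {1}(complexE x); apply: le_trans (ler_normcD _ _) _; rewrite normcM !normcR.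
by rewrite [normc 'i%C]/= expr0n expr1n add0r sqrtr1 mul1r.
Qed.

Lemma ReJ x : complex.Re x^* = complex.Re x.
Proof. by case: x. Qed.

Lemma ReMR (a : R) x : complex.Re ((a%:C)%C * x) = a * complex.Re x.
Proof. by case: x => u v /=; rewrite mul0r subr0. Qed.

(** The radii of balls in [C^o] are positive elements of the field C itself; their real parts give
    ordinary real radii. *)
Lemma ccvgP (u : nat -> C^o) (l : C^o) : u @ \oo --> l <->
  forall e : R, 0 < e -> exists N, forall n, (N <= n)%N -> normc (u n - l) < e.
Proof.
split=> [/cvgrPdist_lt ul e e0 | ul].
  have [|N _ Nu] := ul (e%:C)%C; first by rewrite ltcR.
  by exists N => n /Nu /=; rewrite normE ltcR normcB.
apply/cvgrPdist_lt => e e0; have eE := ge0_Re (ltW e0).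
have [|N Nu] := ul (complex.Re e); first by rewrite -ltcR -eE.
exists N => // n /Nu; rewrite normE [X in _ < X -> _]/= => h.
by rewrite eE ltcR normcB.
Qed.

Lemma ccvgZ (a : C) (u : nat -> C^o) (l : C^o) : u @ \oo --> l ->
  (fun n => a * u n : C^o) @ \oo --> (a * l : C^o).
Proof.
move=> /ccvgP ul; apply/ccvgP => e e0; have a0 : 0 < normc a + 1 by rewrite ltr_wpDl.
have [N HN] := ul _ (divr_gt0 e0 a0); exists N => n /HN; rewrite ltr_pdivlMr // => h.
rewrite -mulrBr normcM; apply: le_lt_trans h.
by rewrite mulrDr mulr1 mulrC lerDl.
Qed.

Lemma ccvg_sum (I : eqType) (s : seq I) (u : I -> nat -> C^o) (l : I -> C^o) :
  (forall i, i \in s -> u i @ \oo --> l i) ->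
  (fun n => \sum_(i <- s) u i n : C^o) @ \oo --> (\sum_(i <- s) l i : C^o).
Proof.
elim: s => [|i s IH] ul.
  rewrite big_nil (_ : (fun n => _) = cst (0 : C^o)); first exact: cvg_cst.
  by apply/funext => n; rewrite big_nil.
rewrite big_cons (_ : (fun n => _) = (fun n => u i n + \sum_(j <- s) u j n)).
  apply: cvgD; first by apply: ul; rewrite mem_head.
  by apply: IH => j js; apply: ul; rewrite inE js orbT.
by apply/funext => n; rewrite big_cons.
Qed.

Lemma ccvg_unique (u : nat -> C^o) (l l' : C^o) : u @ \oo --> l -> u @ \oo --> l' -> l = l'.
Proof. by move=> ul ul'; apply: (cvg_unique _ ul ul'). Qed.

End ComplexNumbers.
#[global] Hint Resolve normc_ge0 : core.

Section HilbertTheory.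
Variables (R : realType).
Local Notation C := R[i].
Variables (V : lmodType C) (H : hspace V).
Hypothesis hH : is_hilbert H.
Implicit Types x y z : V.

Lemma hspace0 : H 0. Proof. by have [] := hilbert_subspace hH. Qed.

Lemma hspaceL a x y : H x -> H y -> H (a *: x + y).
Proof. by have [_] := hilbert_subspace hH; apply. Qed.

Lemma hspaceD x y : H x -> H y -> H (x + y).
Proof. by move=> Hx Hy; rewrite -[x]scale1r; apply: hspaceL. Qed.

Lemma hspaceZ a x : H x -> H (a *: x).
Proof. by move=> Hx; rewrite -[_ *: _]addr0; apply: hspaceL => //; apply: hspace0. Qed.

Lemma hspaceN x : H x -> H (- x).
Proof. by rewrite -scaleN1r; apply: hspaceZ. Qed.

Lemma hspaceB x y : H x -> H y -> H (x - y).
Proof. by move=> Hx Hy; apply: hspaceD => //; apply: hspaceN. Qed.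

Lemma hspace_sum (I : Type) (r : seq I) (P : pred I) (F : I -> V) :
  (forall i, P i -> H (F i)) -> H (\sum_(i <- r | P i) F i).
Proof. by move=> HF; apply: (big_ind (fun x => H x)) => [|x y|]; [exact: hspace0|exact: hspaceD|exact: HF]. Qed.

Lemma hipDl x y z : H x -> H y -> H z -> hip H (x + y) z = hip H x z + hip H y z.
Proof. by move=> Hx Hy Hz; rewrite -[x]scale1r hip_linear // mul1r scale1r. Qed.

Lemma hip0l z : H z -> hip H 0 z = 0.
Proof.
move=> Hz; have := hipDl hspace0 hspace0 Hz; rewrite addr0 => /eqP.
by rewrite -subr_eq0 opprD addrA subrr add0r oppr_eq0 => /eqP.
Qed.

Lemma hipZl a x z : H x -> H z -> hip H (a *: x) z = a * hip H x z.
Proof.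
move=> Hx Hz; rewrite -[_ *: _]addr0 hip_linear //; last exact: hspace0.
by rewrite hip0l // addr0.
Qed.

Lemma hipNl x z : H x -> H z -> hip H (- x) z = - hip H x z.
Proof. by move=> Hx Hz; rewrite -scaleN1r hipZl // mulN1r. Qed.

Lemma hipBl x y z : H x -> H y -> H z -> hip H (x - y) z = hip H x z - hip H y z.
Proof. by move=> Hx Hy Hz; rewrite hipDl ?hipNl //; apply: hspaceN. Qed.

Lemma hipC x y : H x -> H y -> hip H y x = (hip H x y)^*.
Proof. exact: hip_herm. Qed.

Lemma hip0r z : H z -> hip H z 0 = 0.
Proof. by move=> Hz; rewrite hipC ?hip0l ?conjC0 //; apply: hspace0. Qed.

Lemma hipDr x y z : H x -> H y -> H z -> hip H x (y + z) = hip H x y + hip H x z.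
Proof.
move=> Hx Hy Hz; by rewrite (hipC (hspaceD Hy Hz) Hx) hipDl // rmorphD /= -!hipC.
Qed.

Lemma hipZr a x z : H x -> H z -> hip H x (a *: z) = a^* * hip H x z.
Proof. by move=> Hx Hz; rewrite (hipC (hspaceZ a Hz) Hx) hipZl // rmorphM /= -hipC. Qed.

Lemma hipNr x z : H x -> H z -> hip H x (- z) = - hip H x z.
Proof. by move=> Hx Hz; rewrite -scaleN1r hipZr // rmorphN1 mulN1r. Qed.

Lemma hipBr x y z : H x -> H y -> H z -> hip H x (y - z) = hip H x y - hip H x z.
Proof. by move=> Hx Hy Hz; rewrite hipDr ?hipNr //; apply: hspaceN. Qed.

Lemma hip_suml (I : Type) (r : seq I) (P : pred I) (F : I -> V) z :
  (forall i, P i -> H (F i)) -> H z ->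
  hip H (\sum_(i <- r | P i) F i) z = \sum_(i <- r | P i) hip H (F i) z.
Proof.
move=> HF Hz; elim: r => [|i r IH]; first by rewrite !big_nil hip0l.
rewrite !big_cons; case: ifP => // Pi.
by rewrite hipDl ?IH //; [exact: HF | exact: hspace_sum].
Qed.

Lemma hspace_msum d D (F : seq nat -> V) :
  (forall k, size k = d -> sumn k = D -> H (F k)) -> H (msum d D F).
Proof.
elim: d D F => [|d IH] D F HF /=.
  by case: eqP => D0; [exact: HF | exact: hspace0].
apply: hspace_sum => i _; apply: IH => k sk kD; apply: HF; rewrite /= ?sk //.
by rewrite kD subnKC // -ltnS.
Qed.

Lemma hip_msuml d D (F : seq nat -> V) z :
  (forall k, size k = d -> sumn k = D -> H (F k)) -> H z ->
  hip H (msum d D F) z = msum d D (fun k => hip H (F k) z).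
Proof.
elim: d D F => [|d IH] D F HF Hz /=.
  by case: eqP => // _; rewrite hip0l.
have HF' (i : 'I_D.+1) k : size k = d -> sumn k = (D - i)%N -> H (F (nat_of_ord i :: k)).
  by move=> sk kD; apply: HF; rewrite /= ?sk // kD subnKC // -ltnS.
rewrite hip_suml // => [|i _]; last by apply: hspace_msum => k; apply: HF'.
by apply: eq_bigr => i _; rewrite IH // => k; apply: HF'.
Qed.

Lemma hip_msumr d D (F : seq nat -> V) z :
  (forall k, size k = d -> sumn k = D -> H (F k)) -> H z ->
  hip H z (msum d D F) = msum d D (fun k => hip H z (F k)).
Proof.
move=> HF Hz; rewrite hipC //; last exact: hspace_msum.
rewrite hip_msuml // (raddf_msum (Num.conj_op : {additive C -> C})).
by apply: eq_msum => k sk kD /=; rewrite -hipC //; apply: HF.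
Qed.

(** A real-valued version of [hnorm], whose values lie in C, where the order is only partial. *)
Definition nrm x : R := Num.sqrt (complex.Re (hip H x x)).

Lemma nrm_ge0 x : 0 <= nrm x. Proof. exact: sqrtr_ge0. Qed.
Hint Resolve nrm_ge0 : core.

Lemma hip_nrm x : H x -> hip H x x = (nrm x ^+ 2)%:C%C.
Proof.
by move=> Hx; have h0 := hip_ge0 hH Hx; rewrite sqr_sqrtr ?Re_ge0 // -ge0_Re.
Qed.

Lemma nrm_sq x : H x -> nrm x ^+ 2 = complex.Re (hip H x x).
Proof. by move=> Hx; rewrite hip_nrm. Qed.

Lemma nrm0 : nrm 0 = 0.
Proof. by rewrite /nrm hip0l ?sqrtr0 //; apply: hspace0. Qed.

Lemma nrm_eq0 x : H x -> nrm x = 0 -> x = 0.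
Proof. by move=> Hx n0; apply: (hip_def hH Hx); rewrite hip_nrm // n0 expr0n. Qed.

Lemma nrmB_sq x y : H x -> H y ->
  nrm (x - y) ^+ 2 = nrm x ^+ 2 + nrm y ^+ 2 - 2 * complex.Re (hip H x y).
Proof.
move=> Hx Hy; have Hxy := hspaceB Hx Hy.
rewrite !nrm_sq // hipBl // !hipBr // (hipC Hx Hy) !ReB ReJ; ring.
Qed.

Lemma nrmD_sq x y : H x -> H y ->
  nrm (x + y) ^+ 2 = nrm x ^+ 2 + nrm y ^+ 2 + 2 * complex.Re (hip H x y).
Proof.
move=> Hx Hy; have Hxy := hspaceD Hx Hy.
rewrite !nrm_sq // hipDl // !hipDr // (hipC Hx Hy) !ReD ReJ; ring.
Qed.

Lemma nrmZ a x : H x -> nrm (a *: x) = normc a * nrm x.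
Proof.
move=> Hx; have Hax := hspaceZ a Hx.
apply: (@pexpIrn _ 2); rewrite ?nnegrE ?mulr_ge0 ?normc_ge0 //.
by rewrite exprMn !nrm_sq // hipZl // hipZr // mulrA mulC_conj ReMR.
Qed.

Lemma nrmN x : H x -> nrm (- x) = nrm x.
Proof. by move=> Hx; rewrite -scaleN1r nrmZ // normcN normc1 mul1r. Qed.

Lemma nrmBC x y : H x -> H y -> nrm (x - y) = nrm (y - x).
Proof. by move=> Hx Hy; rewrite -nrmN ?opprB //; apply: hspaceB. Qed.

(* Expand |x - (<x,y>/|y|^2) y|^2, with |y|^2 cleared. *)
Lemma cauchy_schwarz x y : H x -> H y -> normc (hip H x y) <= nrm x * nrm y.
Proof.
move=> Hx Hy; have [y0|yn0] := eqVneq (nrm y) 0.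
  by rewrite (nrm_eq0 Hy y0) hip0r // normc0 mulr_ge0.
have y2 : 0 < nrm y ^+ 2 by rewrite exprn_gt0 // lt_def yn0 nrm_ge0.
set a := hip H x y.
have := sqr_ge0 (nrm (((nrm y ^+ 2)%:C)%C *: x - a *: y)).
have Hx' := hspaceZ (nrm y ^+ 2)%:C%C Hx; have Hy' := hspaceZ a Hy.
rewrite nrmB_sq // !nrmZ // hipZl // hipZr // -/a.
rewrite ReMR [a^* * a]mulrC mulC_conj normcR (ger0_norm (ltW y2)) [complex.Re _]/= => h.
rewrite -(@ler_pXn2r _ 2) ?nnegrE ?mulr_ge0 // exprMn.
rewrite -(ler_pM2l y2); nra.
Qed.

Lemma ler_nrmD x y : H x -> H y -> nrm (x + y) <= nrm x + nrm y.
Proof.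
move=> Hx Hy; rewrite -(@ler_pXn2r _ 2) ?nnegrE ?addr_ge0 //.
have Hy' := hspaceN Hy.
rewrite -[y]opprK nrmB_sq // nrmN // hipNr // opprK ReN.
have := le_trans (ler_Re_normc _) (cauchy_schwarz Hx Hy); nra.
Qed.

Lemma ler_nrmB x y z : H x -> H y -> H z -> nrm (x - z) <= nrm (x - y) + nrm (y - z).
Proof.
move=> Hx Hy Hz; have -> : x - z = (x - y) + (y - z) by rewrite addrA subrK.
by apply: ler_nrmD; apply: hspaceB.
Qed.

Lemma hnorm_lt x (e : C) : H x -> 0 < e -> (hnorm H x < e) = (nrm x < complex.Re e).
Proof.
move=> Hx e0; have eE := ge0_Re (ltW e0).
have -> : hnorm H x = (nrm x)%:C%C.
  rewrite /hnorm hip_nrm // rmorphXn /=; apply: sqrCK; by rewrite ler0c.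
by rewrite [in LHS]eE ltcR.
Qed.

Lemma hcvgP (u : nat -> V) l : (forall n, H (u n)) -> H l -> hcvg H u l <->
  forall e : R, 0 < e -> exists N, forall n, (N <= n)%N -> nrm (u n - l) < e.
Proof.
move=> Hu Hl; split=> ul e e0.
  have e0' : 0 < (e%:C)%C :> C by rewrite ltcR.
  have [N Nu] := ul _ e0'; exists N => n /Nu.
  by rewrite hnorm_lt //; apply: hspaceB.
have [|N Nu] := ul (complex.Re e); first by rewrite -ltcR -ge0_Re // ltW.
by exists N => n /Nu; rewrite hnorm_lt //; apply: hspaceB.
Qed.

Lemma hcauchyP (u : nat -> V) : (forall n, H (u n)) ->
  (forall e : R, 0 < e -> exists N, forall m n, (N <= m)%N -> (N <= n)%N -> nrm (u m - u n) < e) ->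
  exists2 l, H l & hcvg H u l.
Proof.
move=> Hu cu; apply: (hilbert_complete hH) => // e e0.
have [|N Nu] := cu (complex.Re e); first by rewrite -ltcR -ge0_Re // ltW.
by exists N => m n Nm Nn; rewrite hnorm_lt ?Nu //; apply: hspaceB.
Qed.

Lemma hcvg_unique (u : nat -> V) l l' : (forall n, H (u n)) -> H l -> H l' ->
  hcvg H u l -> hcvg H u l' -> l = l'.
Proof.
move=> Hu Hl Hl' /hcvgP ul /hcvgP ul'; apply/eqP; rewrite -subr_eq0; apply/eqP.
apply: nrm_eq0; first exact: hspaceB.
apply/eqP; rewrite eq_le nrm_ge0 andbT; apply/ler_addgt0Pl => e e0; rewrite addr0.
have e2 : 0 < e / 2 by rewrite divr_gt0.
have [//|//|N Nu] := ul _ _ _ e2; have [//|//|N' Nu'] := ul' _ _ _ e2.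
have := Nu (N + N')%N (leq_addr _ _); have := Nu' (N + N')%N (leq_addl _ _).
have := ler_nrmB Hl (Hu (N + N')%N) Hl'; rewrite (nrmBC Hl (Hu _)); lra.
Qed.

Lemma hip_cvgl (u : nat -> V) l z : (forall n, H (u n)) -> H l -> H z -> hcvg H u l ->
  (fun n => hip H (u n) z : C^o) @ \oo --> (hip H l z : C^o).
Proof.
move=> Hu Hl Hz /hcvgP ul; apply/ccvgP => e e0.
have nz : 0 < nrm z + 1 by rewrite ltr_wpDl.
have [//|//|N Nu] := ul _ _ _ (divr_gt0 e0 nz).
exists N => n /Nu un; rewrite -hipBl //.
apply: le_lt_trans (cauchy_schwarz (hspaceB (Hu n) Hl) Hz) _.
move: un; rewrite ltr_pdivlMr // mulrDr mulr1; apply: le_lt_trans.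
by rewrite lerDl.
Qed.

Lemma hip_cvgr (u : nat -> V) l z : (forall n, H (u n)) -> H l -> H z -> hcvg H u l ->
  (fun n => hip H z (u n) : C^o) @ \oo --> (hip H z l : C^o).
Proof.
move=> Hu Hl Hz ul; apply/ccvgP => e e0.
have /ccvgP/(_ _ e0)[N Nu] := hip_cvgl Hu Hl Hz ul.
by exists N => n /Nu; rewrite (hipC (Hu n)) // (hipC Hl) // -rmorphB /= normcJ.
Qed.

Lemma hcvg_nrm (u : nat -> V) l (B : R) : (forall n, H (u n)) -> H l -> hcvg H u l ->
  (forall n, nrm (u n) <= B) -> nrm l <= B.
Proof.
move=> Hu Hl /hcvgP ul uB; apply/ler_addgt0Pl => e e0.
have [//|//|N Nu] := ul _ _ _ e0; have := Nu N (leqnn _); have := uB N.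
have := ler_nrmD (hspaceB Hl (Hu N)) (Hu N); rewrite subrK (nrmBC Hl) //; lra.
Qed.

(** * A Riesz lemma for functionals given by their graph *)

Section Riesz.
Variables (G : set (V * C^o)) (B : R).
Hypothesis G_sub : is_subspace G.
Hypothesis B_ge0 : 0 <= B.
Hypothesis GB : forall p, G p -> H p.1 /\ normc p.2 <= B * nrm p.1.

(** If g represents the functional, this is |p.1 - g|^2 - |g|^2, so minimising it means approaching
    g. *)
Let q (p : V * C^o) : R := nrm p.1 ^+ 2 - 2 * complex.Re (p.2 : C).

Let G0 : G 0. Proof. by case: G_sub. Qed.
Let GL (a : C) (x y : V * C^o) : G x -> G y -> G (a *: x + y). Proof. by case: G_sub => _; apply. Qed.
Let GH p : G p -> H p.1. Proof. by case/GB. Qed.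

Let q_lb : has_inf (q @` G).
Proof.
split; first by exists (q 0), 0.
exists (- B ^+ 2) => _ [p Gp <-]; have [_] := GB Gp; rewrite /q.
have := ler_Re_normc p.2; have := sqr_ge0 (B - nrm p.1); nra.
Qed.

Let I := inf (q @` G).

Let qI p : G p -> I <= q p.
Proof. by move=> Gp; apply: ge_inf; [case: q_lb|exists p]. Qed.

Let minimizing (e : R) : 0 < e -> exists2 p, G p & q p < I + e.
Proof. by move=> e0; have [_ [p Gp <-]] := inf_adherent e0 q_lb; exists p. Qed.

Let parallelogram p p' e : G p -> G p' -> q p < I + e -> q p' < I + e ->
  nrm (p.1 - p'.1) ^+ 2 <= 4 * e.
Proof.
move=> Gp Gp' qp qp'.
have half : normc (2^-1 : C) = 2^-1 by rewrite Normc.normcV (normcn R 2).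
have Gm : G ((2^-1 : C) *: (p + p')).
  rewrite -[_ *: _]addr0; apply: GL => //.
  by rewrite -[p]scale1r; apply: GL.
have := qI Gm; move: qp qp'; rewrite /q /=.
have -> : complex.Re ((2^-1 : C) *: (p.2 + p'.2) : C) = 2^-1 * (complex.Re p.2 + complex.Re p'.2).
  rewrite -ReD -ReMR; congr (complex.Re (_ * _)).
  by rewrite -[RHS]/((real_complex R) 2^-1) fmorphV rmorph_nat.
rewrite nrmZ ?half; last by apply: hspaceD; apply: GH.
have Hp := GH Gp; have Hp' := GH Gp'; rewrite nrmB_sq // exprMn nrmD_sq //.
move: (nrm p.1 ^+ 2) (nrm p'.1 ^+ 2) (complex.Re (hip H _ _)) => a b c.
rewrite exprVn; lra.
Qed.

Let near_orthogonal p p' e : G p -> G p' -> 0 < e -> q p < I + e ->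
  normc (hip H p'.1 p.1 - p'.2) ^+ 2 <= e * (nrm p'.1 ^+ 2 + 1).
Proof.
move=> Gp Gp' e0 qp; set d : C := _ - _; set P := nrm p'.1 ^+ 2.
have P0 : 0 < P + 1 by rewrite ltr_wpDl // sqr_ge0.
(* The best step along p' would be P^-1; P + 1 keeps it defined when p' has norm 0. *)
pose t := (P + 1)^-1; pose tau : C := - ((t%:C)%C * d^*).
have t0 : 0 < t by rewrite invr_gt0.
have := qI (GL tau Gp' Gp); move: qp; rewrite /q /=.
have Hp := GH Gp; have Hp' := GH Gp'; have Ht := hspaceZ tau Hp'.
rewrite nrmD_sq // nrmZ // hipZl // exprMn -/P.
have -> : normc tau ^+ 2 = t ^+ 2 * normc d ^+ 2.
  by rewrite normcN normcM normcJ normcR exprMn (ger0_norm (ltW t0)).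
have -> : complex.Re (tau *: p'.2 + p.2 : C) = complex.Re (tau * p'.2) + complex.Re p.2.
  by rewrite ReD.
have : complex.Re (tau * d) = - (t * normc d ^+ 2).
  by rewrite mulNr ReN -mulrA [d^* * d]mulrC mulC_conj ReMR.
rewrite mulrBr ReB => h1 h2 h3.
have h4 : t * (P + 1) = 1 by rewrite mulVf // gt_eqF.
have h5 : t * normc d ^+ 2 <= e.
  have : t ^+ 2 * P <= t by have := sqr_ge0 t; nra.
  have := sqr_ge0 (normc d); nra.
have -> : normc d ^+ 2 = t * normc d ^+ 2 * (P + 1) by rewrite mulrAC h4 mul1r.
by rewrite ler_pM2r.
Qed.

(** Working with the graph [G], a bounded linear relation, leaves neither single-valuedness of the
    functional nor closedness of its domain to be checked. The vector g is the limit of a minimising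
    sequence: midpoints make the sequence Cauchy, and small perturbations of its terms show that the
    limit represents the functional. *)
Lemma riesz : exists g, [/\ H g, nrm g <= B, forall p, G p -> hip H p.1 g = p.2
  & exists2 u : nat -> V * C^o, (forall n, G (u n)) & hcvg H (fun n => (u n).1) g].
Proof.
have /choice [u uP] : forall n, exists p, G p /\ q p < I + n.+1%:R^-1.
  by move=> n; have [|p Gp qp] := @minimizing n.+1%:R^-1; [rewrite invr_gt0|exists p].
have Gu n : G (u n) by have [] := uP n.
have Hu n : H (u n).1 by apply: GH.
have small (e : R) : 0 < e -> exists N, forall n, (N <= n)%N -> n.+1%:R^-1 < e.
  move=> e0; have [N _ HN] := near_infty_natSinv_lt (PosNum e0).
  by exists N => n /HN.
have [e e0|g Hg ug] := hcauchyP Hu.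
   have [|N HN] := small (e ^+ 2 / 8); first by rewrite divr_gt0 ?exprn_gt0.
  exists N => m n /HN Nm /HN Nn.
  have qu k : k.+1%:R^-1 < e ^+ 2 / 8 -> q (u k) < I + e ^+ 2 / 8.
    by move=> h; apply: lt_trans (uP k).2 _; rewrite ltrD2l.
  have := parallelogram (Gu m) (Gu n) (qu _ Nm) (qu _ Nn).
  rewrite -(@ltr_pXn2r _ 2) ?nnegrE ?(ltW e0) ?normc_ge0 //; have := exprn_gt0 2 e0; lra.
have lim p : G p -> hip H p.1 g = p.2.
  move=> Gp; apply: ccvg_unique (hip_cvgr Hu Hg (GH Gp) ug) _.
  apply/ccvgP => e e0; have P0 : 0 < nrm p.1 ^+ 2 + 1 by rewrite ltr_wpDl // sqr_ge0.
  have [|N HN] := small (e ^+ 2 / (nrm p.1 ^+ 2 + 1)); first by rewrite divr_gt0 ?exprn_gt0.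
  exists N => n /HN; rewrite ltr_pdivlMr // => h.
  rewrite -(@ltr_pXn2r _ 2) ?nnegrE ?(ltW e0) ?normc_ge0 //; apply: le_lt_trans h.
  by apply: near_orthogonal => //; exact: (uP n).2.
exists g; split => //; last by exists u.
have bound n : normc (hip H (u n).1 g) <= B * nrm (u n).1 by rewrite lim //; case: (GB (Gu n)).
have [->|gn0] := eqVneq (nrm g) 0; first by [].
have g0 : 0 < nrm g by rewrite lt_def gn0 nrm_ge0.
(* The bound is known for the pairings of g with the approximants and is passed to the limit. *)
suff : nrm g ^+ 2 <= B * nrm g by rewrite expr2 ler_pM2r.
apply/ler_addgt0Pl => e e0.
have K0 : 0 < nrm g + B + 1 by rewrite ltr_wpDl // addr_ge0.
have /hcvgP h := ug; have [//|//|N HN] := h _ _ _ (divr_gt0 e0 K0).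
have := HN N (leqnn _); have := bound N; have D0 := nrm_ge0 ((u N).1 - g).
have : normc (hip H g g - hip H (u N).1 g) <= nrm ((u N).1 - g) * nrm g.
  by rewrite -hipBl // (nrmBC (Hu N) Hg); apply: cauchy_schwarz => //; apply: hspaceB.
have : nrm g ^+ 2 <= normc (hip H g g - hip H (u N).1 g) + normc (hip H (u N).1 g).
  apply: le_trans (ler_normcD _ _); rewrite subrK hip_nrm // normcR.
  by rewrite ger0_norm // sqr_ge0.
have : nrm (u N).1 <= nrm ((u N).1 - g) + nrm g.
  by rewrite -[X in nrm X <= _](subrK g) ler_nrmD //; apply: hspaceB.
rewrite ltr_pdivlMr // => h1 h2 h3 h4 h5.
have : B * nrm (u N).1 <= B * (nrm ((u N).1 - g) + nrm g) by rewrite ler_wpM2l.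
nra.
Qed.

End Riesz.

End HilbertTheory.
#[global] Hint Resolve nrm_ge0 : core.

(** * Closed subspaces, orthogonal complements and projections *)

Section Subspaces.
Variable R : realType.
Local Notation C := R[i].
Variables (V : lmodType C) (H : hspace V).
Hypothesis hH : is_hilbert H.

Lemma is_hilbert_sub (N : set V) : closed_subspace H N -> is_hilbert (HSpace N (hip H)).
Proof.
case=> NH Nsub Ncl; split => //=.
- by move=> a x y z Nx Ny Nz; apply: hip_linear => //; apply: NH.
- by move=> x y Nx Ny; apply: hip_herm => //; apply: NH.
- by move=> x Nx; apply: hip_ge0 => //; apply: NH.
- by move=> x Nx; apply: hip_def => //; apply: NH.
- move=> u Nu cu; have [l Hl ul] := hilbert_complete hH (fun k => NH _ (Nu k)) cu.
  by exists l => //; apply: Ncl ul.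
Qed.

Lemma hominus_closed (S : set V) : S `<=` hcar H -> closed_subspace H (hominus H S).
Proof.
move=> SH; split => /=; first by move=> x [].
  split; first by split=> [|s Ss]; [exact: hspace0|rewrite hip0l //; exact: SH].
  move=> a x y [Hx xS] [Hy yS]; split=> [|s Ss]; first exact: hspaceL.
  by rewrite hip_linear ?xS ?yS ?mulr0 ?addr0 //; exact: SH.
move=> u l uS Hl ul; split=> // s Ss; have Hs := SH _ Ss.
have Hu k : H (u k) by have [] := uS k.
apply: ccvg_unique (hip_cvgl hH Hu Hl Hs ul) _.
have -> : (fun n => hip H (u n) s : C^o) = cst 0.
  by apply/funext => n /=; have [_ ->] := uS n.
exact: cvg_cst.
Qed.

Lemma is_hilbert_hominus (S : set V) : S `<=` hcar H -> is_hilbert (hominus H S).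
Proof. by move=> SH; apply: (is_hilbert_sub (hominus_closed SH)). Qed.

Section Projection.
Variable K : hspace V.
Hypothesis hK : is_hilbert K.
Hypothesis KH : hcar K `<=` hcar H.
Hypothesis KE : hip K = hip H.

(** The projection is the vector of K that represents the functional s |-> <s, x> on K. *)
Lemma hproj_spec x : H x ->
  K (hproj K x) /\ forall s, K s -> hip H (x - hproj K x) s = 0.
Proof.
move=> Hx; pose G : set (V * C^o) := [set p | K p.1 /\ p.2 = hip H p.1 x].
have [|||g [Kg _ gx _]] := @riesz R V K hK G (nrm H x).
- split=> /=; first by split; [exact: hspace0|rewrite hip0l].
  move=> a p p' [Kp ep] [Kp' ep'] /=; split; first exact: hspaceL.
  by rewrite hip_linear -?ep -?ep' //; exact: KH.
- exact: nrm_ge0.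
- move=> p [Kp ->]; split=> //; rewrite /nrm KE mulrC.
  by apply: cauchy_schwarz => //; apply: KH.
have ex : K g /\ forall s, K s -> hip K (x - g) s = 0.
  split=> // s Ks; have Hg := KH Kg; have Hs := KH Ks.
  have E : hip H s g = hip H s x by have := gx (s, hip H s x) (conj Ks erefl); rewrite KE.
  by rewrite KE hipBl // (hipC hH Hs Hx) (hipC hH Hs Hg) E subrr.
rewrite -KE; exact: (@xgetPex _ 0 [set p | K p /\ forall s, K s -> hip K (x - p) s = 0] (ex_intro _ g ex)).
Qed.

Lemma hproj_in x : H x -> K (hproj K x). Proof. by case/hproj_spec. Qed.

Lemma hip_hproj x s : H x -> K s -> hip H (hproj K x) s = hip H x s.
Proof.
move=> Hx Ks; have [Kp /(_ s Ks)] := hproj_spec Hx.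
by rewrite hipBl //; [move/eqP; rewrite subr_eq0 => /eqP|exact: KH|exact: KH].
Qed.

Lemma hproj_unique x p : H x -> K p -> (forall s, K s -> hip H p s = hip H x s) -> hproj K x = p.
Proof.
move=> Hx Kp px; apply/eqP; rewrite -subr_eq0; apply/eqP.
have Kd : K (hproj K x - p) by apply: hspaceB => //; apply: hproj_in.
apply: (hip_def hK Kd); rewrite KE hipBl ?hip_hproj ?px ?subrr //; apply: KH => //.
exact: hproj_in.
Qed.

Lemma hproj_linear a x y : H x -> H y ->
  hproj K (a *: x + y) = a *: hproj K x + hproj K y.
Proof.
move=> Hx Hy; apply: hproj_unique; first exact: hspaceL.
  by apply: hspaceL => //; apply: hproj_in.
by move=> s Ks; rewrite !hip_linear ?hip_hproj //; apply: KH => //; apply: hproj_in.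
Qed.

Lemma nrm_hproj x : H x -> nrm H (hproj K x) <= nrm H x.
Proof.
move=> Hx; have Kp := hproj_in Hx; have Hp := KH Kp.
have [->|pn0] := eqVneq (nrm H (hproj K x)) 0; first exact: nrm_ge0.
have p0 : 0 < nrm H (hproj K x) by rewrite lt_def pn0 nrm_ge0.
rewrite -(ler_pM2r p0) -expr2; apply: le_trans (cauchy_schwarz hH Hx Hp).
by rewrite -hip_hproj // hip_nrm // normcR ger0_norm // sqr_ge0.
Qed.

End Projection.

Lemma closed_total (A : set V) : closed_subspace H A ->
  (forall x, H x -> (forall y, A y -> hip H x y = 0) -> x = 0) -> forall x, H x -> A x.
Proof.
move=> Acl tot x Hx; have hA := is_hilbert_sub Acl; have AH : A `<=` hcar H by case: Acl.
have [Ap xp] := @hproj_spec (HSpace A (hip H)) hA AH erefl x Hx.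
suff /eqP : x - hproj (HSpace A (hip H)) x = 0 by rewrite subr_eq0 => /eqP {1}->.
by apply: tot => //; apply: hspaceB => //; apply: AH.
Qed.

End Subspaces.

(** * Unitary equivalence from equal Gram matrices and equal matrix entries *)

Section Unitary.
Variable R : realType.
Local Notation C := R[i].

Section Half.
Variables (V1 V2 : lmodType C) (H1 : hspace V1) (H2 : hspace V2).
Hypotheses (hH1 : is_hilbert H1) (hH2 : is_hilbert H2).
Variables (I : Type) (v : I -> V1) (u : I -> V2).
Hypotheses (Hv : forall i, H1 (v i)) (Hu : forall i, H2 (u i)).
Hypothesis gram : forall i j, hip H2 (u i) (u j) = hip H1 (v i) (v j).

Let lc (V : lmodType C) (f : I -> V) (s : seq (C * I)) := \sum_(p <- s) p.1 *: f p.2.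

Let lcH (V : lmodType C) (H : hspace V) (hH : is_hilbert H) f s :
  (forall i, H (f i)) -> H (lc f s).
Proof. by move=> Hf; apply: hspace_sum => // p _; apply: hspaceZ. Qed.

Let Hlv s : H1 (lc v s). Proof. exact: lcH. Qed.
Let Hlu s : H2 (lc u s). Proof. exact: lcH. Qed.

Let lc_lin (V : lmodType C) (f : I -> V) a s s' :
  lc f ([seq (a * p.1, p.2) | p <- s] ++ s') = a *: lc f s + lc f s'.
Proof.
rewrite /lc big_cat big_map scaler_sumr; congr (_ + _).
by apply: eq_bigr => p _; rewrite scalerA.
Qed.

Let nrm_lc s : nrm H1 (lc v s) = nrm H2 (lc u s).
Proof.
rewrite /nrm; congr (Num.sqrt (complex.Re _)); rewrite /lc !hip_suml //.
- apply: eq_bigr => p _; rewrite !hipZl //; try exact: Hlu; try exact: Hlv.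
  rewrite (hipC hH1 (Hlv s)) // (hipC hH2 (Hlu s)) // /lc !hip_suml //.
  + congr (_ * _^*); apply: eq_bigr => p' _; by rewrite !hipZl // gram.
  + by move=> p' _; apply: hspaceZ.
  + by move=> p' _; apply: hspaceZ.
- by move=> p _; apply: hspaceZ.
- exact: Hlu.
- by move=> p _; apply: hspaceZ.
- exact: Hlv.
Qed.

(** U x represents the functional u_i |-> <v_i, x> on the span of the u_i. Equal Gram matrices give
    equal norms to corresponding combinations, whence its bound. *)
Lemma gram_transfer : exists U : V1 -> V2, forall x, H1 x ->
  [/\ H2 (U x), nrm H2 (U x) <= nrm H1 x & forall i, hip H2 (U x) (u i) = hip H1 x (v i)].
Proof.
have : forall x, exists y, H1 x ->
  [/\ H2 y, nrm H2 y <= nrm H1 x & forall i, hip H2 y (u i) = hip H1 x (v i)].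
  move=> x; have [Hx|nHx] := pselect (H1 x); last by exists 0.
  pose G : set (V2 * C^o) := [set p | exists s, p = (lc u s, hip H1 (lc v s) x)].
  have [|||g [Hg gB gx _]] := @riesz R V2 H2 hH2 G (nrm H1 x).
  - split; first by exists [::]; rewrite /lc !big_nil hip0l.
    move=> a _ _ [s ->] [s' ->]; exists ([seq (a * p.1, p.2) | p <- s] ++ s').
    by rewrite !lc_lin hip_linear.
  - exact: nrm_ge0.
  - move=> _ [s ->]; split; first exact: Hlu.
    by rewrite mulrC -nrm_lc; apply: cauchy_schwarz.
  exists g => _; split=> // i.
  rewrite (hipC hH2 (Hu i) Hg) (hipC hH1 (Hv i) Hx); congr (_^*).
  apply: (gx (u i, hip H1 (v i) x)); exists [:: (1, i)].
  by rewrite /lc !big_seq1 !scale1r.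
by move=> /choice[U UP]; exists U.
Qed.

End Half.

Lemma hcvg_bounded (V1 V2 : lmodType C) (H1 : hspace V1) (H2 : hspace V2)
    (T : V1 -> V2) (B : R) (w : nat -> V1) (l : V1) :
  is_hilbert H1 -> is_hilbert H2 ->
  (forall x, H1 x -> H2 (T x)) ->
  (forall (a : C) x y, H1 x -> H1 y -> T (a *: x + y) = a *: T x + T y) ->
  (forall x, H1 x -> nrm H2 (T x) <= B * nrm H1 x) ->
  (forall n, H1 (w n)) -> H1 l -> hcvg H1 w l -> hcvg H2 (fun n => T (w n)) (T l).
Proof.
move=> hH1 hH2 TH TL TB Hw Hl /(hcvgP hH1 Hw Hl) wl.
have HTw n : H2 (T (w n)) by apply: TH.
apply/(hcvgP hH2 HTw (TH _ Hl)) => e e0.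
have B0 : 0 < `|B| + 1 by rewrite ltr_wpDl.
have [N HN] := wl _ (divr_gt0 e0 B0); exists N => n /HN; rewrite ltr_pdivlMr // => h.
have -> : T (w n) - T l = T (w n - l).
  by rewrite addrC -scaleN1r -TL // scaleN1r addrC.
apply: le_lt_trans (TB _ _) _; first exact: hspaceB.
apply: le_lt_trans h; rewrite [leLHS]mulrC ler_wpM2l ?nrm_ge0 //.
by apply: le_trans (ler_norm B) _; rewrite lerDl.
Qed.

Variables (V1 V2 : lmodType C) (H1 : hspace V1) (H2 : hspace V2).
Hypotheses (hH1 : is_hilbert H1) (hH2 : is_hilbert H2).
Variables (I : Type) (v : I -> V1) (u : I -> V2).
Hypotheses (Hv : forall i, H1 (v i)) (Hu : forall i, H2 (u i)).
Hypothesis gram : forall i j, hip H2 (u i) (u j) = hip H1 (v i) (v j).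
Hypothesis total1 : forall x, H1 x -> (forall i, hip H1 x (v i) = 0) -> x = 0.
Hypothesis total2 : forall x, H2 x -> (forall i, hip H2 x (u i) = 0) -> x = 0.
Variables (T1 : V1 -> V1) (T2 : V2 -> V2) (B : R).
Hypothesis T1H : forall x, H1 x -> H1 (T1 x).
Hypothesis T2H : forall x, H2 x -> H2 (T2 x).
Hypothesis T1L : forall (a : C) x y, H1 x -> H1 y -> T1 (a *: x + y) = a *: T1 x + T1 y.
Hypothesis T2L : forall (a : C) x y, H2 x -> H2 y -> T2 (a *: x + y) = a *: T2 x + T2 y.
Hypothesis T1B : forall x, H1 x -> nrm H1 (T1 x) <= B * nrm H1 x.
Hypothesis T2B : forall x, H2 x -> nrm H2 (T2 x) <= B * nrm H2 x.
Hypothesis entries : forall i j, hip H2 (T2 (u i)) (u j) = hip H1 (T1 (v i)) (v j).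

Lemma eq_total (V : lmodType C) (H : hspace V) (hH : is_hilbert H) (w : I -> V) x y :
  (forall i, H (w i)) -> (forall x, H x -> (forall i, hip H x (w i) = 0) -> x = 0) ->
  H x -> H y -> (forall i, hip H x (w i) = hip H y (w i)) -> x = y.
Proof.
move=> Hw tot Hx Hy xy; apply/eqP; rewrite -subr_eq0; apply/eqP.
by apply: tot => [|i]; [exact: hspaceB|rewrite hipBl // xy subrr].
Qed.

(** The transfers in the two directions are contractions, and by totality they are inverse to each
    other; both are therefore isometries, and polarisation recovers the inner product. *)
Theorem unitarily_equivalent_of_gram : unitarily_equivalent H1 T1 H2 T2.
Proof.
have [U UP] := gram_transfer hH1 hH2 Hv Hu gram.
have [U' UP'] := gram_transfer hH2 hH1 Hu Hv (fun i j => esym (gram i j)).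
have UH x : H1 x -> H2 (U x) by case/UP.
have Uu x i : H1 x -> hip H2 (U x) (u i) = hip H1 x (v i) by case/UP.
have U'H x : H2 x -> H1 (U' x) by case/UP'.
have U'v x i : H2 x -> hip H1 (U' x) (v i) = hip H2 x (u i) by case/UP'.
have UK x : H1 x -> U' (U x) = x.
  move=> Hx; have HU := UH _ Hx; apply: (eq_total hH1 Hv total1) => // [|i]; first exact: U'H.
  by rewrite U'v // Uu.
have U'K x : H2 x -> U (U' x) = x.
  move=> Hx; have HU := U'H _ Hx; apply: (eq_total hH2 Hu total2) => // [|i]; first exact: UH.
  by rewrite Uu // U'v.
have UL (a : C) x y : H1 x -> H1 y -> U (a *: x + y) = a *: U x + U y.
  move=> Hx Hy; have HU := UH _ Hx; have HU' := UH _ Hy; have Hxy := hspaceL hH1 a Hx Hy.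
  apply: (eq_total hH2 Hu total2) => [||i]; [exact: UH|exact: hspaceL|].
  by rewrite hip_linear // !Uu // hip_linear.
have Un x : H1 x -> nrm H2 (U x) = nrm H1 x.
  move=> Hx; apply/eqP; rewrite eq_le; have [HU -> _] := UP x Hx.
  by have [_ ] := UP' _ HU; rewrite UK.
have URe x y : H1 x -> H1 y -> complex.Re (hip H2 (U x) (U y)) = complex.Re (hip H1 x y).
  move=> Hx Hy; have HU := UH _ Hx; have HU' := UH _ Hy.
  have := nrmD_sq hH1 Hx Hy; have := nrmD_sq hH2 HU HU'.
  have <- : U (x + y) = U x + U y by rewrite -[x]scale1r UL // !scale1r.
  rewrite !Un //; last exact: hspaceD.
  by move=> -> /addrI; apply: mulfI; rewrite pnatr_eq0.
have Uhip x y : H1 x -> H1 y -> hip H2 (U x) (U y) = hip H1 x y.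
  move=> Hx Hy; have HU := UH _ Hx; have HU' := UH _ Hy.
  (* Replacing x by i x turns the equality of real parts into that of imaginary parts. *)
  have Hix := hspaceZ hH1 ('i : C)%C Hx.
  have := URe _ _ Hix Hy.
  have -> : U ('i%C *: x) = 'i%C *: U x.
    rewrite -[_ *: x]addr0 UL //; last exact: hspace0.
    suff -> : U 0 = 0 by rewrite addr0.
    by apply: (nrm_eq0 hH2); [exact: (UH _ (hspace0 hH1))|rewrite Un ?nrm0 //; exact: hspace0].
  rewrite !hipZl // ![('i%C : C) * _]mulrC !ReiNIm => /oppr_inj E.
  by apply/eqP; rewrite eq_complex E URe // !eqxx.
exists U; split => //.
- apply/seteqP; split=> [_ [x Hx <-]|y Hy]; first exact: UH.
  by exists (U' y); [exact: U'H|exact: U'K].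
- have Uv i : U (v i) = u i.
    by apply: (eq_total hH2 Hu total2) => // [|j]; [exact: UH|rewrite Uu // gram].
  (* Since T1, T2 and U are bounded, the vectors on which U intertwines the operators form a closed
     subspace; it contains the total family v. *)
  pose A : set V1 := [set x | H1 x /\ U (T1 x) = T2 (U x)].
  have Av i : A (v i).
    split=> //; apply: (eq_total hH2 Hu total2); rewrite ?Uv.
    + by apply: UH; apply: T1H.
    + exact: T2H.
    + by move=> j; rewrite Uu ?entries //; apply: T1H.
  have Acl : closed_subspace H1 A.
    split; first by move=> x [].
      split; first split; first exact: hspace0.
        have Z (V V' : lmodType C) (H : hspace V) (hH : is_hilbert H) (T : V -> V') :
          (forall (a : C) x y, H x -> H y -> T (a *: x + y) = a *: T x + T y) -> T 0 = 0.
          move=> TL; have := TL (-1) 0 0 (hspace0 hH) (hspace0 hH).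
          by rewrite scaler0 addr0 scaleN1r addNr.
        by rewrite (Z _ _ _ hH1 _ T1L) (Z _ _ _ hH1 _ UL) (Z _ _ _ hH2 _ T2L).
      move=> a x y [Hx ex] [Hy ey]; split; first exact: hspaceL.
      rewrite T1L // UL // ?UL // ?T2L ?ex ?ey //; try exact: UH; exact: T1H.
    move=> w l Aw Hl wl; have Hw n : H1 (w n) by have [] := Aw n.
    split=> //.
    have c1 := hcvg_bounded hH1 hH1 T1H T1L T1B Hw Hl wl.
    have c2 := hcvg_bounded (B := 1) hH1 hH2 UH UL _ (fun n => T1H (Hw n)) (T1H Hl) c1.
    have c3 := hcvg_bounded (B := 1) hH1 hH2 UH UL _ Hw Hl wl.
    have HUw n : H2 (U (w n)) by apply: UH.
    have c4 := hcvg_bounded hH2 hH2 T2H T2L T2B HUw (UH _ Hl) (c3 _).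
    have U1 x : H1 x -> nrm H2 (U x) <= 1 * nrm H1 x by move=> Hx; rewrite mul1r Un.
    apply: (hcvg_unique hH2 _ _ _ (c2 U1)).
    + by move=> n; apply: UH; apply: T1H.
    + by apply: UH; apply: T1H.
    + by apply: T2H; apply: UH.
    + have -> : (fun n => U (T1 (w n))) = (fun n => T2 (U (w n))).
        by apply/funext => n; have [_ ->] := Aw n.
      exact: c4.
  move=> x Hx; have [] // := closed_total hH1 Acl _ Hx.
  move=> y Hy yA; apply: total1 => // i; exact: yA.
Qed.

End Unitary.

(** * Finite orthogonal sums of Hilbert spaces *)

Section DirectSum.
Variable R : realType.
Local Notation C := R[i].
Variables (V : lmodType C) (I : finType) (H : I -> hspace V).
Hypothesis hH : forall i, is_hilbert (H i).

Lemma hip_hsum_nrm (x : I -> V) : hsum H x ->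
  hip (hsum H) x x = (nrm (hsum H) x ^+ 2)%:C%C /\
  nrm (hsum H) x ^+ 2 = \sum_i nrm (H i) (x i) ^+ 2.
Proof.
move=> Hx; have E : hip (hsum H) x x = ((\sum_i nrm (H i) (x i) ^+ 2)%:C)%C.
  by rewrite rmorph_sum; apply: eq_bigr => i _; rewrite hip_nrm //; apply: Hx.
have N : nrm (hsum H) x ^+ 2 = \sum_i nrm (H i) (x i) ^+ 2.
  by rewrite /nrm E sqr_sqrtr //= sumr_ge0 // => i _; rewrite sqr_ge0.
by rewrite N.
Qed.

Lemma is_hilbert_hsum : is_hilbert (hsum H).
Proof.
have hsumL (a : C) x y : hsum H x -> hsum H y -> hsum H (a *: x + y).
  by move=> Hx Hy i; apply: (hspaceL (hH i)).
split => //=.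
- by split=> // i; apply: hspace0.
- move=> a x y z Hx Hy Hz; rewrite mulr_sumr -big_split; apply: eq_bigr => i _.
  exact: hip_linear.
- by move=> x y Hx Hy; rewrite rmorph_sum; apply: eq_bigr => i _; apply: hip_herm.
- by move=> x Hx; apply: sumr_ge0 => i _; apply: hip_ge0.
- move=> x Hx /eqP; rewrite psumr_eq0 => [/allP h|i _]; last exact: hip_ge0.
  apply/funext => i; apply: (hip_def (hH i)) => //.
  by have /implyP/(_ isT)/eqP := h i (mem_index_enum i).
- move=> u Hu cu.
  have hn x (e : C) : hsum H x -> 0 < e -> (hnorm (hsum H) x < e) = (nrm (hsum H) x < complex.Re e).
    move=> Hx e0; have [E _] := hip_hsum_nrm Hx.
    have -> : hnorm (hsum H) x = (nrm (hsum H) x)%:C%C.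
      by rewrite /hnorm E rmorphXn /=; apply: sqrCK; rewrite ler0c nrm_ge0.
    by rewrite [in LHS](ge0_Re (ltW e0)) ltcR.
  have hB x y : hsum H x -> hsum H y -> hsum H (x - y).
    by move=> Hx Hy i; apply: hspaceB.
  have /choice[l lP] : forall i, exists l, H i l /\ hcvg (H i) (fun n => u n i) l.
    move=> i; have [||l Hl ul] := @hcauchyP R V (H i) (hH i) (fun n => u n i); last by exists l.
      by move=> n; apply: Hu.
    move=> e e0; have [|N HN] := cu (e%:C)%C; first by rewrite ltcR.
    exists N => m n Nm Nn; have := HN m n Nm Nn; rewrite hn ?ltcR //; last exact: hB.
    apply: le_lt_trans; rewrite -(@ler_pXn2r _ 2) ?nnegrE ?nrm_ge0 //.
    have [_ ->] := hip_hsum_nrm (hB _ _ (Hu m) (Hu n)).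
    by rewrite (bigD1 i) //= lerDl sumr_ge0 // => j _; rewrite sqr_ge0.
  have Hl : hsum H l by move=> i; have [] := lP i.
  exists l => // e e0; have e0' : 0 < complex.Re e by rewrite -ltcR -ge0_Re // ltW.
  (* A sum of #|I| squares below d^2 stays below (#|I| + 1)^2 d^2; the successor also covers an
     empty index set. *)
  pose d := complex.Re e / #|I|.+1%:R; have d0 : 0 < d by rewrite divr_gt0.
  have /choice[N HN] : forall i, exists N, forall n, (N <= n)%N -> nrm (H i) (u n i - l i) < d.
    move=> i; have [Hli /(hcvgP (hH i))] := lP i.
    by move=> h; apply: h => // n; apply: Hu.
  exists (\max_i N i)%N => n Nn; rewrite hn //; last exact: hB.
  rewrite -(@ltr_pXn2r _ 2) ?nnegrE ?nrm_ge0 ?(ltW e0') //.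
  have [_ ->] := hip_hsum_nrm (hB _ _ (Hu n) Hl).
  have le i : nrm (H i) (u n i - l i) ^+ 2 <= d ^+ 2.
    rewrite ler_pXn2r ?nnegrE ?nrm_ge0 ?(ltW d0) // ltW // HN //.
    by apply: leq_trans Nn; apply: leq_bigmax.
  apply: le_lt_trans (ler_sum _ (fun i _ => le i)) _.
  rewrite sumr_const -mulr_natl.
  have -> : complex.Re e = d * #|I|.+1%:R by rewrite /d divfK // pnatr_eq0.
  have d2 : 0 < d ^+ 2 by rewrite exprn_gt0.
  move: le => _; clearbody d; rewrite exprMn mulrC ltr_pM2l // -natrX ltr_nat.
  rewrite -[#|_|]/#|I|; nia.
Qed.

End DirectSum.

(** The substitution of k + e_j for k, which is behind both differentiation in z_j and
    multiplication by z_j. *)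
Lemma msum_incr (V : nmodType) d D j (F : seq nat -> V) : (j < d)%N ->
  (forall k, size k = d -> nth 0%N k j = 0%N -> F k = 0) ->
  msum d D.+1 F = msum d D (fun k => F (incr_nth k j)).
Proof.
elim: d D j F => [|d IH] D [|j] F // jd F0 /=.
  rewrite big_ord_recl /= msum0 ?add0r => [|k sk _]; last by rewrite F0 //= sk.
  by apply: eq_bigr => i _; rewrite /bump /= add1n subSS.
rewrite big_ord_recr /= subnn msum_in_degree0 F0 /= ?size_nseq ?nth_nseq ?if_same // addr0.
apply: eq_bigr => i _; have iD : (i <= D)%N by rewrite -ltnS.
by rewrite subSn // (IH _ j) // => k sk k0; rewrite F0 //= sk.
Qed.

Lemma sumn_incr_nth k j : sumn (incr_nth k j) = (sumn k).+1.
Proof.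
elim: k j => [|i k IH] [|j] //=; last by rewrite IH addnS.
by elim: j => [|j IH] //=; rewrite add0n.
Qed.

(** * Power series in several variables *)

Section Domination.
Variable R : realType.
Local Notation C := R[i].

Lemma sum_geometric_le (q : R) n : 0 <= q -> q < 1 -> \sum_(i < n) q ^+ i <= (1 - q)^-1.
Proof.
move=> q0 q1; have q1' : 0 < 1 - q by rewrite subr_gt0.
rewrite -(ler_pM2r q1') mulVf ?gt_eqF // mulrC.
have := subrX1 q n; rewrite -opprB -[X in _ = X * _]opprB mulNr => /oppr_inj <-.
by rewrite gerBl exprn_ge0.
Qed.

(** Polynomial factors are absorbed by a larger ratio, one factor p + 1 at a time: with q = rho q1',
    one has (p + 1) rho^p <= sum_(i <= p) rho^i <= (1 - rho)^-1. *)
Lemma poly_geometric (A : nat) (q : R) : 0 <= q -> q < 1 ->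
  exists M q', [/\ 0 <= M, 0 <= q', q' < 1 & forall p : nat, p.+1%:R ^+ A * q ^+ p <= M * q' ^+ p].
Proof.
elim: A q => [|A IH] q q0 q1.
  by exists 1, q; split=> // p; rewrite expr0.
pose q1' := (1 + q) / 2; have q1'0 : 0 < q1' by rewrite /q1'; lra.
have q1'1 : q1' < 1 by rewrite /q1'; lra.
have [M [q' [M0 q'0 q'1 H]]] := IH q1' (ltW q1'0) q1'1.
pose rho := q / q1'; have rho0 : 0 <= rho by rewrite divr_ge0 // ltW.
have rho1 : rho < 1 by rewrite ltr_pdivrMr // mul1r /q1'; lra.
have rho1' : 0 < 1 - rho by rewrite subr_gt0.
exists ((1 - rho)^-1 * M), q'; split=> //; first by rewrite mulr_ge0 // invr_ge0 ltW.
move=> p; have -> : q = rho * q1' by rewrite /rho divfK // gt_eqF.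
have -> : p.+1%:R ^+ A.+1 * (rho * q1') ^+ p = (p.+1%:R * rho ^+ p) * (p.+1%:R ^+ A * q1' ^+ p).
  by rewrite exprS exprMn; ring.
rewrite -[_ * M * _]mulrA; apply: ler_pM => //.
- by rewrite mulr_ge0 ?exprn_ge0 ?ler0n.
- by rewrite mulr_ge0 ?exprn_ge0 ?ler0n // ltW.
apply: le_trans (sum_geometric_le p.+1 rho0 rho1).
rewrite mulr_natl -[X in _ *+ X](card_ord p.+1) -sumr_const; apply: ler_sum => i _.
by rewrite ler_wiXn2l ?(ltW rho1) // -ltnS.
Qed.

Lemma cvg_normc_le (u : nat -> C^o) (l : C^o) (B : R) : u @ \oo --> l ->
  (forall n, normc (u n) <= B) -> normc l <= B.
Proof.
move=> /ccvgP ul uB; apply/ler_addgt0Pl => e e0; have [N HN] := ul e e0.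
have := HN N (leqnn _); have := uB N; have := ler_normcD (l - u N) (u N).
rewrite subrK normcB; lra.
Qed.

Lemma cvg_Re_ge (u : nat -> C^o) (l : C^o) (B : R) N0 : u @ \oo --> l ->
  (forall n, (N0 <= n)%N -> B <= complex.Re (u n)) -> B <= complex.Re l.
Proof.
move=> /ccvgP ul uB; apply/ler_addgt0Pl => e e0; have [N HN] := ul e e0.
have := HN _ (leq_addr N0 N); have := uB _ (leq_addl N N0).
have := ler_Re_normc (u (N + N0)%N - l); rewrite ReB; lra.
Qed.

Lemma dominated_cvg (u : nat -> C^o) (M q : R) : 0 <= q -> q < 1 ->
  (forall p, normc (u p) <= M * q ^+ p) ->
  exists l : C^o, (fun N => \sum_(p < N) u p : C^o) @ \oo --> l.
Proof.
move=> q0 q1 uM; have geo : cvgn (series (fun p => M * q ^+ p : R^o)).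
  by apply: is_cvg_geometric_series; rewrite ger0_norm.
have Re_cvg (f : C -> R) : (forall x, `|f x| <= normc x) ->
    cvgn (series (fun p => f (u p) : R^o)).
  move=> fn; apply: normed_cvg; apply: series_le_cvg geo => p //=.
    exact: le_trans (normc_ge0 _) (uM p).
  exact: le_trans (fn _) (uM p).
have absRe (x : C) : `|complex.Re x| <= normc x.
  by case: x => a b /=; rewrite -sqrtr_sqr ler_wsqrtr // lerDl sqr_ge0.
have absIm (x : C) : `|complex.Im x| <= normc x.
  by case: x => a b /=; rewrite -sqrtr_sqr ler_wsqrtr // lerDr sqr_ge0.
have /cvg_ex[/= a /cvgrPdist_lt ca] := Re_cvg _ absRe.
have /cvg_ex[/= b /cvgrPdist_lt cb] := Re_cvg _ absIm.
exists (a +i* b)%C; apply/ccvgP => e e0.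
have e2 : 0 < e / 2 by rewrite divr_gt0.
have [N _ HN] := ca _ e2; have [N' _ HN'] := cb _ e2.
exists (N + N')%N => n Nn.
have /= := HN n (leq_trans (leq_addr _ _) Nn); have /= := HN' n (leq_trans (leq_addl _ _) Nn).
rewrite /series /= !big_mkord => h1 h2.
have -> : \sum_(p < n) u p = ((\sum_(p < n) complex.Re (u p)) +i* (\sum_(p < n) complex.Im (u p)))%C.
  elim: n {Nn h1 h2} => [|n IH]; first by rewrite !big_ord0.
  by rewrite !big_ord_recr IH /=; case: (u n).
apply: le_lt_trans (normc_le_ReIm _) _; rewrite /= distrC [X in _ + X]distrC; lra.
Qed.

End Domination.

Section MultiSeries.
Variables (R : realType) (d : nat).
Local Notation C := R[i].
Implicit Types (z : 'rV[C]_d) (b : seq nat -> C) (k : seq nat).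

Definition mon z k : C := \prod_(j < d) z 0 j ^+ nth 0%N k j.
Definition hpart b D z : C := msum d D (fun k => b k * mon z k).
Definition psum b N z : C := \sum_(D < N) hpart b D z.
Definition pd (j : nat) b k : C := (nth 0%N k j).+1%:R * b (incr_nth k j).

(** Polynomial growth of the coefficients: it is stable under differentiation, it holds for the
    inverse weights, and it gives convergence in the whole polydisc. *)
Definition growth b := exists (A : nat) (M : R),
  0 <= M /\ forall k, size k = d -> normc (b k) <= M * (sumn k).+1%:R ^+ A.

Lemma sumn_nth k : size k = d -> sumn k = (\sum_(j < d) nth 0 k j)%N.
Proof. by move=> sk; rewrite sumnE (big_nth 0%N) sk big_mkord. Qed.

Lemma nth_le_sumn k j : (nth 0 k j <= sumn k)%N.
Proof. by elim: k j => [|i k IH] [|j] //=; [exact: leq_addr|exact: leq_trans (IH j) (leq_addl _ _)]. Qed.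

Lemma normc_mon z k (r : R) : size k = d -> (forall j, normc (z 0 j) <= r) ->
  normc (mon z k) <= r ^+ sumn k.
Proof.
move=> sk zr; rewrite normc_prod (sumn_nth sk) -prodrXr; apply: ler_prod => j _.
by rewrite normc_ge0 normcX lerXn2r ?nnegrE ?normc_ge0 // (le_trans _ (zr j)).
Qed.

Lemma normc_msum D (F : seq nat -> C) : normc (msum d D F) <= msum d D (fun k => normc (F k)).
Proof.
elim: d D F => [|d' IH] D F /=; first by case: eqP => // _; rewrite normc0.
by apply: le_trans (ler_normc_sum _ _ _) _; apply: ler_sum => i _.
Qed.

Lemma msum_le_const D (F : seq nat -> R) (x : R) : 0 <= x ->
  (forall k, size k = d -> sumn k = D -> F k <= x) -> msum d D F <= D.+1%:R ^+ d * x.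
Proof.
move=> x0; elim: d D F => [|d' IH] D F Fx /=.
  by rewrite expr0 mul1r; case: eqP => // D0; apply: Fx.
apply: (@le_trans _ _ (\sum_(i < D.+1) D.+1%:R ^+ d' * x)); last first.
  by rewrite sumr_const card_ord -[leLHS]mulr_natl exprS -mulrA.
apply: ler_sum => i _; apply: le_trans (IH _ _ _) _ => [k sk kD|].
  by apply: Fx; rewrite /= ?sk // kD subnKC // -ltnS.
by rewrite ler_wpM2r // lerXn2r ?nnegrE ?ler0n // ler_nat ltnS leq_subr.
Qed.

Lemma normc_hpart b (A : nat) (M r : R) D z : 0 <= M ->
  (forall k, size k = d -> normc (b k) <= M * (sumn k).+1%:R ^+ A) ->
  (forall j, normc (z 0 j) <= r) -> 0 <= r ->
  normc (hpart b D z) <= M * (D.+1%:R ^+ (d + A) * r ^+ D).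
Proof.
move=> M0 bM zr r0; apply: le_trans (normc_msum _ _) _.
have -> : M * (D.+1%:R ^+ (d + A) * r ^+ D) = D.+1%:R ^+ d * (M * D.+1%:R ^+ A * r ^+ D).
  by rewrite exprD; ring.
apply: msum_le_const => [|k sk kD].
  by rewrite !mulr_ge0 ?exprn_ge0 ?ler0n.
rewrite normcM; apply: ler_pM => //; rewrite ?normc_ge0 //.
  by rewrite -kD; apply: bM.
by rewrite -kD; apply: normc_mon.
Qed.

Lemma hpart0 b z : hpart b 0 z = b (nseq d 0%N).
Proof.
by rewrite /hpart msum_in_degree0 /mon big1 ?mulr1 // => i _; rewrite nth_nseq if_same.
Qed.

Lemma polydisc_radius z : polydisc z -> exists2 r : R, 0 < r < 1 & forall j, normc (z 0 j) <= r.
Proof.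
(* The default 2^-1 keeps r positive when all coordinates are 0, and covers d = 0. *)
move=> zD; pose r := \big[Num.max/2^-1]_(j < d) normc (z 0 j).
exists r; last by move=> j; rewrite /r; apply: le_bigmax_cond.
apply/andP; split; first by apply: lt_le_trans (bigmax_ge_id _ _ _ _); rewrite invr_gt0.
apply: bigmax_lt => [|j _]; first by rewrite invf_lt1 // ltr1n.
by have := zD j; rewrite normE -[1]/((1 : R)%:C)%C ltcR.
Qed.

Lemma psum_cvg b z : growth b -> polydisc z ->
  exists l : C^o, (fun N => psum b N z : C^o) @ \oo --> l.
Proof.
move=> [A [M [M0 bM]]] /polydisc_radius[r /andP[r0 r1] zr].
have [M' [q [M'0 q0 q1 H]]] := poly_geometric (d + A) (ltW r0) r1.
apply: (@dominated_cvg R (fun D => hpart b D z) (M * M') q q0 q1) => D.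
apply: le_trans (normc_hpart D M0 bM zr (ltW r0)) _.
by rewrite -mulrA ler_wpM2l.
Qed.

Lemma growth_pd b (j : 'I_d) : growth b -> growth (pd j b).
Proof.
move=> [A [M [M0 bM]]]; exists A.+1, (M * 2 ^+ A); split.
  by rewrite mulr_ge0 ?exprn_ge0.
move=> k sk; rewrite normcM normcn.
have := bM (incr_nth k j); rewrite size_incr_nth sk ltn_ord sumn_incr_nth => /(_ erefl) h.
apply: le_trans (_ : (sumn k).+1%:R * (M * (2 * (sumn k).+1%:R) ^+ A) <= _).
  apply: ler_pM; rewrite ?normc_ge0 ?ler0n ?ler_nat ?ltnS ?nth_le_sumn //.
  apply: le_trans h _; rewrite ler_wpM2l // lerXn2r ?nnegrE ?mulr_ge0 ?ler0n //.
  by rewrite -natrM ler_nat; lia.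
by rewrite exprMn exprS le_eqVlt; apply/orP; left; apply/eqP; ring.
Qed.

Lemma mon_split z k (j : 'I_d) :
  mon z k = z 0 j ^+ nth 0%N k j * \prod_(i < d | i != j) z 0 i ^+ nth 0%N k i.
Proof. by rewrite /mon (bigD1 j). Qed.

Lemma hpart_pd b D z (j : 'I_d) : hpart (pd j b) D z =
  msum d D.+1 (fun k => b k * ((nth 0%N k j)%:R * z 0 j ^+ (nth 0%N k j).-1 *
    \prod_(i < d | i != j) z 0 i ^+ nth 0%N k i)).
Proof.
rewrite (msum_incr _ (ltn_ord j)) => [|k _ ->]; last by rewrite !mul0r mulr0.
apply: eq_msum => k sk _; rewrite (mon_split _ _ j) nth_incr_nth eqxx add1n /= /pd.
have -> : \prod_(i < d | i != j) z 0 i ^+ nth 0 (incr_nth k j) i =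
          \prod_(i < d | i != j) z 0 i ^+ nth 0 k i.
  apply: eq_bigr => i ij; rewrite nth_incr_nth.
  by have /negPf -> : (j : nat) != i by apply: contraNneq ij => /val_inj ->.
ring.
Qed.

(** The factor r^2 on the left avoids the exponent p - 2, which would be negative for p < 2. *)
Lemma power_taylor (x h : C) (r : R) p : normc x <= r -> normc (x + h) <= r ->
  normc ((x + h) ^+ p - x ^+ p - h * (p%:R * x ^+ p.-1)) * r ^+ 2 <=
  normc h ^+ 2 * (p%:R ^+ 2 * r ^+ p).
Proof.
move=> xr xhr; have r0 : 0 <= r by apply: le_trans xr; apply: normc_ge0.
elim: p => [|p IH]; first by rewrite !expr0 subrr mul0r mulr0 subrr normc0 expr0n !mul0r mulr0.
set E := _ - _ in IH.
have -> : (x + h) ^+ p.+1 - x ^+ p.+1 - h * (p.+1%:R * x ^+ p.+1.-1) =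
   (x + h) * E + h ^+ 2 * (p%:R * x ^+ p.-1).
  rewrite /E /= !exprS -natr1; case: p {IH E} => [|p] /=; last by rewrite !exprS; ring.
  by rewrite !expr0; ring.
have h1 := ler_normcD ((x + h) * E) (h ^+ 2 * (p%:R * x ^+ p.-1)).
rewrite !normcM !normcX normcn in h1.
apply: (@le_trans _ _ ((normc (x + h) * normc E + normc h ^+ 2 * (p%:R * normc x ^+ p.-1)) * r ^+ 2)).
  by rewrite ler_wpM2r ?exprn_ge0.
have h2 : normc (x + h) * normc E * r ^+ 2 <= r * (normc h ^+ 2 * (p%:R ^+ 2 * r ^+ p)).
  by rewrite -mulrA ler_pM // ?mulr_ge0 ?normc_ge0 ?exprn_ge0.
have h3 : normc h ^+ 2 * (p%:R * normc x ^+ p.-1) * r ^+ 2 <= normc h ^+ 2 * (p%:R * r ^+ p.+1).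
  case: p {IH E h1 h2} => [|p]; first by rewrite !mul0r !mulr0 mul0r.
  rewrite -!mulrA ler_wpM2l ?exprn_ge0 ?normc_ge0 // ler_wpM2l ?ler0n //.
  rewrite /= (_ : r ^+ p.+2 = r ^+ p * r ^+ 2); last by rewrite -exprD addn2.
  rewrite ler_wpM2l ?ler0n // ler_wpM2r ?exprn_ge0 //.
  by rewrite lerXn2r ?nnegrE ?normc_ge0.
rewrite mulrDl; apply: le_trans (lerD h2 h3) _.
have -> : r * (normc h ^+ 2 * (p%:R ^+ 2 * r ^+ p)) + normc h ^+ 2 * (p%:R * r ^+ p.+1)
  = normc h ^+ 2 * ((p%:R ^+ 2 + p%:R) * r ^+ p.+1) by rewrite [r ^+ p.+1]exprS; ring.
rewrite ler_wpM2l ?exprn_ge0 ?normc_ge0 // ler_wpM2r ?exprn_ge0 //.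
by rewrite -natrX -natrD -natrX ler_nat; nia.
Qed.

(** The quadratic remainders of the monomials are summed with the growth bound, so that a single K
    serves all points of the closed polydisc of radius r'. The estimate is made for partial sums and
    passes to the limit. *)
Lemma psum_taylor b (j : 'I_d) (r' : R) : growth b -> 0 < r' -> r' < 1 ->
  exists K, forall z (h : C) (f0 f1 g : C^o),
  (forall i, normc (z 0 i) <= r') -> normc (z 0 j + h) <= r' ->
  (fun N => psum b N z : C^o) @ \oo --> f0 ->
  (fun N => psum b N (z + h *: delta_mx 0 j) : C^o) @ \oo --> f1 ->
  (fun N => psum (pd j b) N z : C^o) @ \oo --> g ->
  normc (f1 - f0 - h * g) <= K * normc h ^+ 2.
Proof.
move=> [A [M [M0 bM]]] r'0 r'1.
have [M' [q [M'0 q0 q1 H]]] := poly_geometric (d + (A + 2)) (ltW r'0) r'1.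
have q1' : 0 < 1 - q by rewrite subr_gt0.
exists (M / r' ^+ 2 * M' / (1 - q)) => z h f0 f1 g zr zhr c0 c1 cg.
pose w := z + h *: delta_mx 0 j.
have wE i : w 0 i = if i == j then z 0 j + h else z 0 i.
  by rewrite !mxE eqxx /=; case: eqP => [->|_]; rewrite ?mulr1 ?mulr0 ?addr0.
pose E (x : C) p := (x + h) ^+ p - x ^+ p - h * (p%:R * x ^+ p.-1).
pose err D := msum d D.+1 (fun k => b k * (E (z 0 j) (nth 0%N k j) *
  \prod_(i < d | i != j) z 0 i ^+ nth 0%N k i)).
(* Degree D + 1 of the series goes with degree D of its derivative; the constant term cancels. *)
have errE D : hpart b D.+1 w = hpart b D.+1 z + h * hpart (pd j b) D z + err D.
  rewrite hpart_pd mulr_msumr -!msumD; apply: eq_msum => k _ _.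
  rewrite !(mon_split _ _ j) wE eqxx.
  have -> : \prod_(i < d | i != j) w 0 i ^+ nth 0%N k i = \prod_(i < d | i != j) z 0 i ^+ nth 0%N k i.
    by apply: eq_bigr => i /negPf ij; rewrite wE ij.
  by rewrite /E; ring.
have errB D : normc (err D) <= normc h ^+ 2 * (M / r' ^+ 2 * M') * q ^+ D.+1.
  apply: le_trans (normc_msum _ _) _.
  apply: (@le_trans _ _ (D.+2%:R ^+ d * (normc h ^+ 2 * (M / r' ^+ 2) * (D.+2%:R ^+ (A + 2) * r' ^+ D.+1)))).
    apply: msum_le_const => [|k sk kD].
      by rewrite !mulr_ge0 ?exprn_ge0 ?normc_ge0 ?invr_ge0 ?ler0n ?exprn_ge0 // ltW.
    set p := nth 0%N k j; set P := \prod_(i < d | i != j) _.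
    have pD : (p <= D.+1)%N by rewrite -kD nth_le_sumn.
    have PB : normc P <= r' ^+ (D.+1 - p).
      have -> : (D.+1 - p = \sum_(i < d | i != j) nth 0 k i)%N.
        by rewrite -kD (sumn_nth sk) (bigD1 j) //= addKn.
      rewrite normc_prod -prodrXr; apply: ler_prod => i _.
      by rewrite normc_ge0 normcX lerXn2r ?nnegrE ?normc_ge0 // ltW.
    have EB : normc (E (z 0 j) p) <= normc h ^+ 2 * (D.+2%:R ^+ 2 * r' ^+ p) / r' ^+ 2.
      rewrite ler_pdivlMr ?exprn_gt0 //; apply: le_trans (power_taylor _ (zr j) zhr) _.
      rewrite ler_wpM2l ?exprn_ge0 ?normc_ge0 // ler_wpM2r ?exprn_ge0 ?(ltW r'0) //.
      by rewrite lerXn2r ?nnegrE ?ler0n // ler_nat (leq_trans pD).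
    have := bM k sk; rewrite kD => bk.
    have -> : normc h ^+ 2 * (M / r' ^+ 2) * (D.+2%:R ^+ (A + 2) * r' ^+ D.+1) =
      M * D.+2%:R ^+ A * (normc h ^+ 2 * (D.+2%:R ^+ 2 * r' ^+ p) / r' ^+ 2 * r' ^+ (D.+1 - p)).
      have -> : r' ^+ D.+1 = r' ^+ p * r' ^+ (D.+1 - p) by rewrite -exprD subnKC.
      by rewrite [_ ^+ (A + 2)]exprD; ring.
    rewrite !normcM; apply: ler_pM; rewrite ?mulr_ge0 ?normc_ge0 //.
    by apply: ler_pM; rewrite ?normc_ge0.
  have := H D.+1; rewrite exprD => h1.
  have -> : D.+2%:R ^+ d * (normc h ^+ 2 * (M / r' ^+ 2) * (D.+2%:R ^+ (A + 2) * r' ^+ D.+1)) =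
    normc h ^+ 2 * (M / r' ^+ 2) * (D.+2%:R ^+ d * D.+2%:R ^+ (A + 2) * r' ^+ D.+1) by ring.
  have -> : normc h ^+ 2 * (M / r' ^+ 2 * M') * q ^+ D.+1 = normc h ^+ 2 * (M / r' ^+ 2) * (M' * q ^+ D.+1) by ring.
  by rewrite ler_wpM2l // !mulr_ge0 ?exprn_ge0 ?normc_ge0 ?invr_ge0 ?exprn_ge0 // ltW.
have sumE N : psum b N.+1 w - psum b N.+1 z - h * psum (pd j b) N z = \sum_(D < N) err D.
  rewrite /psum !big_ord_recl !hpart0 /=.
  rewrite (eq_bigr (fun D : 'I_N => hpart b D.+1 z + h * hpart (pd j b) D z + err D)) => [|D _]; last exact: errE.
  by rewrite !big_split /= -mulr_sumr; ring.
have c : (fun N => psum b N.+1 w - psum b N.+1 z - h * psum (pd j b) N z : C^o) @ \oo -->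
   (f1 - f0 - h * g : C^o).
  apply: cvgB; last exact: ccvgZ.
  by apply: cvgB; [move: c1; rewrite -(cvg_shiftS (fun N => psum b N w : C^o))|
     move: c0; rewrite -(cvg_shiftS (fun N => psum b N z : C^o))].
apply: cvg_normc_le c _ => N; rewrite sumE; apply: le_trans (ler_normc_sum _ _ _) _.
apply: (@le_trans _ _ (\sum_(D < N) normc h ^+ 2 * (M / r' ^+ 2 * M') * q ^+ D.+1)).
  by apply: ler_sum => D _; apply: errB.
rewrite -mulr_sumr.
have -> : M / r' ^+ 2 * M' / (1 - q) * normc h ^+ 2 = normc h ^+ 2 * (M / r' ^+ 2 * M') * (1 - q)^-1 by ring.
rewrite ler_wpM2l ?mulr_ge0 ?exprn_ge0 ?normc_ge0 ?invr_ge0 ?exprn_ge0 ?(ltW r'0) //.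
apply: le_trans (sum_geometric_le N.+1 q0 q1).
rewrite big_ord_recl /= -[leLHS]add0r lerD ?expr0 ?ler01 //.
Qed.

Definition pds (s : seq 'I_d) b : seq nat -> C := foldr (fun j c => pd (nat_of_ord j) c) b s.

Lemma growth_pds s b : growth b -> growth (pds s b).
Proof. by move=> gb; elim: s => //= j s IH; apply: growth_pd. Qed.

Lemma polydisc_le z (r : R) : r < 1 -> (forall j, normc (z 0 j) <= r) -> polydisc z.
Proof.
by move=> r1 zr j; rewrite normE -[1]/((1 : R)%:C)%C ltcR; apply: le_lt_trans (zr j) r1.
Qed.

Lemma derive_psum (f : 'rV[C]_d -> C^o) b z (j : 'I_d) (g : C^o) : growth b ->
  (forall w, polydisc w -> (fun N => psum b N w : C^o) @ \oo --> f w) ->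
  polydisc z -> (fun N => psum (pd j b) N z : C^o) @ \oo --> g ->
  'D_(delta_mx 0 j) f z = g.
Proof.
move=> gb bf zD cg; have [r /andP[r0 r1] zr] := polydisc_radius zD.
pose r' := (1 + r) / 2; have r'0 : 0 < r' by rewrite /r'; lra.
have r'1 : r' < 1 by rewrite /r'; lra.
have [K HK] := psum_taylor j gb r'0 r'1.
apply: cvg_lim => //; apply/cvgrPdist_lt => e e0.
have eR : 0 < complex.Re e by rewrite -ltcR -ge0_Re // ltW.
have K0 : 0 < `|K| + 1 by rewrite ltr_wpDl.
pose del := Num.min (r' - r) (complex.Re e / (`|K| + 1)).
have del0 : 0 < del by rewrite lt_min divr_gt0 // andbT /r'; lra.
have del0' : 0 < (del%:C)%C :> C by rewrite ltcR.
near=> h.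
have h0 : h != 0 by near: h; apply: nbhs_dnbhs_neq.
have : `|h| < (del%:C)%C by near: h; apply: dnbhs0_lt.
rewrite normE ltcR lt_min => /andP[hr he].
have zr' i : normc (z 0 i) <= r' by apply: le_trans (zr i) _; rewrite /r'; lra.
have zhr : normc (z 0 j + h) <= r'.
  by apply: le_trans (ler_normcD _ _) _; have := zr j; lra.
have whD : polydisc (z + h *: delta_mx 0 j).
  apply: (polydisc_le r'1) => i; rewrite !mxE eqxx /=; case: eqP => [->|_].
    by rewrite mulr1.
  by rewrite mulr0 addr0.
have := HK z h _ _ _ zr' zhr (bf _ zD) (bf _ whD) cg.
have -> : (f \o shift z) (h *: delta_mx 0 j) = f (z + h *: delta_mx 0 j) by rewrite /= addrC.
set fh := f (z + _) => B; have nh : 0 < normc h.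
  rewrite lt_def normc_ge0 andbT; apply: contra h0 => /eqP/Normc.eq0_normc -> //.
rewrite normE [X in _ < X]ge0_Re ?ltW // ltcR.
have -> : g - h^-1 *: (fh - f z) = - (h^-1 * (fh - f z - h * g)).
  by rewrite -[h^-1 *: _]/(h^-1 * _); field.
rewrite normcN normcM Normc.normcV -ltr_pdivlMl ?invr_gt0 // invrK.
apply: le_lt_trans B _; rewrite expr2 mulrA mulrC ltr_pM2l //.
move: he; rewrite ltr_pdivlMr // mulrC => he; apply: le_lt_trans he.
by rewrite ler_wpM2r ?normc_ge0 // (le_trans (ler_norm K)) // lerDl.
Unshelve. all: by end_near.
Qed.

Lemma partials_psum (f : 'rV[C]_d -> C^o) b s z : growth b ->
  (forall w, polydisc w -> (fun N => psum b N w : C^o) @ \oo --> f w) ->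
  polydisc z -> (fun N => psum (pds s b) N z : C^o) @ \oo --> partials s f z.
Proof.
move=> gb bf; elim: s z => [|j s IH] z zD /=; first exact: bf.
have [l cl] := psum_cvg (growth_pd j (growth_pds s gb)) zD.
by rewrite (derive_psum (growth_pds s gb) IH zD cl).
Qed.

End MultiSeries.

(** * Real weights and the growth of their inverses *)

Section Weights.
Variable R : realType.
Local Notation C := R[i].

Definition toC (al : seq R) : seq C := [seq (a%:C)%C | a <- al].

Lemma pos_toC al : pos (toC al) = all (fun a => 0 < a) al.
Proof. by rewrite /pos /toC all_map; apply: eq_all => a /=; rewrite ltcR. Qed.

Lemma sum_toC al : \sum_(a <- toC al) a = ((\sum_(a <- al) a)%:C)%C.
Proof. by rewrite big_map rmorph_sum. Qed.

Lemma rfC (a : R) n : rf (a%:C)%C n = ((poch a n)%:C)%C.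
Proof.
rewrite /rf /poch rmorph_prod; apply: eq_bigr => i _.
by rewrite rmorphD rmorph_nat.
Qed.

Lemma wt1C (a : R) n : wt1 (a%:C)%C n = ((n`!%:R / poch a n)%:C)%C.
Proof. by rewrite /wt1 rfC fmorph_div rmorph_nat. Qed.

Lemma poch_gt0 (a : R) n : 0 < a -> 0 < poch a n.
Proof. by move=> a0; apply: prodr_gt0 => i _; rewrite ltr_wpDr ?ler0n. Qed.

(** The parameter a is replaced by an integer bound A, for which the estimate becomes an induction
    over natural numbers. *)
Lemma poch_growth (a : R) : 0 < a -> exists A : nat, forall n, poch a n / n`!%:R <= n.+1%:R ^+ A.
Proof.
move=> a0; exists (Num.bound a) => n; set A := Num.bound a.
have aA : a <= A%:R by rewrite ltW // archi_boundP // ltW.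
rewrite ler_pdivrMr ?ltr0n ?fact_gt0 //; elim: n => [|n IH].
  by rewrite /poch big_nil expr1n fact0 mulr1.
rewrite /poch big_nat_recr //= -/(poch a n).
apply: (@le_trans _ _ (n.+1%:R ^+ A * n`!%:R * (A + n)%:R)).
  apply: ler_pM => //; rewrite ?natrD ?lerD2r //; first by rewrite ltW // poch_gt0.
  by rewrite addr_ge0 // ltW.
rewrite factS -!natrX -!natrM ler_nat; clear.
(* Bernoulli's inequality 1 + A / (n + 1) <= ((n + 2) / (n + 1))^A with the denominators cleared. *)
suff : (n.+1 ^ A * (A + n.+1) <= n.+1 * n.+2 ^ A)%N by nia.
elim: A => [|A IH]; first by rewrite !expn0; lia.
rewrite !expnS; set x := (n.+1 ^ A)%N in IH *; set y := (n.+2 ^ A)%N in IH *; nia.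
Qed.

Lemma growth_wt al : all (fun a => 0 < a) al -> growth (size al) (fun k => (wt (toC al) k)^-1).
Proof.
elim: al => [|a al IH] /=.
  move=> _; exists 0%N, 1; split=> // k _; rewrite invr1 normc1 expr0 mul1r //.
case/andP=> a0 /IH[A [M [M0 bM]]]; have [B HB] := poch_growth a0.
exists (A + B)%N, M; split=> // -[|i k] // [sk] /=.
rewrite invfM normcM wt1C -fmorphV invf_div normcR ger0_norm; last first.
  by rewrite divr_ge0 // ltW // poch_gt0.
rewrite exprD mulrA [leLHS]mulrC; apply: ler_pM; rewrite ?normc_ge0 ?divr_ge0 ?(ltW (poch_gt0 _ _)) //.
  apply: le_trans (bM k sk) _; rewrite ler_wpM2l // lerXn2r ?nnegrE ?ler0n //.
  by rewrite ler_nat ltnS leq_addl.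
apply: le_trans (HB i) _; rewrite lerXn2r ?nnegrE ?ler0n //.
by rewrite ler_nat ltnS leq_addr.
Qed.

End Weights.

(** * The binomial series and the kernel *)

Section Cpow.
Variable R : realType.
Local Notation C := R[i].

(** In the right half-plane, which contains 1 - x for |x| < 1, the argument defined by acos is an
    arctangent, which is easier to differentiate. *)
Lemma carg_atan (u v : R) : 0 < u -> carg (u +i* v)%C = atan (v / u).
Proof.
move=> u0; rewrite /carg /=.
have uv : 0 < u ^+ 2 + v ^+ 2 by rewrite ltr_pwDl ?exprn_gt0 ?sqr_ge0.
have E : u / Num.sqrt (u ^+ 2 + v ^+ 2) = cos (atan (v / u)).
  rewrite cos_atan; have -> : 1 + (v / u) ^+ 2 = (u ^+ 2 + v ^+ 2) / u ^+ 2.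
    by rewrite expr_div_n mulrDl divff // expf_neq0 // gt_eqF.
  rewrite sqrtrM ?ltW // sqrtrV ?sqr_ge0 // sqrtr_sqr gtr0_norm // invfM invrK mulrC //.
have := atan_gtNpi2 (v / u); have := atan_ltpi2 (v / u); have := pi_gt0 R.
rewrite E; case: (leP 0 v) => v0 p0 h1 h2.
  have at0 : 0 <= atan (v / u).
    by rewrite -(@atan0 R); apply: le_atan; rewrite divr_ge0 // ltW.
  by rewrite cosK // in_itv /= at0 /=; lra.
have at0 : atan (v / u) <= 0.
  by rewrite -(@atan0 R); apply: le_atan; rewrite ltW // pmulr_llt0 ?invr_gt0.
by rewrite cosKN ?opprK // at0 andbT; lra.
Qed.

Lemma is_derive_quad (f : R -> R) (t g K eta : R) : 0 < eta ->
  (forall h, `|h| < eta -> `|f (t + h) - f t - h * g| <= K * h ^+ 2) -> is_derive t 1 f g.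
Proof.
move=> eta0 fK.
have c : h^-1 *: ((f \o shift t) (h *: 1) - f t) @[h --> 0^'] --> g.
  apply/cvgrPdist_lt => e e0; have K0 : 0 < `|K| + 1 by rewrite ltr_wpDl.
  near=> h.
  have h0 : h != 0 by near: h; apply: nbhs_dnbhs_neq.
  have hr : `|h| < eta by near: h; apply: dnbhs0_lt.
  have he : `|h| < e / (`|K| + 1) by near: h; apply: dnbhs0_lt; rewrite divr_gt0.
  have := fK h hr; rewrite /= -[h *: 1]/(h * 1) mulr1 [h + t]addrC => B.
  have nh : 0 < `|h| by rewrite normr_gt0.
  have -> : g - h^-1 *: (f (t + h) - f t) = - (h^-1 * (f (t + h) - f t - h * g)).
    by rewrite -[h^-1 *: _]/(h^-1 * _); field.
  rewrite normrN normrM normfV -ltr_pdivlMl ?invr_gt0 // invrK.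
  apply: le_lt_trans B _; rewrite -[h ^+ 2]ger0_norm ?sqr_ge0 // normrX expr2 mulrA mulrC ltr_pM2l //.
  move: he; rewrite ltr_pdivlMr // mulrC => he; apply: le_lt_trans he.
  by rewrite ler_wpM2r // (le_trans (ler_norm K)) // lerDl.
apply: DeriveDef; first by apply/cvg_ex; exists g.
exact: cvg_lim c.
Unshelve. all: by end_near.
Qed.

Section Rotation.
Variables (a b s : R).

Let u t : R := 1 - t * a.
Let v t : R := - (t * b).
Let q t : R := u t ^+ 2 + v t ^+ 2.
Let L t := s / 2 * ln (q t).
Let Th t := s * atan (v t / u t).

Let du (t : R) : is_derive t 1 u (- a).
Proof. by rewrite /u; apply: is_derive_eq; rewrite /GRing.scale /= ?(mulr0,mul0r,addr0,add0r,mulr1,mul1r). Qed.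

Let dv (t : R) : is_derive t 1 v (- b).
Proof. by rewrite /v; apply: is_derive_eq; rewrite /GRing.scale /= ?(mulr0,mul0r,addr0,add0r,mulr1,mul1r). Qed.

Let q_gt0 t : 0 < u t -> 0 < q t.
Proof. by move=> u0; rewrite /q ltr_pwDl ?exprn_gt0 ?sqr_ge0. Qed.

Let dL (t : R) : 0 < u t -> is_derive t 1 L (s * (u t * - a + v t * - b) / q t).
Proof.
move=> u0; have q0 := q_gt0 u0.
have dq : is_derive t 1 q (2 * (u t * - a + v t * - b)).
  rewrite /q; apply: is_derive_eq; rewrite /GRing.scale /=; ring.
have d1 := @is_derive1_comp R (@ln R) q t _ _ (is_derive1_ln q0) dq.
have := is_deriveZ (s / 2) d1 => d2.
apply: (@is_derive_eq _ _ _ _ _ _ _ _ d2); rewrite /GRing.scale /=; field.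
by rewrite gt_eqF.
Qed.

Let dTh (t : R) : 0 < u t -> is_derive t 1 Th (s * (u t * - b - v t * - a) / q t).
Proof.
move=> u0; have q0 := q_gt0 u0; have un0 : u t != 0 by rewrite gt_eqF.
have dV := is_deriveV un0 (du t).
have dw : is_derive t 1 (fun t => v t / u t) ((u t * - b - v t * - a) / u t ^+ 2).
  apply: is_derive_eq; rewrite /GRing.scale /=; field.
  exact: un0.
have d1 := @is_derive1_comp R (@atan R) (fun t => v t / u t) t _ _ (is_derive1_atan (v t / u t)) dw.
have := is_deriveZ s d1 => d2.
apply: (@is_derive_eq _ _ _ _ _ _ _ _ d2); rewrite /GRing.scale /=.
have -> : (1 + (v t / u t) ^+ 2)^-1 = u t ^+ 2 / q t.
  rewrite -[u t ^+ 2]invrK -invfM; congr (_^-1); rewrite /q; field; exact: un0.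
by field; rewrite un0 gt_eqF.
Qed.

(** With [rot2], the real and imaginary parts of (1 - t (a + i b))^s, written in polar form. *)
Definition rot1 t := expR (L t) * cos (Th t).
Definition rot2 t := expR (L t) * sin (Th t).

Lemma is_derive_rot1 (t : R) : 0 < 1 - t * a -> is_derive t 1 rot1
  (s * (u t * - a + v t * - b) / q t * rot1 t - s * (u t * - b - v t * - a) / q t * rot2 t).
Proof.
move=> u0; have d1 := @is_derive1_comp R (@expR R) L t _ _ (is_derive_expR (L t)) (dL u0).
have d2 := @is_derive1_comp R (@cos R) Th t _ _ (is_derive_cos (Th t)) (dTh u0).
have := is_deriveM d1 d2 => d3.
by apply: (@is_derive_eq _ _ _ _ _ _ _ _ d3); rewrite /GRing.scale /rot1 /rot2 /=; ring.
Qed.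

Lemma is_derive_rot2 (t : R) : 0 < 1 - t * a -> is_derive t 1 rot2
  (s * (u t * - a + v t * - b) / q t * rot2 t + s * (u t * - b - v t * - a) / q t * rot1 t).
Proof.
move=> u0; have d1 := @is_derive1_comp R (@expR R) L t _ _ (is_derive_expR (L t)) (dL u0).
have d2 := @is_derive1_comp R (@sin R) Th t _ _ (is_derive_sin (Th t)) (dTh u0).
have := is_deriveM d1 d2 => d3.
by apply: (@is_derive_eq _ _ _ _ _ _ _ _ d3); rewrite /GRing.scale /rot1 /rot2 /=; ring.
Qed.

End Rotation.

Lemma rot_cpow (a b s : R) : 0 < 1 - a ->
  (rot1 a b s 1 +i* rot2 a b s 1)%C * cpow (1 - (a +i* b)%C) (- s) = 1.
Proof.
move=> u0; have -> : 1 - (a +i* b)%C = ((1 - a) +i* (- b))%C.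
  by apply/eqP; rewrite eq_complex /= add0r !eqxx.
rewrite /cpow carg_atan // /rot1 /rot2 !mul1r.
set q := _ ^+ 2 + _ ^+ 2; have q0 : 0 < q by rewrite /q ltr_pwDl ?exprn_gt0 ?sqr_ge0.
have sq0 : 0 < Num.sqrt q by rewrite sqrtr_gt0.
rewrite [normc _]/= -/q /powR (gt_eqF sq0) [- s * atan _]mulNr cosN sinN.
have -> : ln (Num.sqrt q) = ln q / 2.
  have qE : Num.sqrt q ^+ 2 = q by rewrite sqr_sqrtr // ltW.
  by rewrite -{2}qE lnXn // mulr2n; field.
set th := s * atan _; set e := expR (s / 2 * _).
have -> : expR (- s * (ln q / 2)) = e^-1 by rewrite /e -expRN; congr expR; ring.
have e0 : e != 0 by rewrite gt_eqF // expR_gt0.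
have := cos2Dsin2 th => cs.
apply/eqP; rewrite eq_complex /=; apply/andP; split; apply/eqP.
  rewrite !mul0r subr0 !addr0.
  by rewrite -cs; field.
by rewrite !mul0r !addr0; field.
Qed.

Lemma hpart1 (b : seq nat -> C) D (z : 'rV[C]_1) : hpart b D z = b [:: D] * z 0 0 ^+ D.
Proof.
rewrite /hpart (msum_single (k0 := [:: D])) //= ?addn0 //; first by rewrite /mon big_ord1.
by move=> [|i []] //= _; rewrite addn0 => ->; rewrite eqxx.
Qed.

Lemma const_on_unit_interval (f : R -> R) : (forall t : R, 0 <= t <= 1 -> is_derive t 1 f 0) -> f 1 = f 0.
Proof.
move=> df; have [||c _] := @MVT_segment R f (fun=> 0) 0 1 ler01.
- by move=> t; rewrite in_itv /= => /andP[t0 t1]; apply: df; rewrite !ltW.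
- apply: derivable_within_continuous => t; rewrite in_itv /= => t01.
  by have [] := df t t01.
by rewrite mul0r => /eqP; rewrite subr_eq0 => /eqP.
Qed.

(* Along the segment from 0 to x the power series solves the differential
   equation of (1 - t x)^(-s), so their quotient is constant. *)
Lemma binomial_series (x : C) (s : R) : normc x < 1 -> 0 < s ->
  (fun N => psum (fun k => (wt (toC [:: s]) k)^-1) N (const_mx x : 'rV[C]_1) : C^o) @ \oo -->
  (cpow (1 - x) (- s) : C^o).
Proof.
move=> x1 s0; set b := fun k : seq nat => _.
have gb : growth 1 b by apply: (@growth_wt R [:: s]); rewrite /= s0.
pose r' := (1 + normc x) / 2; have nx := normc_ge0 x.
have r'0 : 0 < r' by rewrite /r'; lra.
have r'1 : r' < 1 by rewrite /r'; lra.
pose z (t : R) : 'rV[C]_1 := const_mx ((t%:C)%C * x).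
have nz (t : R) : normc ((t%:C)%C * x) = `|t| * normc x by rewrite normcM normcR.
have zr (t : R) i : 0 <= t <= 1 -> normc (z t 0 i) <= r'.
  move=> /andP[t0 t1]; rewrite mxE nz ger0_norm // /r'; nra.
have zD (t : R) : 0 <= t <= 1 -> polydisc (z t).
  by move=> t01; apply: (polydisc_le r'1) => i; apply: zr.
have /choice[F FP] : forall w : 'rV[C]_1, exists l : C^o, polydisc w ->
    (fun N => psum b N w : C^o) @ \oo --> l.
  move=> w; have [wD|] := pselect (polydisc w); last by exists 0.
  by have [l cl] := psum_cvg gb wD; exists l.
have gb1 : growth 1 (pd 0 b) := growth_pd ord0 gb.
have /choice[F1 FP1] : forall w : 'rV[C]_1, exists l : C^o, polydisc w ->
    (fun N => psum (pd 0 b) N w : C^o) @ \oo --> l.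
  move=> w; have [wD|] := pselect (polydisc w); last by exists 0.
  by have [l cl] := psum_cvg gb1 wD; exists l.
have [K HK] := psum_taylor ord0 gb r'0 r'1.
have taylor (t h : R) : 0 <= t <= 1 -> `|h| < r' - normc x ->
   normc (F (z (t + h)) - F (z t) - (h%:C)%C * (x * F1 (z t))) <= K * normc x ^+ 2 * h ^+ 2.
  move=> t01 hr; have zth : z (t + h) = z t + ((h%:C)%C * x) *: delta_mx 0 ord0.
    by apply/rowP => i; rewrite !mxE !ord1 eqxx mulr1 -mulrDl rmorphD.
  have nzth : normc (z t 0 0 + (h%:C)%C * x) <= r'.
    rewrite mxE; apply: le_trans (ler_normcD _ _) _; rewrite !nz.
    by move: t01 => /andP[t0 t1]; rewrite ger0_norm //; have := normr_ge0 h; nra.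
  have zthD : polydisc (z (t + h)).
    apply: (polydisc_le r'1) => i; rewrite (_ : z (t + h) 0 i = z t 0 0 + (h%:C)%C * x) //.
    by rewrite !mxE rmorphD mulrDl.
  have := HK (z t) ((h%:C)%C * x) (F (z t)) (F (z (t + h))) (F1 (z t)) (fun i => zr t i t01) nzth (FP _ (zD _ t01)).
  rewrite -zth => /(_ (FP _ zthD) (FP1 _ (zD _ t01))).
  rewrite nz exprMn real_normK ?num_real // -mulrA => B.
  by apply: le_trans B _; rewrite [h ^+ 2 * _]mulrC mulrA.
have dRe (f : C -> R) (t : R) : (forall u v : C, f (u - v) = f u - f v) -> (forall (r : R) u, f ((r%:C)%C * u) = r * f u) ->
   (forall u, `|f u| <= normc u) -> 0 <= t <= 1 -> is_derive t 1 (fun t => f (F (z t))) (f (x * F1 (z t))).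
  move=> fB fZ fn t01; apply: (@is_derive_quad _ _ _ (K * normc x ^+ 2) (r' - normc x)).
    by rewrite /r'; lra.
  by move=> h hr; rewrite -fZ -!fB; apply: le_trans (fn _) _; apply: taylor.
pose g1 t := complex.Re (F (z t)); pose g2 t := complex.Im (F (z t)).
have dg1 (t : R) : 0 <= t <= 1 -> is_derive t 1 g1 (complex.Re (x * F1 (z t))).
  apply: dRe; [exact: ReB|exact: ReMR|move=> u].
  by case: u => p q /=; rewrite -sqrtr_sqr ler_wsqrtr // lerDl sqr_ge0.
have dg2 (t : R) : 0 <= t <= 1 -> is_derive t 1 g2 (complex.Im (x * F1 (z t))).
  apply: dRe; [by case=> ? ? [? ?]|by move=> r [? ?] /=; rewrite mul0r addr0|move=> u].
  by case: u => p q /=; rewrite -sqrtr_sqr ler_wsqrtr // lerDr sqr_ge0.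
(* The recursion (D + 1) b_(D+1) = (s + D) b_D of the binomial coefficients, summed over D. *)
have ode (t : R) : 0 <= t <= 1 -> (1 - (t%:C)%C * x) * F1 (z t) = (s%:C)%C * F (z t).
  move=> t01; have c1 := FP1 _ (zD _ t01); have c0 := FP _ (zD _ t01).
  have fin N : psum (pd 0 b) N.+1 (z t) =
      (s%:C)%C * psum b N.+1 (z t) + ((t%:C)%C * x) * psum (pd 0 b) N (z t).
    have hp D : hpart (pd 0 b) D (z t) = ((s%:C)%C + D%:R) * hpart b D (z t).
      rewrite !hpart1 /pd /b /= !mulr1 /wt1 rfS factS natrM mulrA; congr (_ * _).
      have sD : (s%:C)%C + D%:R != 0 :> C by rewrite gt_eqF // ltr_wpDr ?ler0n ?ltcR.
      have pD : rf (s%:C)%C D != 0 by rewrite gt_eqF // rf_gt0 // ltcR.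
      by rewrite !invf_div; field; rewrite pnatr_eq0 -lt0n fact_gt0 nat1r pnatr_eq0.
    rewrite {1}/psum (eq_bigr _ (fun (D : 'I_N.+1) _ => hp D)).
    under eq_bigr => D _ do rewrite mulrDl.
    rewrite big_split /= -mulr_sumr; congr (_ + _).
    rewrite big_ord_recl mul0r add0r mulr_sumr; apply: eq_bigr => D _.
    rewrite !hpart1 /pd /= /bump /= ?add1n mxE exprS; ring.
  have c1' : (fun N => psum (pd 0 b) N.+1 (z t) : C^o) @ \oo --> F1 (z t).
    by move: c1; rewrite -(cvg_shiftS (fun N => psum (pd 0 b) N (z t) : C^o)).
  have c0' : (fun N => psum b N.+1 (z t) : C^o) @ \oo --> F (z t).
    by move: c0; rewrite -(cvg_shiftS (fun N => psum b N (z t) : C^o)).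
  have c2 : (fun N => psum (pd 0 b) N.+1 (z t) : C^o) @ \oo -->
      ((s%:C)%C * F (z t) + ((t%:C)%C * x) * F1 (z t) : C^o).
    rewrite (_ : (fun N => _) = (fun N => (s%:C)%C * psum b N.+1 (z t) + ((t%:C)%C * x) * psum (pd 0 b) N (z t) : C^o)).
      by apply: cvgD; apply: ccvgZ.
    by apply/funext => N; rewrite fin.
  have E := ccvg_unique c1' c2.
  by rewrite mulrBl mul1r {1}E addrK.
pose a := complex.Re x; pose c := complex.Im x.
have xE : x = (a +i* c)%C by rewrite /a /c; case: (x).
have a1 : a < 1 by apply: le_lt_trans (ler_Re_normc x) x1.
have u0 (t : R) : 0 <= t <= 1 -> 0 < 1 - t * a by move=> /andP[t0 t1]; case: (leP a 0) => a0; nra.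
have odeE (t : R) : 0 <= t <= 1 ->
    g1 t = ((1 - t * a) * complex.Re (F1 (z t)) + t * c * complex.Im (F1 (z t))) / s /\
    g2 t = ((1 - t * a) * complex.Im (F1 (z t)) - t * c * complex.Re (F1 (z t))) / s.
  move=> t01; have := ode t t01; rewrite /g1 /g2 xE.
  case: (F (z t)) (F1 (z t)) => [p p'] [q q'] /eqP; rewrite eq_complex /=.
  rewrite !(mul0r, subr0, add0r, addr0) => /andP[/eqP E1 /eqP E2].
  by split; apply: (mulfI (lt0r_neq0 s0)); rewrite ?E1 ?E2; [rewrite -E1|rewrite -E2]; field; rewrite gt_eqF.
have dF (t : R) : 0 <= t <= 1 ->
    is_derive t 1 g1 (a * complex.Re (F1 (z t)) - c * complex.Im (F1 (z t))) /\
    is_derive t 1 g2 (a * complex.Im (F1 (z t)) + c * complex.Re (F1 (z t))).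
  move=> t01; have := dg1 t t01; have := dg2 t t01; rewrite xE.
  by case: (F1 (z t)).
have q0 (t : R) : 0 <= t <= 1 -> (1 - t * a) ^+ 2 + (- (t * c)) ^+ 2 != 0.
  by move=> t01; rewrite gt_eqF // ltr_pwDl ?exprn_gt0 ?u0 // sqr_ge0.
have sn0 : s != 0 by rewrite gt_eqF.
(* The two functions are the real and imaginary parts of F(t x) (1 - t x)^s. *)
have c1 := @const_on_unit_interval (fun t => g1 t * rot1 a c s t - g2 t * rot2 a c s t).
have c2 := @const_on_unit_interval (fun t => g1 t * rot2 a c s t + g2 t * rot1 a c s t).
have F0 : F (z 0) = 1.
  apply: ccvg_unique (FP _ (zD 0 _)) _; first by rewrite lexx ler01.
  rewrite -(cvg_shiftS (fun N => psum b N (z 0) : C^o)).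
  rewrite (_ : (fun N => _) = cst (1 : C^o)); first exact: cvg_cst.
  apply/funext => N; rewrite /psum big_ord_recl hpart1 /b /= /wt1 rf0 fact0 divr1 mulr1 invr1 mul1r.
  rewrite big1 ?addr0 ?expr0 // => i _; rewrite hpart1 mxE mul0r exprS !mul0r mulr0 //.
have F1E : F (z 1) * (rot1 a c s 1 +i* rot2 a c s 1)%C = 1.
  have r10 : rot1 a c s 0 = 1.
    by rewrite /rot1 !mul0r subr0 oppr0 expr1n expr0n addr0 ln1 mulr0 expR0 mul0r atan0 mulr0 cos0 mulr1.
  have r20 : rot2 a c s 0 = 0.
    by rewrite /rot2 !mul0r oppr0 mul0r atan0 mulr0 sin0 mulr0.
  have {c1} := c1 _; have {c2} := c2 _; rewrite r10 r20 /g1 /g2 F0 !mulr0 !mulr1 /= addr0 subr0 => c2 c1.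
  case: (F (z 1)) c1 c2 => p p' /= c1 c2; apply/eqP; rewrite eq_complex /=.
  apply/andP; split; apply/eqP.
    apply: c1 => t t01; have [d1 d2] := dF t t01.
    have e1 := is_derive_rot1 c s (u0 t t01); have e2 := is_derive_rot2 c s (u0 t t01).
    have := is_deriveB (is_deriveM d1 e1) (is_deriveM d2 e2) => d3.
    apply: (@is_derive_eq _ _ _ _ _ _ _ _ d3); rewrite /GRing.scale /=.
    by have [-> ->] := odeE t t01; field; rewrite q0 ?sn0.
  apply: c2 => t t01; have [d1 d2] := dF t t01.
  have e1 := is_derive_rot1 c s (u0 t t01); have e2 := is_derive_rot2 c s (u0 t t01).
  have := is_deriveD (is_deriveM d1 e2) (is_deriveM d2 e1) => d3.
  apply: (@is_derive_eq _ _ _ _ _ _ _ _ d3); rewrite /GRing.scale /=.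
  by have [-> ->] := odeE t t01; field; rewrite q0 ?sn0.
have z1 : z 1 = const_mx x by apply/rowP => i; rewrite !mxE mul1r.
have <- : F (z 1) = cpow (1 - x) (- s).
  have := @rot_cpow a c s; rewrite subr_gt0 -xE => /(_ a1) E.
  transitivity (F (z 1) * ((rot1 a c s 1 +i* rot2 a c s 1)%C * cpow (1 - x) (- s))).
    by rewrite E mulr1.
  by rewrite mulrA F1E mul1r.
by rewrite -z1; apply: FP; apply: zD; rewrite lexx ler01.
Qed.

End Cpow.

(** * Cauchy products and the expansion of the product kernel *)

Section KernelSeries.
Variable R : realType.
Local Notation C := R[i].

Lemma geometric_lt (M q e : R) : 0 <= q -> q < 1 -> 0 < e ->
  exists N0, forall N, (N0 <= N)%N -> M * q ^+ N < e.
Proof.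
move=> q0 q1 e0; have := @cvg_geometric R M q; rewrite ger0_norm // => /(_ q1).
move=> /cvgrPdist_lt/(_ e e0)[N0 _ HN]; exists N0 => N /HN /=.
by rewrite sub0r normrN; apply: le_lt_trans; apply: ler_norm.
Qed.

Lemma triangle_sum (u v : nat -> C) N : \sum_(D < N) \sum_(i < D.+1) u i * v (D - i)%N =
  \sum_(i < N) u i * \sum_(j < (N - i)%N) v j.
Proof.
elim: N => [|N IH]; first by rewrite !big_ord0.
rewrite big_ord_recr IH [RHS]big_ord_recr /= subSnn big_ord1 big_ord_recr /= subnn addrA.
congr (_ + _); rewrite -big_split; apply: eq_bigr => i _ /=.
by rewrite -mulrDr subSn ?(ltnW (ltn_ord i)) // big_ord_recr.
Qed.

(** The square and the triangle of partial sums differ by the terms u_i v_j with i, j < N and i + j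
    >= N, which are at most N^2 in number and each bounded by M^2 q^N. *)
Lemma cauchy_product (u v : nat -> C) (M q : R) (U W : C^o) : 0 <= M -> 0 <= q -> q < 1 ->
  (forall i, normc (u i) <= M * q ^+ i) -> (forall i, normc (v i) <= M * q ^+ i) ->
  (fun N => \sum_(i < N) u i : C^o) @ \oo --> U -> (fun N => \sum_(i < N) v i : C^o) @ \oo --> W ->
  (fun N => \sum_(D < N) \sum_(i < D.+1) u i * v (D - i)%N : C^o) @ \oo --> (U * W : C^o).
Proof.
move=> M0 q0 q1 uM vM cu cv.
have diff N : normc ((\sum_(i < N) u i) * (\sum_(i < N) v i) - \sum_(D < N) \sum_(i < D.+1) u i * v (D - i)%N)
    <= M ^+ 2 * (N.+1%:R ^+ 2 * q ^+ N).
  rewrite triangle_sum mulr_suml -sumrB; apply: le_trans (ler_normc_sum _ _ _) _.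
  apply: (@le_trans _ _ (\sum_(i < N) M ^+ 2 * (N%:R * q ^+ N))); last first.
    rewrite sumr_const card_ord -[leLHS]mulr_natr -[leLHS]mulrA ler_wpM2l ?sqr_ge0 // mulrAC ler_wpM2r ?exprn_ge0 //.
    by rewrite -natrX -natrM ler_nat; nia.
  apply: ler_sum => i _; have iN := ltnW (ltn_ord i); rewrite -mulrBr normcM.
  have -> : \sum_(j < N) v j - \sum_(j < (N - i)%N) v j = \sum_(j < i) v (N - i + j)%N.
    have E n p : \sum_(j < (n + p)%N) v j = \sum_(j < n) v j + \sum_(j < p) v (n + j)%N.
      by rewrite big_split_ord.
    by have := E (N - i)%N i; rewrite subnK // => ->; rewrite addrAC subrr add0r.
  apply: (@le_trans _ _ (M * q ^+ i * (N%:R * (M * q ^+ (N - i))))).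
    apply: ler_pM; rewrite ?normc_ge0 //; apply: le_trans (ler_normc_sum _ _ _) _.
    apply: (@le_trans _ _ (\sum_(j < i) M * q ^+ (N - i))).
      apply: ler_sum => j _; apply: le_trans (vM _) _; rewrite ler_wpM2l // exprD.
      by rewrite ler_piMr ?exprn_ge0 // exprn_ile1 // ltW.
    by rewrite sumr_const card_ord -[leLHS]mulr_natl ler_wpM2r ?mulr_ge0 ?exprn_ge0 // ler_nat.
  rewrite -[in leRHS](subnKC iN) exprD le_eqVlt; apply/orP; left; apply/eqP.
  by rewrite subnKC //; ring.
have [M' [p [M'0 p0 p1 H]]] := poly_geometric 2 q0 q1.
have cuv : (fun N => (\sum_(i < N) v i) * (\sum_(i < N) u i) : C^o) @ \oo --> (W * U : C^o).
  exact: (cvgZ cv cu).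
apply/ccvgP => e e0; have /ccvgP/(_ _ (divr_gt0 e0 (ltr0Sn R 1)))[N1 H1] := cuv.
have [N2 H2] := geometric_lt (M ^+ 2 * M') p0 p1 (divr_gt0 e0 (ltr0Sn R 1)).
exists (N1 + N2)%N => N NN; have := H1 N (leq_trans (leq_addr _ _) NN).
have := H2 N (leq_trans (leq_addl _ _) NN); have := diff N.
set S := \sum_(D < N) _; set A := \sum_(i < N) u i; set B := \sum_(i < N) v i => h1 h2 h3.
have -> : S - U * W = (B * A - W * U) - (A * B - S) by ring.
apply: le_lt_trans (ler_normcB _ _) _.
have : M ^+ 2 * (N.+1%:R ^+ 2 * q ^+ N) <= M ^+ 2 * M' * p ^+ N by rewrite -mulrA ler_wpM2l ?sqr_ge0.
lra.
Qed.

Lemma mon_cons d (z : 'rV[C]_d.+1) i k :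
  mon z (i :: k) = z 0 ord0 ^+ i * mon (\row_j z 0 (lift ord0 j)) k.
Proof.
by rewrite /mon big_ord_recl; congr (_ * _); apply: eq_bigr => j _; rewrite mxE.
Qed.

Lemma kernel_series (al : seq R) (z : 'rV[C]_(size al)) : all (fun a => 0 < a) al ->
  (forall j, normc (z 0 j) < 1) ->
  (fun N => psum (fun k => (wt (toC al) k)^-1) N z : C^o) @ \oo -->
  (\prod_(j < size al) cpow (1 - z 0 j) (- nth 0 al j) : C^o).
Proof.
elim: al z => [|a al IH] z.
  move=> _ _; rewrite big_ord0 -(cvg_shiftS (fun N => psum _ N z : C^o)).
  rewrite (_ : (fun N => _) = cst (1 : C^o)); first exact: cvg_cst.
  apply/funext => N; rewrite /psum big_ord_recl hpart0 /= invr1 big1 ?addr0 //.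
move=> /andP[a0 p] z1; pose z' : 'rV[C]_(size al) := \row_j z 0 (lift ord0 j).
pose x : 'rV[C]_1 := const_mx (z 0 ord0).
have z'1 j : normc (z' 0 j) < 1 by rewrite mxE.
have cz' := IH z' p z'1; have cx := binomial_series (z1 ord0) a0.
have -> : \prod_(j < size (a :: al)) cpow (1 - z 0 j) (- nth 0 (a :: al) j) =
    cpow (1 - z 0 ord0) (- a) * \prod_(j < size al) cpow (1 - z' 0 j) (- nth 0 al j).
  by rewrite big_ord_recl; congr (_ * _); apply: eq_bigr => j _; rewrite mxE.
have pD n (y : 'rV[C]_n) : (forall j, normc (y 0 j) < 1) -> polydisc y.
  by move=> y1 j; rewrite normE -[1]/((1 : R)%:C)%C ltcR.
have [r /andP[r0 r1] zr] := polydisc_radius (pD _ _ z1).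
have xr j : normc (x 0 j) <= r by rewrite mxE.
have z'r j : normc (z' 0 j) <= r by rewrite mxE.
have [A [M [M0 bM]]] := @growth_wt R al p.
have [A1 [M1 [M10 bM1]]] : growth 1 (fun k => (wt (toC [:: a]) k)^-1).
  by apply: (@growth_wt R [:: a]); rewrite /= a0.
have [M' [q [M'0 q0 q1 H]]] := poly_geometric (size al + A + (1 + A1)) (ltW r0) r1.
have dom B (D : nat) : (B <= size al + A + (1 + A1))%N -> D.+1%:R ^+ B * r ^+ D <= M' * q ^+ D.
  move=> BA; apply: le_trans (H D); rewrite ler_wpM2r ?exprn_ge0 ?(ltW r0) //.
  by rewrite ler_weXn2l // ler1n.
pose MM := (M + M1) * M'; have MM0 : 0 <= MM by rewrite mulr_ge0 ?addr_ge0.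
have ux D : normc (hpart (fun k => (wt (toC [:: a]) k)^-1) D x) <= MM * q ^+ D.
  apply: le_trans (normc_hpart D M10 bM1 xr (ltW r0)) _; rewrite /MM -mulrA.
  apply: ler_pM => //; first by rewrite mulr_ge0 ?exprn_ge0 ?(ltW r0).
    by rewrite lerDr.
  by apply: dom; lia.
have vz D : normc (hpart (fun k => (wt (toC al) k)^-1) D z') <= MM * q ^+ D.
  apply: le_trans (normc_hpart D M0 bM z'r (ltW r0)) _; rewrite /MM -mulrA.
  apply: ler_pM => //; first by rewrite mulr_ge0 ?exprn_ge0 ?(ltW r0).
    by rewrite lerDl.
  exact/dom/leq_addr.
have c := cauchy_product MM0 q0 q1 ux vz cx cz'.
have E N : psum (fun k => (wt (toC (a :: al)) k)^-1) N z = \sum_(D < N) \sum_(i < D.+1)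
    hpart (fun k => (wt (toC [:: a]) k)^-1) i x * hpart (fun k => (wt (toC al) k)^-1) (D - i)%N z'.
  apply: eq_bigr => D _; rewrite {1}/hpart [LHS]/=.
  apply: eq_bigr => i _; rewrite hpart1 mxE mulr_msumr; apply: eq_msum => k _ _ /=.
  by rewrite mulr1 invfM mon_cons -/z'; ring.
by have EE := @funext nat C (fun N => psum (fun k => (wt (toC (a :: al)) k)^-1) N z) _ E; rewrite -EE in c; exact: c.
Qed.

End KernelSeries.

Lemma sumn_eq0 k : sumn k = 0%N -> k = nseq (size k) 0%N.
Proof.
elim: k => //= i k IH /eqP; rewrite addn_eq0 => /andP[/eqP -> /eqP /IH <-] //.
Qed.

Lemma incr_nthP k : (0 < sumn k)%N ->
  exists j k', [/\ (j < size k)%N, size k' = size k & k = incr_nth k' j].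
Proof.
elim: k => //= -[|i] k IH h; last by exists 0%N, (i :: k).
have [j [k' [jk sk' kE]]] := IH h; exists j.+1, (0%N :: k').
by split; rewrite /= ?sk' // {1}kE.
Qed.

(** * Vanishing along the diagonal *)

Section Vanishing.
Variables (R : realType) (d : nat).
Local Notation C := R[i].
Local Notation fn := ('rV[C]_d -> C^o).
Implicit Types (b c : seq nat -> C) (k : seq nat).

Lemma eq_pd j b c k : (j < d)%N -> size k = d ->
  (forall x, size x = d -> b x = c x) -> pd j b k = pd j c k.
Proof. by move=> jd sk bc; rewrite /pd bc // size_incr_nth sk jd. Qed.

Lemma pdC i j b k : pd i (pd j b) k = pd j (pd i b) k.
Proof.
rewrite /pd !nth_incr_nth incr_nthC; case: (eqVneq i j) => [-> //|ij].
by rewrite !add0n mulrCA.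
Qed.

Lemma Lm_pd b k : size k = d -> Lm b k = \sum_(j < d) pd j b k.
Proof.
elim: k d b => [|i k IH] [|d'] b //=; first by rewrite big_ord0.
case=> sk; rewrite big_ord_recl /pd /=; congr (_ + _).
by rewrite (IH d').
Qed.

Lemma pd_Lm j b k : (j < d)%N -> size k = d -> Lm (pd j b) k = pd j (Lm b) k.
Proof.
move=> jd sk; rewrite Lm_pd // [RHS]/pd Lm_pd ?size_incr_nth ?sk ?jd // mulr_sumr.
by apply: eq_bigr => i _; rewrite pdC.
Qed.

Lemma iter_Lm_pds N (s : seq 'I_d) b k : size k = d ->
  iter N (@Lm C) (pds s b) k = pds s (iter N (@Lm C) b) k.
Proof.
elim: s k => [//|j s IH] k sk /=.
have E M c x : size x = d -> iter M (@Lm C) (pd j c) x = pd j (iter M (@Lm C) c) x.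
  elim: M x => [//|M IHM] x sx; rewrite !iterS.
  rewrite (@eq_Lm _ _ (pd j (iter M (@Lm C) c))) => [|y sy _]; last by rewrite IHM ?sy.
  by rewrite pd_Lm.
by rewrite E //; apply: eq_pd => // x sx; apply: IH.
Qed.

(** Euler's identity: the sum of the coefficients of degree D is the value of the homogeneous part
    at (1,...,1), and [Lm] differentiates in that direction. *)
Lemma msum_Lm D b : msum d D (Lm b) = D.+1%:R * msum d D.+1 b.
Proof.
transitivity (\sum_(j < d) msum d D.+1 (fun k => (nth 0%N k j)%:R * b k)).
  rewrite -exchange_msum.
  transitivity (\sum_(j < d) msum d D (pd j b)).
    by rewrite -exchange_msum; apply: eq_msum => k sk _; rewrite Lm_pd.
  rewrite exchange_msum; apply: eq_bigr => j _; rewrite [RHS](msum_incr _ (ltn_ord j)) => [|k _ ->].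
    by apply: eq_msum => k sk _; rewrite nth_incr_nth eqxx.
  by rewrite mul0r.
rewrite -exchange_msum mulr_msumr; apply: eq_msum => k sk kD.
by rewrite -mulr_suml -natr_sum -sumn_nth // kD.
Qed.

Lemma iter_Lm_zero N b : iter N (@Lm C) b (nseq d 0%N) = N`!%:R * msum d N b.
Proof.
elim: N b => [|N IH] b; first by rewrite /= msum_in_degree0 fact0 mul1r.
by rewrite iterSr IH msum_Lm factS natrM mulrCA mulrA.
Qed.

Lemma pds_zeroP n c :
  (forall s : seq 'I_d, (size s < n)%N -> pds s c (nseq d 0%N) = 0) <->
  (forall k, size k = d -> (sumn k < n)%N -> c k = 0).
Proof.
split.
  elim: n c => [//|n IH] c h k sk kn.
  have [k0|kp] := posnP (sumn k); first by rewrite (sumn_eq0 k0) sk; apply: (h [::]).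
  have [j [k' [jk sk' kE]]] := incr_nthP kp; rewrite sk in jk sk'.
  have := IH (pd j c) _ k' sk'; rewrite /pd -kE => E.
  have /eqP : (nth 0%N k' j).+1%:R * c k = 0.
    apply: E; last by move: kn; rewrite kE sumn_incr_nth.
    move=> s sn; have := h (rcons s (Ordinal jk)); rewrite size_rcons /pds foldr_rcons.
    exact.
  by rewrite mulf_eq0 pnatr_eq0 => /eqP.
move=> h s sn; suff : forall k, size k = d -> (sumn k + size s < n)%N -> pds s c k = 0.
  apply; first by rewrite size_nseq.
  by rewrite sumn_nseq mul0n.
elim: s {sn} => [|j s IH] k sk kn; first by apply: h => //; rewrite addn0 in kn.
rewrite /= /pd IH ?mulr0 // ?size_incr_nth ?sk ?ltn_ord // sumn_incr_nth.
by rewrite addSnnS.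
Qed.

Lemma psum_at0 b : (fun N => psum b N (0 : 'rV[C]_d) : C^o) @ \oo --> (b (nseq d 0%N) : C^o).
Proof.
rewrite -(cvg_shiftS (fun N => psum b N (0 : 'rV[C]_d) : C^o)).
rewrite (_ : (fun N => _) = cst (b (nseq d 0%N) : C^o)); first exact: cvg_cst.
apply/funext => N; rewrite /psum big_ord_recl hpart0 big1 ?addr0 // => i _.
apply: msum0 => k sk; rewrite lift0 => kE.
have [j [k' [jk sk' kE']]] : exists j k', [/\ (j < size k)%N, size k' = size k & k = incr_nth k' j].
  by apply: incr_nthP; rewrite kE.
rewrite sk in jk; rewrite (mon_split _ _ (Ordinal jk)) mxE /= kE' nth_incr_nth eqxx add1n.
by rewrite exprS !mul0r mulr0.
Qed.

Lemma polydisc0 : polydisc (0 : 'rV[C]_d).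
Proof. by move=> j; rewrite mxE normr0 ltr01. Qed.

Lemma partials0 (s : seq 'I_d) : partials s (cst 0 : fn) = cst 0.
Proof.
elim: s => //= j s ->; apply/funext => z; exact: derive_cst.
Qed.

Lemma psum_zero b : growth d b ->
  (forall w : 'rV[C]_d, polydisc w -> (fun N => psum b N w : C^o) @ \oo --> (0 : C^o)) ->
  forall k, size k = d -> b k = 0.
Proof.
move=> gb b0 k sk; apply: (pds_zeroP (sumn k).+1 b).1 => // s _.
have := @partials_psum R d (cst 0) b s 0 gb b0 polydisc0; rewrite partials0.
move=> c; have E : (pds s b (nseq d 0%N) : C^o) = 0 := ccvg_unique (@psum_at0 (pds s b)) c.
exact: E.
Qed.

Lemma psum_unique b c (f : fn) : growth d b -> growth d c ->
  (forall w : 'rV[C]_d, polydisc w -> (fun N => psum b N w : C^o) @ \oo --> f w) ->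
  (forall w : 'rV[C]_d, polydisc w -> (fun N => psum c N w : C^o) @ \oo --> f w) ->
  forall k, size k = d -> b k = c k.
Proof.
move=> [A [M [M0 bM]]] [A' [M' [M'0 cM]]] cb cc k sk; apply/eqP; rewrite -subr_eq0; apply/eqP.
apply: (@psum_zero (fun k => b k - c k)) sk => [|w wD].
  exists (A + A')%N, (M + M'); split=> [|x sx]; first exact: addr_ge0.
  apply: le_trans (ler_normcB _ _) _; rewrite mulrDl; apply: lerD.
    apply: le_trans (bM x sx) _; rewrite ler_wpM2l // ler_weXn2l ?ler1n ?leq_addr //.
  apply: le_trans (cM x sx) _; rewrite ler_wpM2l // ler_weXn2l ?ler1n ?leq_addl //.
rewrite -(subrr (f w)).
have E N : psum (fun k => b k - c k) N w = psum b N w - psum c N w.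
  rewrite /psum -sumrB; apply: eq_bigr => D _; rewrite /hpart -[X in _ - X]mul1r -mulN1r mulrA mulr1.
  rewrite mulr_msumr -msumD; apply: eq_msum => x _ _; ring.
have EE := @funext nat C (fun N => psum (fun k => b k - c k) N w) _ E.
rewrite [X in X @ _](EE); exact: cvgB (cb w wD) (cc w wD).
Qed.

End Vanishing.

Section VanishingOrder.
Variables (R : realType) (d : nat).
Local Notation C := R[i].
Local Notation fn := ('rV[C]_d -> C^o).

(** A partial derivative vanishes on the diagonal iff all its powers of L vanish at 0, by
    [iter_Lm_zero]. As L commutes with partial derivatives, the condition says that the partial
    derivatives of order < n of each L^N f vanish at 0, which concerns the low coefficients. *)
Lemma vanishP n b (f : fn) : (0 < d)%N -> growth d b ->
  (forall w : 'rV[C]_d, polydisc w -> (fun N => psum b N w : C^o) @ \oo --> f w) ->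
  vanishes_to_order n f <->
  forall N k, size k = d -> (sumn k < n)%N -> iter N (@Lm C) b k = 0.
Proof.
move=> d0 gb bf.
have diag_psum c N (t : C) : psum c N (const_mx t : 'rV[C]_d) = \sum_(D < N) msum d D c * t ^+ D.
  apply: eq_bigr => D _; rewrite mulr_msuml; apply: eq_msum => k sk kD; congr (_ * _).
  by rewrite -kD (sumn_nth sk) -prodrXr; apply: eq_bigr => j _; rewrite mxE.
have step : vanishes_to_order n f <->
    forall s : seq 'I_d, (size s < n)%N -> forall D, msum d D (pds s b) = 0.
  split=> [h s sn D | h s sn z [zD zE]].
    have [A [M [M0 bM]]] := growth_pds s gb.
    (* Along the diagonal the series depends on the single variable t, and its coefficients in t
       must vanish. *)
    have := @psum_zero R 1 (fun k => msum d (sumn k) (pds s b)) _ _ [:: D]; rewrite /= addn0; apply=> //.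
      exists (d + A)%N, M; split=> // k _; apply: le_trans (normc_msum _ _ _) _.
      rewrite exprD mulrCA; apply: msum_le_const => [|x sx xD].
        by rewrite mulr_ge0 // exprn_ge0 ?ler0n.
      by rewrite -xD; apply: bM.
    move=> w wD; have tD : polydisc (const_mx (w 0 0) : 'rV[C]_d) by move=> j; rewrite mxE.
    have c := @partials_psum R d f b s _ gb bf tD; rewrite h // in c; last by split=> // i j; rewrite !mxE.
    have E N : psum (pds s b) N (const_mx (w 0 0) : 'rV[C]_d) = psum (fun k => msum d (sumn k) (pds s b)) N w.
      by rewrite diag_psum; apply: eq_bigr => D' _; rewrite hpart1 /= addn0.
    have EE := @funext nat C (fun N => psum (pds s b) N (const_mx (w 0 0) : 'rV[C]_d)) _ E.
    by rewrite EE in c; exact: c.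
  have zE' : z = const_mx (z 0 (Ordinal d0)) by apply/rowP => j; rewrite mxE (zE j (Ordinal d0)).
  apply: ccvg_unique (@partials_psum R d f b s _ gb bf zD) _.
  rewrite (_ : (fun N => _) = cst (0 : C^o)); first exact: cvg_cst.
  by apply/funext => N; rewrite zE' diag_psum big1 // => D _; rewrite h // mul0r.
rewrite step; split=> h.
  move=> N; apply: (@pds_zeroP R d n (iter N (@Lm C) b)).1 => s sn.
  by rewrite -iter_Lm_pds ?size_nseq // iter_Lm_zero h // mulr0.
move=> s sn D; have /eqP := iter_Lm_zero d D (pds s b).
rewrite iter_Lm_pds ?size_nseq // ((@pds_zeroP R d n _).2 (h D) s sn) eq_sym mulf_eq0 pnatr_eq0.
by rewrite -leqn0 leqNgt fact_gt0 => /eqP.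
Qed.

End VanishingOrder.

(** * Sums over all exponents of degree less than N *)

Section TruncatedSums.
Definition tsum (V : nmodType) d N (F : seq nat -> V) : V := \sum_(D < N) msum d D F.

Lemma eq_tsum (V : nmodType) d N (F G : seq nat -> V) :
  (forall k, size k = d -> (sumn k < N)%N -> F k = G k) -> tsum d N F = tsum d N G.
Proof. by move=> FG; apply: eq_bigr => D _; apply: eq_msum => k sk kD; rewrite FG ?kD. Qed.

Lemma tsumD (V : nmodType) d N (F G : seq nat -> V) :
  tsum d N (fun k => F k + G k) = tsum d N F + tsum d N G.
Proof. by rewrite -big_split; apply: eq_bigr => D _; rewrite msumD. Qed.

Lemma morph_tsum (V W : nmodType) (f : V -> W) d N F :
  f 0 = 0 -> {morph f : x y / x + y} -> f (tsum d N F) = tsum d N (fun k => f (F k)).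
Proof.
move=> f0 fD; rewrite (big_morph f fD f0); apply: eq_bigr => D _.
exact: morph_msum.
Qed.

Lemma mulr_tsumr (A : pzSemiRingType) (x : A) d N F :
  x * tsum d N F = tsum d N (fun k => x * F k).
Proof. by apply: (morph_tsum (f := *%R x)); [rewrite mulr0|move=> y z; rewrite mulrDr]. Qed.

Lemma tsum_ge0 (A : numDomainType) d N (F : seq nat -> A) :
  (forall k, size k = d -> 0 <= F k) -> 0 <= tsum d N F.
Proof. by move=> F0; apply: sumr_ge0 => D _; apply: msum_ge0 => k sk _; apply: F0. Qed.

Lemma ler_tsum (A : numDomainType) d N (F G : seq nat -> A) :
  (forall k, size k = d -> F k <= G k) -> tsum d N F <= tsum d N G.
Proof. by move=> FG; apply: ler_sum => D _; apply: ler_msum => k sk _; apply: FG. Qed.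

Lemma tsum_le (A : numDomainType) d N M (F : seq nat -> A) : (N <= M)%N ->
  (forall k, size k = d -> 0 <= F k) -> tsum d N F <= tsum d M F.
Proof.
move=> NM F0; rewrite -(subnKC NM) /tsum big_split_ord /= lerDl.
by apply: sumr_ge0 => D _; apply: msum_ge0 => k sk _; apply: F0.
Qed.

Lemma tsum_tail (V : zmodType) d N M (F : seq nat -> V) : (N <= M)%N ->
  tsum d M F - tsum d N F = tsum d M (fun k => if (N <= sumn k)%N then F k else 0).
Proof.
move=> NM; have E (G : nat -> V) : \sum_(D < M) G D = \sum_(D < N) G D + \sum_(D < M - N) G (N + D)%N.
  have E p q : \sum_(D < (p + q)%N) G D = \sum_(D < p) G D + \sum_(D < q) G (p + D)%N.
    by rewrite big_split_ord.
  by have := E N (M - N)%N; rewrite subnKC.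
rewrite /tsum (E (fun D => msum d D F)) (E (fun D => msum d D (fun k => if (N <= sumn k)%N then F k else 0))) [X in X - _]addrC addrK [X in _ = X + _]big1 ?add0r => [|D _]; last first.
  by apply: msum0 => k _ ->; rewrite leqNgt ltn_ord.
by apply: eq_bigr => D _; apply: eq_msum => k _ ->; rewrite leq_addr.
Qed.

Lemma tsum_single (V : nmodType) d N F k0 : size k0 = d -> (sumn k0 < N)%N ->
  (forall k, size k = d -> k != k0 -> F k = 0) -> tsum d N F = F k0 :> V.
Proof.
move=> sk kN F0; rewrite /tsum (bigD1 (Ordinal kN)) //= big1 ?addr0 => [|D DN].
  by apply: msum_single => // k s _; apply: F0.
apply: msum0 => k s kD; apply: F0 => //; apply: contraNneq DN => kk.
by apply/eqP/val_inj; rewrite /= -kD kk.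
Qed.

Variable R : realType.

Lemma tsum_cauchy_schwarz d N (u v : seq nat -> R) :
  tsum d N (fun k => u k * v k) ^+ 2 <= tsum d N (fun k => u k ^+ 2) * tsum d N (fun k => v k ^+ 2).
Proof.
set P := tsum d N _; set A := tsum d N _; set B := tsum d N _.
have quad x y : 0 <= x ^+ 2 * A + 2 * x * y * P + y ^+ 2 * B.
  have <- : tsum d N (fun k => (x * u k + y * v k) ^+ 2) = x ^+ 2 * A + 2 * x * y * P + y ^+ 2 * B.
    rewrite /A /B /P !mulr_tsumr -!tsumD; apply: eq_tsum => k _ _; ring.
  by apply: tsum_ge0 => k _; apply: sqr_ge0.
have B0 : 0 <= B by apply: tsum_ge0 => k _; apply: sqr_ge0.
have A0 : 0 <= A by apply: tsum_ge0 => k _; apply: sqr_ge0.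
have [B00|Bn0] := eqVneq B 0.
  have [->|Pn0] := eqVneq P 0; first by rewrite expr0n mulr_ge0.
  have := quad 1 (- (A + 1) / P); rewrite B00.
  have -> : 1 ^+ 2 * A + 2 * 1 * (- (A + 1) / P) * P + (- (A + 1) / P) ^+ 2 * 0 = - A - 2.
    by field.
  lra.
have Bp : 0 < B by rewrite lt_def Bn0.
have := quad B (- P); rewrite (_ : _ + _ = B * (A * B - P ^+ 2)); last by ring.
by rewrite pmulr_rge0 // subr_ge0.
Qed.

End TruncatedSums.

(** * The weighted Hilbert spaces *)

Section DiagonalKernel.
Variables (R : realType) (d : nat).
Local Notation C := R[i].
Local Notation fn := ('rV[C]_d -> C^o).
Variables (al : seq R) (C0 : R) (H : hspace fn).
Hypothesis sz : size al = d.
Hypothesis al_pos : all (fun a => 0 < a) al.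
Hypothesis C0_gt0 : 0 < C0.
Let Ker (z w : 'rV[C]_d) : C := (C0%:C)%C * \prod_(j < d) cpow (1 - z 0 j * (w 0 j)^*) (- nth 0 al j).
Hypothesis hrk : is_rkhs (@polydisc R d) Ker H.

Let hH : is_hilbert H. Proof. by case: hrk. Qed.
Let wC := wt (toC al).
Let wr k : R := complex.Re (wC k).

Let posC : pos (toC al). Proof. by rewrite pos_toC. Qed.

Let wCE k : wC k = ((wr k)%:C)%C.
Proof. by apply: ge0_Re; rewrite ltW // wt_gt0. Qed.

Let wr_gt0 k : 0 < wr k.
Proof. by have := wt_gt0 k posC; rewrite -/wC wCE ltcR. Qed.

Let sp (F : seq nat -> R) N := tsum d N F.

Let Kw (w : 'rV[C]_d) : fn := fun z => if z \in @polydisc R d then Ker z w else 0.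

Let KwH w : polydisc w -> H (Kw w).
Proof. by move=> wD; have [_ _ h] := hrk; have [] := h w wD. Qed.

Let reproducing (f : fn) w : H f -> polydisc w -> f w = hip H f (Kw w).
Proof. by move=> Hf wD; have [_ _ h] := hrk; have [_] := h w wD; apply. Qed.

Lemma outside (f : fn) z : H f -> ~ polydisc z -> f z = 0.
Proof. by move=> Hf; have [_ h _] := hrk; apply: h. Qed.

(** Cut off outside the polydisc, as [is_rkhs] demands of the members of the space. *)
Definition monF k : fn := fun z => if z \in @polydisc R d then mon z k else 0.
Definition polF N (b : seq nat -> C) : fn := tsum d N (fun k => b k *: monF k).

Let monF_in k z : polydisc z -> monF k z = mon z k.
Proof. by move=> zD; rewrite /monF mem_set. Qed.

Let monF_out k z : ~ polydisc z -> monF k z = 0.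
Proof. by move=> zD; rewrite /monF memNset. Qed.

Let eval_msum D (F : seq nat -> fn) z : msum d D F z = msum d D (fun k => F k z).
Proof. by apply: (morph_msum (f := fun g : fn => g z)). Qed.

Lemma polF_in N b z : polydisc z -> polF N b z = psum b N z.
Proof.
move=> zD; rewrite /polF /tsum fct_sumE; apply: eq_bigr => D _; rewrite eval_msum.
by apply: eq_msum => k _ _; rewrite -(monF_in k zD).
Qed.

Lemma polF_out N b z : ~ polydisc z -> polF N b z = 0.
Proof.
move=> zD; rewrite /polF /tsum fct_sumE big1 // => D _; rewrite eval_msum.
by apply: msum0 => k _ _; rewrite -[LHS]/(b k * monF k z) monF_out ?mulr0.
Qed.

Let ksum (w z : 'rV[C]_d) N : C := (C0%:C)%C * tsum d N (fun k => (wC k)^-1 * (mon z k * (mon w k)^*)).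

Let ksum_cvg w z : polydisc w -> polydisc z -> (fun N => ksum w z N : C^o) @ \oo --> (Ker z w : C^o).
Proof.
move=> wD zD; apply: ccvgZ; pose x : 'rV[C]_d := \row_j (z 0 j * (w 0 j)^*).
have x1 j : normc (x 0 j) < 1.
  have := zD j; have := wD j; rewrite !normE -[1]/((1 : R)%:C)%C !ltcR => w1 z1.
  rewrite mxE normcM normcJ; apply: le_lt_trans z1; rewrite ler_piMr ?normc_ge0 //.
  exact: ltW.
have gen (n : nat) (e : size al = n) (y : 'rV[C]_n) : (forall j, normc (y 0 j) < 1) ->
    (fun N => psum (fun k => (wC k)^-1) N y : C^o) @ \oo --> (\prod_(j < n) cpow (1 - y 0 j) (- nth 0 al j) : C^o).
  by case: n / e y => y y1; apply: kernel_series.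
have c := gen d sz x x1.
rewrite (eq_bigr (fun j => cpow (1 - z 0 j * (w 0 j)^*) (- nth 0 al j))) in c; last first.
  by move=> j _; rewrite mxE.
have E N : tsum d N (fun k => (wC k)^-1 * (mon z k * (mon w k)^*)) = psum (fun k => (wC k)^-1) N x.
  apply: eq_bigr => D _; apply: eq_msum => k _ _; congr (_ * _).
  rewrite /mon rmorph_prod -big_split; apply: eq_bigr => j _.
  by rewrite mxE exprMn rmorphXn.
have EE := @funext nat C (fun N => tsum d N (fun k => (wC k)^-1 * (mon z k * (mon w k)^*))) _ E.
rewrite -EE in c; exact: c.
Qed.

Let moment (s : seq (C * 'rV[C]_d)) k : C := \sum_(p <- s) p.1 * (mon p.2 k)^*.
Let kcomb (s : seq (C * 'rV[C]_d)) : fn := \sum_(p <- s) p.1 *: Kw p.2.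
Let inD (s : seq (C * 'rV[C]_d)) := forall p, p \in s -> polydisc p.2.

Let kcombH s : inD s -> H (kcomb s).
Proof.
move=> sD; rewrite /kcomb big_seq; apply: hspace_sum => // p ps.
by apply: hspaceZ => //; apply: KwH; apply: sD.
Qed.

(** The squared norm of a combination of kernel functions is C0 times the sum of |moment|^2 /
    weight. It is computed from kernel values alone, before any monomial is known to lie in H. *)
Let hip_kcomb_cvg s : inD s ->
  (fun N => ((C0 * sp (fun k => (wr k)^-1 * normc (moment s k) ^+ 2) N)%:C)%C : C^o) @ \oo -->
  (hip H (kcomb s) (kcomb s) : C^o).
Proof.
move=> sD.
have -> : hip H (kcomb s) (kcomb s) = \sum_(p <- s) \sum_(p' <- s) p.1 * p'.1^* * Ker p'.2 p.2.
  rewrite {1}/kcomb big_seq hip_suml ?kcombH // => [|p ps|]; last exact: kcombH.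
    rewrite [RHS]big_seq; apply: eq_bigr => p ps; have pD := sD _ ps.
    rewrite hipZl ?kcombH //; try exact: KwH; try exact: kcombH.
    rewrite (hipC hH (kcombH sD) (KwH pD)) /kcomb big_seq hip_suml ?KwH //; last first.
    - by exact: KwH.
    - by move=> p' p's; apply: hspaceZ => //; apply: KwH; apply: sD.
    rewrite rmorph_sum mulr_sumr [RHS]big_seq; apply: eq_bigr => p' p's; have p'D := sD _ p's.
    rewrite hipZl ?KwH //; try exact: KwH.
    rewrite rmorphM /= -mulrA; congr (_ * (_ * _)).
    rewrite -hipC //; try exact: KwH.
    by rewrite -(reproducing (KwH pD) p'D) /Kw mem_set.
  by apply: hspaceZ => //; apply: KwH; apply: sD.
have E N : ((C0 * sp (fun k => (wr k)^-1 * normc (moment s k) ^+ 2) N)%:C)%C =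
    \sum_(p <- s) \sum_(p' <- s) p.1 * p'.1^* * ksum p.2 p'.2 N.
  rewrite rmorphM /= (morph_tsum (f := real_complex R)) ?rmorph0 //; last exact: rmorphD.
  transitivity (\sum_(p <- s) \sum_(p' <- s) (C0%:C)%C * tsum d N (fun k =>
     (wC k)^-1 * ((p.1 * (mon p.2 k)^*) * (p'.1 * (mon p'.2 k)^*)^*))).
    under eq_bigr => p _ do rewrite -mulr_sumr.
    rewrite -mulr_sumr; congr (_ * _).
    pose T (F : seq nat -> C) := tsum d N F.
    have Tsum (F : C * 'rV[C]_d -> seq nat -> C) : \sum_(p <- s) T (F p) = T (fun k => \sum_(p <- s) F p k).
      rewrite /T; elim: (s) => [|p r IH].
        rewrite big_nil /tsum big1 // => D _; apply: msum0 => k _ _; by rewrite big_nil.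
      by rewrite big_cons IH -tsumD; apply: eq_tsum => k _ _; rewrite big_cons.
    under [RHS]eq_bigr => p _ do rewrite -/(T _) Tsum.
    rewrite Tsum; apply: eq_tsum => k _ _.
    under eq_bigr => p _ do rewrite -mulr_sumr -mulr_sumr.
    rewrite -mulr_sumr -mulr_suml -rmorph_sum /= mulC_conj wCE -fmorphV -rmorphM.
    by [].
  apply: eq_bigr => p _; apply: eq_bigr => p' _; rewrite /ksum mulrCA; congr (_ * _).
  rewrite mulr_tsumr; apply: eq_tsum => k _ _; rewrite rmorphM /= conjCK; ring.
have EE := @funext nat C (fun N => ((C0 * sp (fun k => (wr k)^-1 * normc (moment s k) ^+ 2) N)%:C)%C) _ E.
rewrite [X in X @ _](EE).
apply: (@ccvg_sum _ _ s (fun p N => \sum_(p' <- s) p.1 * p'.1^* * ksum p.2 p'.2 N)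
   (fun p => \sum_(p' <- s) p.1 * p'.1^* * Ker p'.2 p.2)) => p ps.
apply: (@ccvg_sum _ _ s (fun p' N => p.1 * p'.1^* * ksum p.2 p'.2 N)
   (fun p' => p.1 * p'.1^* * Ker p'.2 p.2)) => p' p's.
by apply: ccvgZ; apply: ksum_cvg; apply: sD.
Qed.

Let kcomb_lb s N : inD s ->
  C0 * sp (fun k => (wr k)^-1 * normc (moment s k) ^+ 2) N <= nrm H (kcomb s) ^+ 2.
Proof.
move=> sD; rewrite (nrm_sq hH); last exact: kcombH.
apply: (cvg_Re_ge (N0 := N) (hip_kcomb_cvg sD)) => n Nn /=.
rewrite ler_pM2l //; apply: tsum_le => // k _.
by rewrite mulr_ge0 ?sqr_ge0 // invr_ge0 ltW.
Qed.

(* The Riesz lemma on the graph of kcomb s |-> sum_k b_k^* moment s k produces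
   the polynomial sum_k b_k z^k together with an upper bound for its norm. *)
Lemma polF_bound N b : H (polF N b) /\
  nrm H (polF N b) ^+ 2 <= tsum d N (fun k => normc (b k) ^+ 2 * wr k) / C0.
Proof.
set B2 := _ / C0.
have B20 : 0 <= B2.
  rewrite divr_ge0 ?(ltW C0_gt0) //; apply: tsum_ge0 => k _.
  by rewrite mulr_ge0 ?sqr_ge0 // ltW.
pose phi s : C := tsum d N (fun k => (b k)^* * moment s k).
have lin (a : C) s s' : let s0 := [seq (a * p.1, p.2) | p <- s] ++ s' in
    kcomb s0 = a *: kcomb s + kcomb s' /\ phi s0 = a * phi s + phi s'.
  move=> s0; split.
    rewrite /kcomb big_cat big_map scaler_sumr; congr (_ + _).
    by apply: eq_bigr => p _; rewrite scalerA.
  rewrite /phi mulr_tsumr -tsumD; apply: eq_tsum => k _ _.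
  rewrite /moment big_cat big_map mulrDr mulrCA [a * \sum_(p <- s) _]mulr_sumr; congr (_ * _ + _).
  by apply: eq_bigr => p _; rewrite mulrA.
pose G : set (fn * C^o) := [set p | exists2 s, inD s & p = (kcomb s, phi s)].
have [|||g [Hg gB gx _]] := @riesz R fn H hH G (Num.sqrt B2).
- split; first exists [::] => //.
    congr (_, _); first by rewrite /kcomb big_nil.
    rewrite /phi /tsum big1 // => D _; apply: msum0 => k _ _.
    by rewrite /moment big_nil mulr0.
  move=> a _ _ [s sD ->] [s' s'D ->]; exists ([seq (a * p.1, p.2) | p <- s] ++ s').
    move=> p; rewrite mem_cat => /orP[/mapP[p' p's ->]|]; [exact: (sD p')|exact: s'D].
  by have [-> ->] := lin a s s'.
- exact: sqrtr_ge0.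
- move=> _ [s sD ->]; split; first exact: kcombH.
  rewrite -(@ler_pXn2r _ 2) ?nnegrE ?mulr_ge0 ?normc_ge0 ?sqrtr_ge0 ?nrm_ge0 //.
  rewrite exprMn sqr_sqrtr //.
  (* The weight is split into two square roots, so that Cauchy-Schwarz separates b from the moments,
     which [kcomb_lb] controls. *)
  have h1 : normc (phi s) <= tsum d N (fun k => (normc (b k) * Num.sqrt (wr k)) * (normc (moment s k) / Num.sqrt (wr k))).
    rewrite /phi /tsum; apply: le_trans (ler_normc_sum _ _ _) _; apply: ler_sum => D _.
    apply: le_trans (normc_msum _ _ _) _; apply: ler_msum => k _ _.
    rewrite normcM normcJ le_eqVlt; apply/orP; left; apply/eqP; field.
    by rewrite gt_eqF // sqrtr_gt0.
  have h2 := tsum_cauchy_schwarz d N (fun k => normc (b k) * Num.sqrt (wr k)) (fun k => normc (moment s k) / Num.sqrt (wr k)).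
  apply: (@le_trans _ _ (tsum d N (fun k => (normc (b k) * Num.sqrt (wr k)) * (normc (moment s k) / Num.sqrt (wr k))) ^+ 2)).
    by rewrite ler_pXn2r ?nnegrE ?normc_ge0 // (le_trans _ h1) ?normc_ge0.
  apply: le_trans h2 _; have h3 := kcomb_lb N sD.
  rewrite /B2 -mulrA; apply: ler_pM.
  + by apply: tsum_ge0 => k _; apply: sqr_ge0.
  + by apply: tsum_ge0 => k _; apply: sqr_ge0.
  + by apply: ler_tsum => k _; rewrite exprMn sqr_sqrtr // ltW.
  rewrite ler_pdivlMl //; apply: le_trans h3; rewrite ler_pM2l //.
  by apply: ler_tsum => k _; rewrite expr_div_n sqr_sqrtr ?(ltW (wr_gt0 k)) // mulrC.
have gE : g = polF N b.
  apply/funext => w; have [wD|wD] := pselect (polydisc w); last first.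
    by rewrite polF_out // outside.
  rewrite polF_in // (reproducing Hg wD) (hipC hH (KwH wD) Hg).
  have sD : inD [:: (1, w)] by move=> p; rewrite inE => /eqP ->.
  have := gx (kcomb [:: (1, w)], phi [:: (1, w)]) (ex_intro2 _ _ _ sD erefl).
  rewrite /kcomb big_seq1 scale1r /= => ->; rewrite /phi.
  rewrite (morph_tsum (f := Num.conj_op)) ?rmorph0 //; last exact: rmorphD.
  apply: eq_tsum => k _ _ /=.
  by rewrite /moment big_seq1 mul1r rmorphM /= !conjCK.
rewrite -gE; split=> //; rewrite -[leRHS]sqr_sqrtr // ler_pXn2r ?nnegrE ?nrm_ge0 ?sqrtr_ge0 //.
Qed.

Let T N (b : seq nat -> C) : R := tsum d N (fun k => normc (b k) ^+ 2 * wr k).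

Let T_tail N M b : (N <= M)%N -> T M (fun k => if (N <= sumn k)%N then b k else 0) = T M b - T N b.
Proof.
move=> NM; rewrite tsum_tail //; apply: eq_tsum => k _ _; case: ifP => // _.
by rewrite normc0 expr0n mul0r.
Qed.

Let polF_tail N M b : (N <= M)%N ->
  polF M b - polF N b = polF M (fun k => if (N <= sumn k)%N then b k else 0).
Proof.
move=> NM; rewrite /polF tsum_tail //; apply: eq_tsum => k _ _.
by case: ifP => // _; rewrite scale0r.
Qed.

(** [polF_bound] applied to the tails makes the partial sums of a weighted square-summable family
    Cauchy. *)
Lemma polF_cvg b (B : R) : (forall N, tsum d N (fun k => normc (b k) ^+ 2 * wr k) <= B) ->
  exists2 g, H g & hcvg H (polF^~ b) g.
Proof.
move=> TB.
have Tmono : nondecreasing_seq (T^~ b).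
  by move=> N M NM; apply: tsum_le => // k _; rewrite mulr_ge0 ?sqr_ge0 // ltW.
have /cvg_ex[/= l /cvgrPdist_lt cl] : cvgn (T^~ b).
  apply: nondecreasing_is_cvgn => //; exists B => _ [N _ <-]; exact: TB.
apply: hcauchyP => // [N|e e0]; first by case: (polF_bound N b).
have e2 : 0 < e ^+ 2 * C0 / 2 by rewrite divr_gt0 // mulr_gt0 ?exprn_gt0.
have [N0 _ HN] := cl _ e2; exists N0.
have key n m : (N0 <= n)%N -> (n <= m)%N -> nrm H (polF m b - polF n b) < e.
  move=> Nn nm; have h2 : `|(l : R) - T n b| < e ^+ 2 * C0 / 2 := HN n Nn.
  have h1 : `|(l : R) - T m b| < e ^+ 2 * C0 / 2 := HN m (leq_trans Nn nm).
  rewrite polF_tail // -(@ltr_pXn2r _ 2) ?nnegrE ?nrm_ge0 ?(ltW e0) //.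
  move: h1 h2; rewrite !ltr_norml => /andP[h1 _] /andP[_ h2].
  apply: le_lt_trans (polF_bound _ _).2 _; rewrite -/(T m _) T_tail // ltr_pdivrMr //.
  lra.
move=> m n Nm Nn; case: (leqP n m) => [nm|/ltnW mn]; first exact: key.
have Hp N : H (polF N b) by case: (polF_bound N b).
by rewrite (nrmBC hH) // key.
Qed.

Let eval_cvg (u : nat -> fn) (g : fn) w : (forall n, H (u n)) -> H g -> hcvg H u g -> polydisc w ->
  (fun n => u n w) @ \oo --> g w.
Proof.
move=> Hu Hg ug wD; rewrite (reproducing Hg wD).
have -> : (fun n => u n w) = (fun n => hip H (u n) (Kw w) : C^o).
  by apply/funext => n; apply: reproducing.
by apply: hip_cvgl => //; apply: KwH.
Qed.

Let delta_single k N : size k = d -> (sumn k < N)%N -> polF N (delta C k) = monF k.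
Proof.
move=> sk kN; rewrite /polF (tsum_single sk kN) /delta ?eqxx ?scale1r // => k' _ /negPf ->.
by rewrite scale0r.
Qed.

Lemma monF_H k : size k = d -> H (monF k).
Proof.
move=> sk; have [Hp _] := polF_bound (sumn k).+1 (delta C k).
by rewrite delta_single in Hp.
Qed.

Let monF_nrm k : size k = d -> nrm H (monF k) ^+ 2 <= wr k / C0.
Proof.
move=> sk; have [_] := polF_bound (sumn k).+1 (delta C k); rewrite delta_single //.
rewrite (tsum_single sk) // /delta ?eqxx ?normc1 ?expr1n ?mul1r // => k' _ /negPf ->.
by rewrite normc0 expr0n mul0r.
Qed.

(* The Taylor coefficients of f, by orthogonality of the monomials. *)
Definition cf (f : fn) k : C := (C0%:C)%C / wt (toC al) k * hip H f (monF k).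

Let hip_polF (f : fn) N b : H f ->
  hip H f (polF N b) = tsum d N (fun k => (b k)^* * hip H f (monF k)).
Proof.
move=> Hf; have HD D : H (msum d D (fun k => b k *: monF k)).
  by apply: hspace_msum => // k sk _; apply: hspaceZ => //; apply: monF_H.
rewrite /polF /tsum (hipC hH _ Hf); last by apply: hspace_sum.
rewrite hip_suml // rmorph_sum; apply: eq_bigr => D _ /=.
rewrite -hipC // hip_msumr // => [|k sk _].
  by apply: eq_msum => k sk _; rewrite hipZr //; apply: monF_H.
by apply: hspaceZ => //; apply: monF_H.
Qed.

Let C0_conj : ((C0%:C)%C : C)^* = (C0%:C)%C.
Proof. exact: conjc_real. Qed.

Let wC_conj k : (wC k)^* = wC k. Proof. exact: wt_conj. Qed.

Let wC_neq0 k : wC k != 0. Proof. by rewrite gt_eqF // wt_gt0. Qed.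

(** The kernel function at w is the limit in H of the partial sums of its expansion, which are
    polynomials; pairing f with them gives the partial sums of the Taylor series of f. *)
Lemma cf_series (f : fn) w : H f -> polydisc w -> (fun N => psum (cf f) N w : C^o) @ \oo --> f w.
Proof.
move=> Hf wD; pose bw k : C := (C0%:C)%C / wC k * (mon w k)^*.
have Hp N : H (polF N bw) by case: (polF_bound N bw).
have [|g Hg gw] := @polF_cvg bw (C0 * nrm H (kcomb [:: (1, w)]) ^+ 2).
  move=> N; have sD : inD [:: (1, w)] by move=> p; rewrite inE => /eqP ->.
  have := kcomb_lb N sD; rewrite -(ler_pM2l C0_gt0); apply: le_trans.
  rewrite mulr_tsumr mulr_tsumr; apply: ler_tsum => k _.
  rewrite /moment big_seq1 mul1r /bw !normcM !normcJ wCE Normc.normcV !normcR.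
  rewrite (gtr0_norm C0_gt0) (gtr0_norm (wr_gt0 k)) le_eqVlt; apply/orP; left; apply/eqP.
  by field; rewrite gt_eqF ?wr_gt0.
have gE : g = Kw w.
  apply/funext => z; have [zD|zD] := pselect (polydisc z); last first.
    by rewrite !outside //; apply: KwH.
  apply: ccvg_unique (eval_cvg Hp Hg gw zD) _.
  rewrite /Kw mem_set //; have c := ksum_cvg wD zD.
  have E N : polF N bw z = ksum w z N.
    rewrite polF_in // /ksum mulr_tsumr; apply: eq_bigr => D _; apply: eq_msum => k _ _.
    by rewrite /bw; ring.
  by have EE := @funext nat C (fun N => polF N bw z) _ E; rewrite -EE in c; exact: c.
rewrite (reproducing Hf wD) -gE.
have c := hip_cvgr hH Hp Hg Hf gw.
have E N : hip H f (polF N bw) = psum (cf f) N w.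
  rewrite hip_polF //; apply: eq_bigr => D _; apply: eq_msum => k _ _.
  by rewrite /bw /cf rmorphM fmorph_div /= C0_conj wC_conj conjCK -/wC; ring.
by have EE := @funext nat C (fun N => hip H f (polF N bw)) _ E; rewrite EE in c; exact: c.
Qed.

Lemma growth_cf (f : fn) : H f -> growth d (cf f).
Proof.
move=> Hf; have [A [M [M0 bM]]] := growth_wt al_pos; rewrite sz in bM.
exists A, (nrm H f * (1 + C0 * M)); split.
  by rewrite mulr_ge0 ?nrm_ge0 // addr_ge0 // mulr_ge0 // ltW.
move=> k sk; have := bM k sk; rewrite -/wC wCE Normc.normcV normcR (gtr0_norm (wr_gt0 k)) => bk.
have h := cauchy_schwarz hH Hf (monF_H sk).
set x := C0 / wr k; have x0 : 0 < x by rewrite divr_gt0.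
(* The square root of x would be the direct bound; 1 + x avoids the root and still grows
   polynomially. *)
have nm : nrm H (monF k) * x <= 1 + x.
  have : (nrm H (monF k) * x) ^+ 2 <= x.
    rewrite exprMn; apply: (@le_trans _ _ (wr k / C0 * x ^+ 2)).
      by rewrite ler_wpM2r ?sqr_ge0 // monF_nrm.
    by rewrite /x le_eqVlt; apply/orP; left; apply/eqP; field; rewrite !gt_eqF ?wr_gt0.
  have := nrm_ge0 H (monF k); set y := nrm H (monF k) * x => y0 yx.
  have : (y - 1) ^+ 2 >= 0 by apply: sqr_ge0.
  nra.
rewrite /cf -/wC wCE !normcM Normc.normcV !normcR (gtr0_norm C0_gt0) (gtr0_norm (wr_gt0 k)) -/x.
apply: (@le_trans _ _ (nrm H f * (nrm H (monF k) * x))).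
  by rewrite mulrA [leRHS]mulrC ler_wpM2l // ltW.
rewrite -mulrA ler_wpM2l ?nrm_ge0 //; apply: le_trans nm _; rewrite mulrDl mul1r.
apply: lerD; first by rewrite exprn_ege1 // ler1n.
by rewrite /x -mulrA ler_wpM2l // ltW.
Qed.

Lemma cf_linear (a : C) (f g : fn) k : H f -> H g -> size k = d -> cf (a *: f + g) k = a * cf f k + cf g k.
Proof.
move=> Hf Hg sk; have Hk := monF_H sk.
by rewrite /cf hip_linear // mulrDr mulrCA.
Qed.

(** Both families are coefficients of the same function. Uniqueness of power series thereby yields
    the orthogonality of the monomials and their norms. *)
Let cf_monF k0 k : size k0 = d -> size k = d -> cf (monF k0) k = delta C k0 k.
Proof.
move=> sk0 sk; apply: (@psum_unique R d _ _ (monF k0)) => //.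
- by apply: growth_cf; apply: monF_H.
- exists 0%N, 1; split=> // x _; rewrite expr0 mulr1 /delta.
  by case: eqP; rewrite ?normc1 ?normc0.
- by move=> w; apply: cf_series; apply: monF_H.
- move=> w wD; apply/ccvgP => e e0; exists (sumn k0).+1 => n kn.
  by rewrite -(delta_single sk0 kn) polF_in // subrr normc0.
Qed.

Definition phi D (c : seq nat -> C) : fn := msum d D (fun k => c k *: monF k).

Lemma phi_H D c : H (phi D c).
Proof. by apply: hspace_msum => // k sk _; apply: hspaceZ => //; apply: monF_H. Qed.

Let hip_monF (f : fn) k : hip H f (monF k) = cf f k * wC k / (C0%:C)%C.
Proof.
rewrite /cf -/(wC k); field; rewrite wC_neq0 andbT.
by rewrite gt_eqF // ltcR.
Qed.

Lemma hip_phi (f : fn) D c : H f -> hip H f (phi D c) = form (toC al) D (cf f) c / (C0%:C)%C.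
Proof.
move=> Hf; rewrite hip_msumr // => [|k sk _]; last by apply: hspaceZ => //; apply: monF_H.
rewrite /form size_map sz mulr_msuml; apply: eq_msum => k sk _.
by rewrite hipZr ?hip_monF //; [rewrite -/(wC k); ring|apply: monF_H].
Qed.

Lemma cf_phi D c k : size k = d -> cf (phi D c) k = if sumn k == D then c k else 0.
Proof.
move=> sk; have Hk := monF_H sk; rewrite {1}/cf hip_msuml // => [|x sx _]; last first.
  by apply: hspaceZ => //; apply: monF_H.
rewrite mulr_msumr (eq_msum (G := fun x => c x * delta C x k)) => [|x sx xD]; last first.
  by rewrite -cf_monF // hipZl //; [rewrite /cf; ring|apply: monF_H].
case: eqP => kD.
  rewrite (msum_single (k0 := k)) // /delta ?eqxx ?mulr1 // => x _ _.
  by rewrite eq_sym => /negPf ->; rewrite mulr0.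
apply: msum0 => x _ xD; rewrite /delta; case: eqP => [E|_]; last by rewrite mulr0.
by case: kD; rewrite E.
Qed.

Lemma cf_total (f : fn) : H f -> (forall k, size k = d -> cf f k = 0) -> f = 0.
Proof.
move=> Hf f0; apply/funext => w; have [wD|wD] := pselect (polydisc w); last exact: outside.
apply: ccvg_unique (cf_series Hf wD) _.
rewrite (_ : (fun N => _) = cst (0 : C^o)); first exact: cvg_cst.
apply/funext => N; apply: big1 => D _; apply: msum0 => k sk _.
by rewrite f0 // mul0r.
Qed.

Lemma cf_inj (f g : fn) : H f -> H g -> (forall k, size k = d -> cf f k = cf g k) -> f = g.
Proof.
move=> Hf Hg fg; apply/eqP; rewrite -subr_eq0 addrC -scaleN1r; apply/eqP.
apply: cf_total => [|k sk]; first exact: hspaceL.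
by rewrite cf_linear // fg // mulN1r addNr.
Qed.

(** Bessel's inequality, from |f - p|^2 >= 0 for the N-th Taylor polynomial p of f. *)
Let bessel (f : fn) N : H f -> T N (cf f) <= C0 * nrm H f ^+ 2.
Proof.
move=> Hf; have [Hp pB] := polF_bound N (cf f).
have E : hip H f (polF N (cf f)) = ((T N (cf f) / C0)%:C)%C.
  have ET : ((T N (cf f))%:C)%C = tsum d N (fun k => ((normc (cf f k) ^+ 2 * wr k)%:C)%C).
    by rewrite (morph_tsum (f := real_complex R)) ?rmorph0 //; exact: rmorphD.
  rewrite hip_polF // rmorphM fmorphV mulrC [X in _ = _ * X]ET.
  rewrite mulr_tsumr; apply: eq_tsum => k _ _.
  have -> : ((normc (cf f k) ^+ 2 * wr k)%:C)%C = (cf f k * (cf f k)^*) * wC k.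
    by rewrite mulC_conj wCE -rmorphM.
  by rewrite hip_monF; ring.
have h := sqr_ge0 (nrm H (f - polF N (cf f))); rewrite (nrmB_sq hH Hf Hp) E [complex.Re _]/= in h.
rewrite -/(T N _) in pB; rewrite mulrC -ler_pdivrMr //; lra.
Qed.

Lemma submoduleP n (f : fn) : (0 < d)%N -> submodule H n f <->
  H f /\ forall N k, size k = d -> (sumn k < n)%N -> iter N (@Lm C) (cf f) k = 0.
Proof.
move=> d0; split=> -[Hf h]; split=> //.
  by apply/(@vanishP R d n (cf f) f) => //; [exact: growth_cf|move=> w; exact: cf_series].
by apply/(@vanishP R d n (cf f) f) => //; [exact: growth_cf|move=> w; exact: cf_series].
Qed.

(** * Multiplication by the first variable *)

Section Multiplication.
Hypothesis d_gt0 : (0 < d)%N.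
Let j0 := Ordinal d_gt0.
Let a := nth 0 al 0.
Let kappa := 1 + a^-1.

(* Multiplication by z_1 on coefficients. *)
Definition zs (b : seq nat -> C) := wshift (fun=> 1) b.

Let a_gt0 : 0 < a.
Proof. by move: d_gt0 al_pos; rewrite /a -sz; case: (al) => //= x l _ /andP[]. Qed.

Let zs_incr b k : size k = d -> zs b (incr_nth k 0) = b k.
Proof. by case: k => [|i k] sk /=; [move: d_gt0; rewrite -sk|rewrite mul1r]. Qed.

Let zs_0 b k : nth 0%N k 0 = 0%N -> zs b k = 0.
Proof. by case: k => [|[|i] k]. Qed.

Let psum_zs b N w : psum (zs b) N.+1 w = w 0 j0 * psum b N w.
Proof.
rewrite /psum big_ord_recl hpart0 zs_0 ?nth_nseq ?if_same // add0r mulr_sumr.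
apply: eq_bigr => D _; rewrite lift0 /hpart (msum_incr _ d_gt0) => [|k _ k0]; last by rewrite zs_0 ?mul0r.
rewrite mulr_msumr; apply: eq_msum => k sk _; rewrite zs_incr // mulrCA; congr (_ * _).
rewrite !(mon_split _ _ j0) nth_incr_nth eqxx add1n exprS -mulrA; congr (_ * (_ * _)).
apply: eq_bigr => i ij; rewrite nth_incr_nth.
by have /negPf -> : 0%N != i by apply: contraNneq ij => ij; apply/eqP/val_inj.
Qed.

(** The ratio (i + 1) / (a + i) of consecutive weights is at most 1 + 1 / a, which is the origin of
    [kappa]. *)
Let wr_incr k : size k = d -> wr (incr_nth k 0) <= kappa * wr k.
Proof.
rewrite -sz; case: k => [|i k]; first by move: d_gt0; rewrite -sz => + h; rewrite -h.
move=> _ /=; have al_cons : al = a :: behead al.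
  by move: d_gt0; rewrite /a -sz; case: (al).
have E : wr (i.+1 :: k) * (a + i%:R) = wr (i :: k) * i.+1%:R.
  have EC : ((wr (i.+1 :: k))%:C * (a%:C + i%:R) = (wr (i :: k))%:C * i.+1%:R)%C.
    rewrite -!wCE /wC al_cons /= -[a%:C%C + _]mulr1 mulrAC.
    by rewrite mulrA wt1S ?ltcR //; ring.
  by apply: (@complexI R); rewrite !rmorphM rmorphD !rmorph_nat; exact: EC.
have ai : 0 < a + i%:R by rewrite ltr_wpDr ?ler0n.
rewrite -(ler_pM2r ai) E mulrAC mulrC ler_pM2r //.
rewrite /kappa mulrDl mul1r mulrDr mulVf ?gt_eqF //.
have : 0 <= a^-1 * i%:R by rewrite mulr_ge0 ?ler0n // invr_ge0 ltW.
rewrite -natr1; have := a_gt0; lra.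
Qed.

Let T_zs b N : T N (zs b) <= kappa * T N b.
Proof.
apply: (@le_trans _ _ (T N.+1 (zs b))).
  by apply: tsum_le => // k _; rewrite mulr_ge0 ?sqr_ge0 // ltW.
rewrite /T /tsum big_ord_recl msum_in_degree0 zs_0 ?nth_nseq ?if_same //.
rewrite normc0 expr0n mul0r add0r mulr_sumr; apply: ler_sum => D _.
rewrite lift0 (msum_incr _ d_gt0) => [|k _ k0]; last by rewrite zs_0 // normc0 expr0n mul0r.
rewrite mulr_msumr; apply: ler_msum => k sk _; rewrite zs_incr // mulrCA.
by rewrite ler_wpM2l ?sqr_ge0 // wr_incr.
Qed.

(** The shifted coefficients of f are again square-summable, so their polynomials converge in H;
    pointwise the limit is z_1 f. The norm bound is inherited from the polynomials. *)
Let Mz_spec (f : fn) : H f -> H (Mz 1 f) /\ nrm H (Mz 1 f) <= Num.sqrt kappa * nrm H f.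
Proof.
move=> Hf; have kappa0 : 0 <= kappa by rewrite addr_ge0 // invr_ge0 ltW.
have TB N : T N (zs (cf f)) <= kappa * (C0 * nrm H f ^+ 2).
  by apply: le_trans (T_zs _ _) _; rewrite ler_wpM2l // bessel.
have Hp N : H (polF N (zs (cf f))) by case: (polF_bound N (zs (cf f))).
have [g Hg c] := polF_cvg TB.
have entE (w : 'rV[C]_d) : ent w 1 = w 0 j0 by rewrite /ent insubT.
have <- : g = Mz 1 f.
  apply/funext => w; rewrite /Mz entE.
  have [wD|wD] := pselect (polydisc w); last by rewrite !outside // mulr0.
  have c1 := eval_cvg Hp Hg c wD.
  apply: ccvg_unique (_ : (fun N => polF N.+1 (zs (cf f)) w : C^o) @ \oo --> g w) _.
    by move: c1; rewrite -(cvg_shiftS (fun N => polF N (zs (cf f)) w : C^o)).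
  have E N : polF N.+1 (zs (cf f)) w = w 0 j0 * psum (cf f) N w by rewrite polF_in // psum_zs.
  have EE := @funext nat C (fun N => polF N.+1 (zs (cf f)) w) _ E; rewrite [X in X @ _](EE).
  by apply: ccvgZ; apply: cf_series.
split=> //; apply: (hcvg_nrm hH Hp Hg c) => N.
rewrite -(@ler_pXn2r _ 2) ?nnegrE ?mulr_ge0 ?nrm_ge0 ?sqrtr_ge0 //.
apply: le_trans (polF_bound _ _).2 _; rewrite -/(T N _) ler_pdivrMr // exprMn sqr_sqrtr //.
by apply: le_trans (TB N) _; rewrite mulrA [leRHS]mulrAC mulrCA mulrA.
Qed.

Lemma Mz_H (f : fn) : H f -> H (Mz 1 f). Proof. by case/Mz_spec. Qed.

Lemma Mz_bounded : exists B : R, forall f : fn, H f -> nrm H (Mz 1 f) <= B * nrm H f.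
Proof. by exists (Num.sqrt kappa) => f /Mz_spec[]. Qed.

Lemma cf_Mz (f : fn) k : H f -> size k = d -> cf (Mz 1 f) k = zs (cf f) k.
Proof.
move=> Hf sk; have Hz := Mz_H Hf; apply: (@psum_unique R d _ _ (Mz 1 f)) => //.
- exact: growth_cf.
- have [A [M [M0 bM]]] := growth_cf Hf; exists A, M; split=> // x sx.
  have pos : 0 <= M * (sumn x).+1%:R ^+ A by rewrite mulr_ge0 // exprn_ge0 ?ler0n.
  case: x sx pos => [|[|i] x] sx pos; [by rewrite normc0|by rewrite normc0|rewrite /zs /= mul1r].
  apply: le_trans (bM (i :: x) sx) _; rewrite ler_wpM2l // lerXn2r ?nnegrE ?ler0n //.
  by rewrite ler_nat.
- by move=> w; apply: cf_series.
move=> w wD; rewrite -(cvg_shiftS (fun N => psum (zs (cf f)) N w : C^o)).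
have E N : psum (zs (cf f)) N.+1 w = w 0 j0 * psum (cf f) N w by rewrite psum_zs.
have EE := @funext nat C (fun N => psum (zs (cf f)) N.+1 w) _ E; rewrite [X in X @ _](EE).
have -> : Mz 1 f w = w 0 j0 * f w by rewrite /Mz /ent insubT.
by apply: ccvgZ; apply: cf_series.
Qed.

End Multiplication.

End DiagonalKernel.

Lemma form_iter_adj (C : numClosedFieldType) (al : seq C) N D b c : pos al ->
  form al (N + D) b (iter N (Lp al) c) = form al D (iter N (@Lm C) b) c.
Proof.
move=> p; elim: N b => [|N IH] b //.
by rewrite iterS addSn form_adjr // IH -iterSr.
Qed.

Lemma eq_iter_Lm (C : numClosedFieldType) N (b c : seq nat -> C) x :
  (forall y, size y = size x -> b y = c y) -> iter N (@Lm C) b x = iter N (@Lm C) c x.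
Proof.
move=> bc; elim: N x bc => [|N IH] x bc; first exact: bc.
by apply: eq_Lm => y sy _; apply: IH => z sz; apply: bc; rewrite sz.
Qed.

Lemma iter_LmD (C : numClosedFieldType) N (b c : seq nat -> C) x :
  iter N (@Lm C) (fun k => b k + c k) x = iter N (@Lm C) b x + iter N (@Lm C) c x.
Proof.
elim: N x => [//|N IH] x; rewrite !iterS -LmD.
by apply: eq_Lm => y _ _; apply: IH.
Qed.

(** The commutator of L with multiplication by z_1 is the identity. *)
Lemma Lm_zs (R : realType) (b : seq nat -> R[i]) k : (0 < size k)%N ->
  Lm (zs b) k = zs (Lm b) k + b k.
Proof.
case: k => [//|[|i] k] _ /=; rewrite !mul1r.
  by rewrite Lm_0 addr0 add0r.
rewrite (@eq_Lm _ (fun x => 1 * b (i :: x)) (fun x => b (i :: x))) => [|x _ _]; last by rewrite mul1r.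
by rewrite -[in LHS]natr1; ring.
Qed.

Lemma iter_Lm_zs (R : realType) n N (b : seq nat -> R[i]) x : (0 < size x)%N -> (sumn x < n)%N ->
  (forall N y, size y = size x -> (sumn y < n)%N -> iter N (@Lm _) b y = 0) ->
  iter N (@Lm _) (zs b) x = 0.
Proof.
move=> x0 xn; elim: N b => [|N IH] b b0.
  case: x x0 xn b0 => [|[|i] x] // _ xn b0; rewrite /= mul1r.
  by apply: (b0 0%N) => //; exact: ltnW.
rewrite iterSr (@eq_iter_Lm _ _ _ (fun k => zs (Lm b) k + b k)) => [|y sy]; last first.
  by rewrite Lm_zs // sy.
rewrite iter_LmD b0 // addr0; apply: IH => N' y sy yn.
by rewrite -iterSr b0.
Qed.

(** * The quotient module and its compression *)

Section QuotientModule.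
Variables (R : realType) (d : nat).
Local Notation C := R[i].
Local Notation fn := ('rV[C]_d -> C^o).
Variables (al : seq R) (C0 : R) (H : hspace fn) (n : nat).
Hypothesis sz : size al = d.
Hypothesis al_pos : all (fun a => 0 < a) al.
Hypothesis C0_gt0 : 0 < C0.
Hypothesis hrk : is_rkhs (@polydisc R d)
  (fun z w => (C0%:C)%C * \prod_(j < d) cpow (1 - z 0 j * (w 0 j)^*) (- nth 0 al j)) H.
Hypothesis d_gt0 : (0 < d)%N.

Local Notation alC := (toC al).
Local Notation cf := (cf al C0 H).
Local Notation Hq := (quotient_module H n).

Let posC : pos alC. Proof. by rewrite pos_toC. Qed.

Lemma rkhs_hilbert : is_hilbert H. Proof. by case: hrk. Qed.
Let hH := rkhs_hilbert.

Let C0_neq0 : (C0%:C)%C != 0 :> C. Proof. by rewrite gt_eqF // ltcR. Qed.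

Let phiH D c : H (phi D c). Proof. exact: phi_H hrk D c. Qed.

Lemma submodule_sub : submodule H n `<=` hcar H. Proof. by move=> f []. Qed.

Lemma quotient_hilbert : is_hilbert Hq.
Proof. exact: is_hilbert_hominus submodule_sub. Qed.
Let hHq := quotient_hilbert.

Lemma quotient_sub : hcar Hq `<=` hcar H. Proof. by move=> f []. Qed.

Lemma quotient_intro (f : fn) : H f -> (forall s, submodule H n s -> hip H s f = 0) -> Hq f.
Proof.
move=> Hf fs; split=> // s Ss; have [Hs _] := Ss.
by rewrite (hipC hH Hs Hf) fs // conjC0.
Qed.

(** By adjunction, pairing with such a vector reads off coefficients of degree < n of L^N s, which
    are 0 for s in the submodule. *)
Lemma quotient_phi N D c : (D < n)%N -> Hq (phi (N + D) (iter N (Lp alC) c)).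
Proof.
move=> Dn; apply: quotient_intro => [|s Ss]; first exact: phiH.
have [Hs h] := (submoduleP sz al_pos C0_gt0 hrk n s d_gt0).1 Ss.
rewrite (hip_phi sz al_pos C0_gt0 hrk) // form_iter_adj // form0l ?mul0r // => k.
by rewrite size_map sz => sk kD; apply: h; rewrite // kD.
Qed.

(** Such an f lies in the submodule as well as in its complement. Together with [quotient_phi] this
    makes the vectors Lp^N z^k with |k| < n total in the quotient. *)
Lemma quotient_total (f : fn) : Hq f ->
  (forall N k, size k = d -> (sumn k < n)%N -> iter N (@Lm C) (cf f) k = 0) -> f = 0.
Proof.
move=> Hqf h; have [Hf fS] := Hqf.
have Sf : submodule H n f by apply/(submoduleP sz al_pos C0_gt0 hrk n f d_gt0).
by apply: (hip_def hH Hf); apply: fS.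
Qed.

Lemma hip_phi_phi D D' b c : hip H (phi D b) (phi D' c) =
  if D == D' then form alC D b c / (C0%:C)%C else 0.
Proof.
rewrite (hip_phi sz al_pos C0_gt0 hrk) //; case: eqP => [<-|DD].
  congr (_ / _); apply: eq_form => // k; rewrite size_map sz => sk kD.
  by rewrite (cf_phi sz al_pos C0_gt0 hrk) // kD eqxx.
rewrite form0l ?mul0r // => k; rewrite size_map sz => sk kD.
by rewrite (cf_phi sz al_pos C0_gt0 hrk) // ifF // kD; apply/eqP => E; apply: DD.
Qed.

Lemma cf_Mz_phi D b k : size k = d -> cf (Mz 1 (phi D b)) k = if sumn k == D.+1 then zs b k else 0.
Proof.
move=> sk; rewrite (cf_Mz sz al_pos C0_gt0 hrk d_gt0) // /zs.
case: k sk => [|[|i] k] sk /=; rewrite ?if_same // !mul1r.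
by rewrite (cf_phi sz al_pos C0_gt0 hrk) //= addSn eqSS.
Qed.

Lemma hip_Mz_phi D D' b c : hip H (Mz 1 (phi D b)) (phi D' c) =
  if D' == D.+1 then form alC D' (zs b) c / (C0%:C)%C else 0.
Proof.
have HM : H (Mz 1 (phi D b)) by apply: (Mz_H sz al_pos C0_gt0 hrk d_gt0).
rewrite (hip_phi sz al_pos C0_gt0 hrk) //; case: eqP => DD.
  congr (_ / _); apply: eq_form => // k; rewrite size_map sz => sk kD.
  by rewrite cf_Mz_phi // kD DD eqxx.
rewrite form0l ?mul0r // => k; rewrite size_map sz => sk kD.
by rewrite cf_Mz_phi // ifF // kD; apply/eqP.
Qed.

Let MzH (f : fn) : Hq f -> H (Mz 1 f).
Proof. by case=> Hf _; apply: (Mz_H sz al_pos C0_gt0 hrk d_gt0). Qed.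

Lemma Mz_linear (a : C) (f g : fn) : Mz 1 (a *: f + g) = a *: Mz 1 f + Mz 1 g.
Proof.
by apply/funext => z; rewrite /Mz /= mulrDr; congr (_ + _); rewrite -[LHS]/(_ * (_ * _)) mulrCA.
Qed.

Lemma Mq_in (f : fn) : Hq f -> Hq (Mq H n f).
Proof. by move=> Hqf; apply: (hproj_in hH hHq quotient_sub) => //; apply: MzH. Qed.

Lemma hip_Mq (f g : fn) : Hq f -> Hq g -> hip H (Mq H n f) g = hip H (Mz 1 f) g.
Proof. by move=> Hqf Hqg; apply: (hip_hproj hH hHq quotient_sub) => //; apply: MzH. Qed.

Lemma Mq_linear (a : C) (f g : fn) : Hq f -> Hq g -> Mq H n (a *: f + g) = a *: Mq H n f + Mq H n g.
Proof.
move=> Hqf Hqg; rewrite /Mq /compression Mz_linear.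
by apply: (hproj_linear hH hHq quotient_sub) => //; apply: MzH.
Qed.

Lemma Mq_bounded : exists B : R, forall f : fn, Hq f -> nrm H (Mq H n f) <= B * nrm H f.
Proof.
have [B HB] := Mz_bounded sz al_pos C0_gt0 hrk d_gt0; exists B => f Hqf.
apply: le_trans (HB f (quotient_sub Hqf)).
by apply: (nrm_hproj hH hHq quotient_sub) => //; apply: MzH.
Qed.

(** The vectors of [quotient_phi] with c a monomial recover each coefficient that the submodule
    condition requires to be 0. *)
Lemma submodule_of_perp (f : fn) : H f -> (forall y, Hq y -> hip H f y = 0) -> submodule H n f.
Proof.
move=> Hf fq; apply/(submoduleP sz al_pos C0_gt0 hrk n f d_gt0); split=> // N k sk kn.
have := fq _ (quotient_phi N (delta C k) kn).
rewrite (hip_phi sz al_pos C0_gt0 hrk) // form_iter_adj // form_delta ?size_map ?sz //.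
by move/eqP; rewrite mulf_eq0 invr_eq0 (negPf C0_neq0) orbF mulf_eq0 (gt_eqF (wt_gt0 _ posC)) orbF => /eqP.
Qed.

Lemma submodule_Mz (f : fn) : submodule H n f -> submodule H n (Mz 1 f).
Proof.
move=> /(submoduleP sz al_pos C0_gt0 hrk n f d_gt0)[Hf h].
apply/(submoduleP sz al_pos C0_gt0 hrk n _ d_gt0); split; first exact: (Mz_H sz al_pos C0_gt0 hrk d_gt0).
move=> N k sk kn; rewrite (@eq_iter_Lm _ _ _ (zs (cf f))) => [|y sy].
  by apply: (@iter_Lm_zs _ n); rewrite ?sk // => N' y sy yn; apply: h; rewrite ?sy.
by apply: (cf_Mz sz al_pos C0_gt0 hrk d_gt0); rewrite // sy.
Qed.

Lemma submodule_hproj (f : fn) : H f -> submodule H n (f - hproj Hq f).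
Proof.
move=> Hf; have [p pq] := hproj_spec hH hHq quotient_sub erefl Hf.
by apply: submodule_of_perp => //; apply: hspaceB => //; apply: quotient_sub.
Qed.

Lemma hip_submodule (f s : fn) : Hq f -> submodule H n s -> hip H f s = 0.
Proof. by case=> _; apply. Qed.

(** The submodule is invariant under z_1, so the error made by each projection stays in the
    submodule under further multiplications and is invisible to g. *)
Lemma hip_iter_Mq k (f g : fn) : Hq f -> Hq g ->
  hip H (iter k (Mq H n) f) g = hip H (iter k (Mz 1) f) g.
Proof.
move=> Hf Hg; have Hit j : Hq (iter j (Mq H n) f) by elim: j => [//|j IH]; apply: Mq_in.
have HM j : H (iter j (Mz 1) f).
  by elim: j => [|j IH]; [exact: quotient_sub|apply: (Mz_H sz al_pos C0_gt0 hrk d_gt0)].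
elim: k g Hg => [//|k IH] g Hg; have HTk := quotient_sub (Hit k).
have HD : H (-1 *: iter k (Mq H n) f + iter k (Mz 1) f) by apply: hspaceL.
have Sk : submodule H n (-1 *: iter k (Mq H n) f + iter k (Mz 1) f).
  apply: submodule_of_perp => // y Hqy; have Hy := quotient_sub Hqy.
  by rewrite hip_linear // IH // mulN1r addNr.
have [_ _] := Sk; have Sk' := submodule_Mz Sk; have [Hs _] := Sk'.
have := hipC hH (quotient_sub Hg) Hs; rewrite (hip_submodule Hg Sk') conjC0 Mz_linear.
have Hz1 : H (Mz 1 (iter k (Mq H n) f)) by apply: MzH.
have Hz2 : H (Mz 1 (iter k (Mz 1) f)) by apply: (HM k.+1).
rewrite hip_linear //; last exact: quotient_sub.
by rewrite mulN1r addrC iterS hip_Mq // => /eqP; rewrite subr_eq0 => /eqP.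
Qed.

End QuotientModule.

Lemma zs_embed (R : realType) e (T : seq nat -> R[i]) b k :
  zs (embed e T b) k = embed e T (zs b) k.
Proof. by case: k => [|[|i] k] //=; rewrite ?mul0r // !mul1r. Qed.

Lemma iter_Lp_embed (C : numClosedFieldType) (a : C) al e Q b N k : pos al -> al != [::] ->
  size k = (size al).+1 ->
  iter N (Lp (a :: al)) (embed e (tower al e Q) b) k =
  embed e (tower al e Q) (iter N (Lp [:: a; \sum_(x <- al) x + 2 * e%:R]) b) k.
Proof.
move=> p n; elim: N k => [//|N IH] k sk; rewrite !iterS -Lp_embed //.
by apply: eq_Lp => x sx _; apply: IH; rewrite sx.
Qed.

(** * The decomposition *)

Section Decomposition.
Variables (R : realType) (d n : nat).
Local Notation C := R[i].
Variables (a1 : R) (al' : seq R) (M : hspace ('rV[C]_d -> C^o)).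
Hypothesis sz : size (a1 :: al') = d.
Hypothesis al'_neq0 : al' != [::].
Hypothesis al_pos : all (fun a => 0 < a) (a1 :: al').
Hypothesis hM : is_rkhs (@polydisc R d)
  (fun z w => ((1 : R)%:C)%C * \prod_(j < d) cpow (1 - z 0 j * (w 0 j)^*) (- nth 0 (a1 :: al') j)) M.
Variables (I : finType) (L : I -> seq nat) (c : I -> R) (Hl : I -> hspace ('rV[C]_2 -> C^o)).
Hypothesis L_inj : injective L.
Hypothesis L_size : forall i, size (L i) = (size al').-1.
Hypothesis L_onto : forall l, size l = (size al').-1 -> (sumn l < n)%N -> exists i, L i = l.
Hypothesis c_gt0 : forall i, 0 < c i.
Let e i := sumn (L i).
Let be i : R := \sum_(a <- al') a + 2 * (e i)%:R.
Hypothesis hHl : forall i, is_rkhs (@polydisc R 2)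
  (fun z w => ((c i)%:C)%C * \prod_(j < 2) cpow (1 - z 0 j * (w 0 j)^*) (- nth 0 [:: a1; be i] j)) (Hl i).

Let d_gt0 : (0 < d)%N. Proof. by rewrite -sz. Qed.
Let a1_gt0 : 0 < a1. Proof. by move: al_pos => /andP[]. Qed.
Let al'_pos : all (fun a => 0 < a) al'. Proof. by move: al_pos => /andP[]. Qed.
Let posC' : pos (toC al'). Proof. by rewrite pos_toC. Qed.
Let posC : pos (toC (a1 :: al')). Proof. by rewrite pos_toC. Qed.
Let neqC' : toC al' != [::]. Proof. by case: (al') al'_neq0. Qed.

Let beC i : ((be i)%:C)%C = \sum_(x <- toC al') x + 2 * (e i)%:R.
Proof. by rewrite sum_toC /be rmorphD rmorphM !rmorph_nat. Qed.

Let be_pos i : 0 < be i.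
Proof. by rewrite -ltcR beC; apply: be_gt0. Qed.

Let pos2 i : all (fun a => 0 < a) [:: a1; be i]. Proof. by rewrite /= a1_gt0 be_pos. Qed.

Let toC2 i : toC [:: a1; be i] = [:: (a1%:C)%C; \sum_(x <- toC al') x + 2 * (e i)%:R].
Proof. by rewrite /= beC. Qed.

Let T i := Tf (toC al') (L i).
Let NQ i : C := form (toC al') (e i) (Qf (toC al') (L i)) (Qf (toC al') (L i)).

Let L_sizeC i : size (L i) = (size (toC al')).-1. Proof. by rewrite size_map. Qed.

Let NQ_gt0 i : 0 < NQ i. Proof. exact: form_Qf_gt0. Qed.

(** Normalises the embedding of the i-th summand: [embed] multiplies squared norms by [NQ i], while
    the kernel constant [c i] divides those of the summand. *)
Let s i : C := sqrtC (NQ i * ((c i)%:C)%C)^-1.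

Let s_conj i : s i * (s i)^* = (NQ i * ((c i)%:C)%C)^-1.
Proof.
have x0 : 0 <= (NQ i * ((c i)%:C)%C)^-1 by rewrite invr_ge0 mulr_ge0 ?ler0c // ltW.
by rewrite -normCK ger0_norm ?sqrtC_ge0 // sqrtCK.
Qed.

(* Index (i, N, p, q): the vector Lp^N z_1^p z_2^q of the i-th summand. *)
Let J := (I * nat * nat * nat)%type.
Let b2 (j : J) : seq nat -> C :=
  let: (i, N, p, q) := j in iter N (Lp (toC [:: a1; be i])) (delta C [:: p; q]).
Let deg (j : J) : nat := let: (i, N, p, q) := j in (N + (p + q))%N.
Let ok (j : J) : bool := let: (i, N, p, q) := j in (p + q < n - e i)%N.
Let idx (j : J) : I := let: (i, N, p, q) := j in i.

(** Inadmissible indices receive the zero vector, so that the index type is a plain product; the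
    families u and v do so for the same indices. *)
Let u (j : J) : I -> ('rV[C]_2 -> C^o) := fun i =>
  if ok j && (i == idx j) then phi (deg j) (b2 j) else 0.
Let v (j : J) : 'rV[C]_d -> C^o :=
  if ok j then s (idx j) *: phi (deg j + e (idx j)) (embed (e (idx j)) (T (idx j)) (b2 j)) else 0.

Let Hq := quotient_module M n.
Let Hi i := quotient_module (Hl i) (n - e i).

Let hHq : is_hilbert Hq := quotient_hilbert n hM.
Let hHi i : is_hilbert (Hi i) := quotient_hilbert (n - e i) (hHl i).
Let hHs : is_hilbert (hsum Hi) := is_hilbert_hsum hHi.
Let one_gt0 : 0 < (1 : R) := ltr01.

Let Hv j : Hq (v j).
Proof.
rewrite /v; case: ifP => okj; last exact: hspace0.
apply: hspaceZ => //; case: j okj => [[[i N] p] q] /= pq.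
rewrite -addnA; set X := embed _ _ _.
have -> : phi (d := d) (N + (p + q + e i)) X =
    phi (N + (p + q + e i)) (iter N (Lp (toC (a1 :: al'))) (embed (e i) (T i) (delta C [:: p; q]))).
  apply: eq_msum => k sk kD; congr (_ *: _); rewrite /X /= beC.
  by rewrite [RHS]iter_Lp_embed // size_map; move: sk; rewrite -sz.
by apply: (quotient_phi sz al_pos one_gt0 hM d_gt0); rewrite -ltn_subRL addnC in pq *; rewrite addnC; move: pq; lia.
Qed.

Let Hu j : hsum Hi (u j).
Proof.
move=> i; rewrite /u; case: ifP => [/andP[okj /eqP ->]|_]; last exact: hspace0.
case: j okj => [[[i' N] p] q] /= pq.
by apply: (@quotient_phi R 2 [:: a1; be i'] (c i') (Hl i') (n - e i') erefl (pos2 i') (c_gt0 i') (hHl i')).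
Qed.

Let Hu' j i : Hl i (u j i). Proof. by have [] := Hu j i. Qed.

Let hip_u j j' : hip (hsum Hi) (u j) (u j') =
  if [&& ok j, ok j', idx j == idx j' & deg j == deg j'] then
    form (toC [:: a1; be (idx j)]) (deg j) (b2 j) (b2 j') / ((c (idx j))%:C)%C else 0.
Proof.
rewrite /= (bigD1 (idx j)) //= big1 ?addr0 => [|i ij]; last first.
  rewrite /u (negPf ij) andbF hip0l //; last exact: (Hu' j' i).
  exact: rkhs_hilbert (hHl i).
rewrite /u eqxx andbT; have hil := rkhs_hilbert (hHl (idx j)).
case okj : (ok j) => /=; last by rewrite hip0l //; have := Hu' j' (idx j); rewrite /u.
case okj' : (ok j') => /=; last by rewrite hip0r //; apply: (phi_H (al := [:: a1; be (idx j)])) => //; exact: hHl.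
case: (eqVneq (idx j) (idx j')) => [E|_] /=; last first.
  by rewrite hip0r //; apply: (phi_H (al := [:: a1; be (idx j)])) => //; exact: hHl.
by rewrite (hip_phi_phi (d := 2) (al := [:: a1; be (idx j)]) erefl (pos2 _) (c_gt0 _) (hHl _)).
Qed.

Let form_emb j j' b b' D : idx j = idx j' ->
  form (toC (a1 :: al')) (D + e (idx j)) (embed (e (idx j)) (T (idx j)) b) (embed (e (idx j')) (T (idx j')) b')
  = NQ (idx j) * form (toC [:: a1; be (idx j)]) D b b'.
Proof.
move=> <-; set i := idx j.
have := form_embed (a1%:C)%C b b' (D + e i) (fun K => form_Tf K posC' neqC' (L_sizeC i)).
by rewrite leq_addl addnK -/(e i) toC2 => <-.
Qed.

Let form_emb0 i i' b b' D : i != i' ->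
  form (toC (a1 :: al')) D (embed (e i) (T i) b) (embed (e i') (T i') b') = 0.
Proof.
move=> ii; rewrite [LHS]form_embed_layer big1 // => x _.
rewrite form_Tf_neq ?mulr0 //; by move/L_inj => E; rewrite E eqxx in ii.
Qed.

Let gram j j' : hip (hsum Hi) (u j) (u j') = hip Hq (v j) (v j').
Proof.
rewrite hip_u; have HH := rkhs_hilbert hM; have Hphi D b : M (phi D b) := phi_H sz al_pos one_gt0 hM D b.
rewrite /v; case: (ok j) => /=; last by rewrite hip0l //; case: ifP => _; [exact: hspaceZ|exact: hspace0].
case: (ok j') => /=; last by rewrite hip0r //; exact: hspaceZ.
rewrite /Hq /= hipZl ?hipZr //; last exact: hspaceZ.
rewrite (hip_phi_phi sz al_pos one_gt0 hM).
case: (eqVneq (idx j) (idx j')) => [E|ne] /=; last first.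
  by case: ifP => _; rewrite ?form_emb0 // ?mul0r ?mulr0.
rewrite -{2}E eqn_add2r; case: eqP => DD; last by rewrite !mulr0.
rewrite form_emb // -E [s _ * (_ * _)]mulrA s_conj divr1.
have n1 : NQ (idx j) != 0 by rewrite gt_eqF // NQ_gt0.
have n2 : ((c (idx j))%:C)%C != 0 :> C by rewrite gt_eqF // ltcR.
by field; rewrite n1 n2.
Qed.

Let total_u (x : I -> ('rV[C]_2 -> C^o)) : hsum Hi x -> (forall j, hip (hsum Hi) x (u j) = 0) -> x = 0.
Proof.
move=> Hx xu; apply/funext => i; have Hxi := Hx i; have [Hli _] := Hxi.
apply: (@quotient_total R 2 [:: a1; be i] (c i) (Hl i) (n - e i) erefl (pos2 i) (c_gt0 i) (hHl i)) => //.
move=> N [|p [|q []]] // _; rewrite [sumn _]/= addn0 => pq.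
have E : hip (Hl i) (x i) (u (i, N, p, q) i) = 0.
  rewrite -[RHS](xu (i, N, p, q)) /= (bigD1 i) //= big1 ?addr0 // => i' ii.
  by rewrite /u (negPf ii) andbF hip0r //; [exact: rkhs_hilbert (hHl i')|have [] := Hx i'].
have {}E : hip (Hl i) (x i) (phi (N + (p + q)) (iter N (Lp (toC [:: a1; be i])) (delta C [:: p; q]))) = 0.
  by move: E; rewrite /u eqxx andbT /= pq.
move: E; rewrite (hip_phi (al := [:: a1; be i]) erefl (pos2 i) (c_gt0 i) (hHl i)) //.
have p2 : pos (toC [:: a1; be i]) by rewrite pos_toC pos2.
rewrite form_iter_adj // (_ : (p + q)%N = sumn [:: p; q]); last by rewrite /= addn0.
rewrite form_delta //.
have w0 : 0 < wt (toC [:: a1; be i]) [:: p; q] by apply: wt_gt0.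
have c0 : 0 < ((c i)%:C)%C :> C by rewrite ltcR.
by move/eqP; rewrite mulf_eq0 invr_eq0 (gt_eqF c0) orbF mulf_eq0 (gt_eqF w0) orbF => /eqP.
Qed.

(** The slices of L^N x by the first exponent are orthogonal to all towers, hence 0 by
    [Tf_complete]. *)
Let total_v (x : 'rV[C]_d -> C^o) : Hq x -> (forall j, hip Hq x (v j) = 0) -> x = 0.
Proof.
move=> Hx xv; have [HMx _] := Hx; have HH := rkhs_hilbert hM.
have Hphi D b : M (phi D b) := phi_H sz al_pos one_gt0 hM D b.
apply: (@quotient_total R d _ 1 M n sz al_pos one_gt0 hM d_gt0) => // N k0 sk0 kn.
have sk1 : size k0 = (size al').+1 by rewrite sk0 -sz.
case: k0 sk1 kn {sk0} => [|p k'] // [sk'] kn; set g := iter N _ _; set D := sumn (p :: k') in kn.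
apply: (@Tf_complete _ (toC al') (D - p)%N (fun k => g (p :: k)) posC' neqC') => //; last 2 first.
- by rewrite size_map.
- by rewrite /D /= addKn.
move=> l sl lD; rewrite size_map in sl.
have pD : (p <= D)%N by rewrite /D leq_addr.
have ln : (sumn l < n)%N by apply: leq_ltn_trans kn; apply: leq_trans lD _; rewrite leq_subr.
have [i Li] := L_onto sl ln.
(* The exponent for which z_1^p z_2^q is embedded in the degree D under consideration; D < n makes
   the index admissible. *)
pose q := (D - p - e i)%N; have DE : D = (p + q + e i)%N by rewrite /q /e Li; lia.
have okj : ok (i, N, p, q) by rewrite /= ltn_subRL addnC -DE.
have sn0 : (s i)^* != 0.
  rewrite conjC_eq0; apply/eqP => s0; have := s_conj i; rewrite s0 mul0r => /esym/eqP.
  have n2 : ((c i)%:C)%C != 0 :> C by rewrite gt_eqF // ltcR.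
  by rewrite invr_eq0 mulf_eq0 (negPf n2) orbF gt_eqF // NQ_gt0.
have E : (s i)^* * hip M x (phi (N + (p + q) + e i) (embed (e i) (T i)
    (iter N (Lp (toC [:: a1; be i])) (delta C [:: p; q])))) = 0.
  by have := xv (i, N, p, q); rewrite /v okj /= hipZr.
have {E} : hip M x (phi (N + (p + q) + e i) (embed (e i) (T i)
    (iter N (Lp (toC [:: a1; be i])) (delta C [:: p; q])))) = 0.
  by move/eqP: E; rewrite mulf_eq0 (negPf sn0) => /eqP.
rewrite (hip_phi sz al_pos one_gt0 hM) // divr1.
rewrite (@eq_form _ _ _ _ _ (cf (a1 :: al') 1 M x) (iter N (Lp (toC (a1 :: al'))) (embed (e i) (T i) (delta C [:: p; q])))) //.
  (* After adjunction the embedded monomial meets only the slice with first exponent p, where it is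
     the tower. *)
  rewrite -addnA -DE form_iter_adj // -/g [LHS]form_cons (bigD1 (Ordinal (pD : (p < D.+1)%N))) //=.
  rewrite big1 ?addr0 => [|i' ip]; last first.
    rewrite form0r ?mulr0 // => k _ _; rewrite /= /delta eqseq_cons.
    have /negPf -> : (i' : nat) != p by apply: contraNneq ip => ip; apply/eqP/val_inj.
    by rewrite mul0r.
  rewrite (@eq_form _ _ _ _ _ (fun k => g (p :: k)) (Tf (toC al') l)) // => [|k _ kD].
    by move/eqP; rewrite mulf_eq0 gt_eqF ?wt1_gt0 ?ltcR // => /eqP.
  by rewrite /= kD -/q /delta eqxx mul1r /T Li.
move=> k; rewrite size_map => sk _.
by rewrite toC2 [RHS]iter_Lp_embed // size_map.
Qed.

Let T1H (f : 'rV[C]_d -> C^o) : Hq f -> Hq (Mq M n f).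
Proof. exact: (Mq_in sz al_pos one_gt0 hM d_gt0). Qed.

Let T2 : (I -> ('rV[C]_2 -> C^o)) -> (I -> ('rV[C]_2 -> C^o)) :=
  opsum (fun i => Mq (Hl i) (n - e i)).

Let MqiH i (f : 'rV[C]_2 -> C^o) : Hi i f -> Hi i (Mq (Hl i) (n - e i) f).
Proof. exact: (Mq_in (al := [:: a1; be i]) erefl (pos2 i) (c_gt0 i) (hHl i)). Qed.

(** Multiplication by z_1 commutes with the embedding, so the entries are compared exactly as in
    [gram]. *)
Let entries j j' : hip (hsum Hi) (T2 (u j)) (u j') = hip Hq (Mq M n (v j)) (v j').
Proof.
have HH := rkhs_hilbert hM; have Hphi D b : M (phi D b) := phi_H sz al_pos one_gt0 hM D b.
have HMz (f : 'rV[C]_d -> C^o) : M f -> M (Mz 1 f).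
  by move=> Hf; apply: (Mz_H sz al_pos one_gt0 hM d_gt0).
rewrite [RHS](hip_Mq sz al_pos one_gt0 hM d_gt0) //.
have -> : hip (hsum Hi) (T2 (u j)) (u j') = \sum_i hip (Hl i) (Mz 1 (u j i)) (u j' i).
  apply: eq_bigr => i _.
  exact: (hip_Mq (al := [:: a1; be i]) erefl (pos2 i) (c_gt0 i) (hHl i) isT (Hu j i) (Hu j' i)).
have Mz0 dd : Mz 1 (0 : 'rV[C]_dd -> C^o) = 0 by apply/funext => z; rewrite /Mz mulr0.
have MzZ (a : C) (f : 'rV[C]_d -> C^o) : Mz 1 (a *: f) = a *: Mz 1 f.
  by rewrite -[a *: f]addr0 Mz_linear Mz0 addr0.
have hil i := rkhs_hilbert (hHl i).
have HMz2 i (f : 'rV[C]_2 -> C^o) : Hl i f -> Hl i (Mz 1 f).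
  by move=> Hf; apply: (Mz_H (al := [:: a1; be i]) erefl (pos2 i) (c_gt0 i) (hHl i)).
rewrite (bigD1 (idx j)) //= big1 ?addr0 => [|i ij]; last first.
  by rewrite {1}/u (negPf ij) andbF Mz0 hip0l.
rewrite /u /v eqxx andbT; case okj : (ok j) => /=; last first.
  rewrite !Mz0 !hip0l //; first by case: ifP => _; [exact: hspaceZ|exact: hspace0].
  by have := Hu' j' (idx j); rewrite /u.
have Hp2 i D b : Hl i (phi D b) := phi_H (al := [:: a1; be i]) erefl (pos2 i) (c_gt0 i) (hHl i) D b.
case: (ok j') => /=; last by rewrite MzZ !hip0r //; [apply: hspaceZ => //; exact: HMz|exact: HMz2].
have HMzp D b : M (Mz 1 (phi D b)) by apply: HMz.
rewrite MzZ hipZl ?hipZr //; last exact: hspaceZ.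
rewrite (hip_Mz_phi sz al_pos one_gt0 hM d_gt0).
have zsE i b k : size k = d -> zs (embed (e i) (T i) b) k = embed (e i) (T i) (zs b) k by move=> _; exact: zs_embed.
case: (eqVneq (idx j) (idx j')) => [E|ne] /=; last first.
  rewrite hip0r; [|exact: hil|exact: HMz2].
  case: ifP => _; last by rewrite !mulr0.
  rewrite (@eq_form _ _ _ _ _ (embed (e (idx j)) (T (idx j)) (zs (b2 j))) (embed (e (idx j')) (T (idx j')) (b2 j'))) //.
    by rewrite form_emb0 // mul0r !mulr0.
  by move=> k _ _; rewrite zs_embed.
rewrite (hip_Mz_phi (d := 2) (al := [:: a1; be (idx j)]) erefl (pos2 _) (c_gt0 _) (hHl _) isT).
rewrite -E -addSn eqn_add2r; case: eqP => DD; last by rewrite !mulr0.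
rewrite [in RHS](@eq_form _ (toC (a1 :: al')) _ _ _ (embed (e (idx j)) (T (idx j)) (zs (b2 j)))
  (embed (e (idx j)) (T (idx j)) (b2 j'))) //; last by move=> k _ _; rewrite zs_embed.
rewrite (@form_emb j j) // [s _ * (_ * _)]mulrA s_conj divr1.
have n1 : NQ (idx j) != 0 by rewrite gt_eqF // NQ_gt0.
have n2 : ((c (idx j))%:C)%C != 0 :> C by rewrite gt_eqF // ltcR.
by field; rewrite n1 n2.
Qed.

Theorem quotient_decomposition : unitarily_equivalent Hq (Mq M n) (hsum Hi) T2.
Proof.
have [B0 HB0] := Mq_bounded n sz al_pos one_gt0 hM d_gt0.
have /choice[B HB] : forall i, exists B, forall f, Hi i f -> nrm (Hl i) (Mq (Hl i) (n - e i) f) <= B * nrm (Hl i) f.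
  by move=> i; apply: (Mq_bounded (n - e i) (al := [:: a1; be i]) erefl (pos2 i) (c_gt0 i) (hHl i)).
(* One bound for the operators on both sides, as the criterion requires. *)
pose BB := `|B0| + \sum_i `|B i|.
have S0 : 0 <= \sum_i `|B i| by apply: sumr_ge0.
have BB0 : 0 <= BB by rewrite addr_ge0.
have T2H x : hsum Hi x -> hsum Hi (T2 x) by move=> Hx i; apply: MqiH.
apply: (@unitarily_equivalent_of_gram R _ _ Hq (hsum Hi) hHq hHs J v u Hv Hu gram total_v total_u (Mq M n) T2 BB) => //.
- by move=> a x y Hx Hy; apply: (Mq_linear sz al_pos one_gt0 hM d_gt0).
- move=> a x y Hx Hy; apply/funext => i.
  exact: (Mq_linear (al := [:: a1; be i]) erefl (pos2 i) (c_gt0 i) (hHl i) isT a (Hx i) (Hy i)).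
- move=> x Hx; apply: le_trans (HB0 x Hx) _; rewrite ler_wpM2r ?nrm_ge0 //.
  by apply: le_trans (ler_norm _) _; rewrite lerDl.
- move=> x Hx; rewrite -(@ler_pXn2r _ 2) ?nnegrE ?mulr_ge0 ?nrm_ge0 //.
  have [_ ->] := hip_hsum_nrm hHi (T2H _ Hx); rewrite exprMn.
  have [_ ->] := hip_hsum_nrm hHi Hx; rewrite mulr_sumr; apply: ler_sum => i _.
  rewrite -exprMn ler_pXn2r ?nnegrE ?mulr_ge0 ?nrm_ge0 //.
  apply: le_trans (HB i _ (Hx i)) _; rewrite ler_wpM2r ?nrm_ge0 //.
  apply: le_trans (ler_norm _) _; rewrite /BB (bigD1 i) //= addrCA lerDl addr_ge0 //.
  exact: sumr_ge0.
Qed.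

End Decomposition.

(** * Irreducibility *)

Section DiagonalMultiples.
Variable C : numClosedFieldType.
Implicit Types b : seq nat -> C.

(* Multiplication by z_1 - z_2 on coefficients. *)
Definition zdiff b k : C :=
  if k is [:: i; j] then
    (if i is i'.+1 then b [:: i'; j] else 0) - (if j is j'.+1 then b [:: i; j'] else 0)
  else 0.

(** L annihilates z_1 - z_2, hence commutes with multiplication by it. *)
Lemma Lm_zdiff b k : size k = 2 -> Lm (zdiff b) k = zdiff (Lm b) k.
Proof.
case: k => [|i [|j []]] //= _.
by case: i => [|i]; case: j => [|j] /=; rewrite ?subr0 ?sub0r -1?[i.+2%:R]natr1 -1?[j.+2%:R]natr1; ring.
Qed.

Lemma iter_Lm_zdiff N b k : size k = 2 -> iter N (@Lm C) (zdiff b) k = zdiff (iter N (@Lm C) b) k.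
Proof.
elim: N k => [//|N IH] k sk; rewrite !iterS -Lm_zdiff //.
by apply: eq_Lm => x sx _; apply: IH; rewrite sx.
Qed.

Lemma iter_Lm_zdiff_iter N r b k : size k = 2 ->
  iter N (@Lm C) (iter r zdiff b) k = iter r zdiff (iter N (@Lm C) b) k.
Proof.
elim: r k => [//|r IH] k sk; rewrite !iterS iter_Lm_zdiff //.
by case: k sk => [|[|i] [|[|j] []]] //= _; rewrite ?IH.
Qed.

Lemma zdiff_degree b D r i j : (forall i j, (i + j)%N != D -> b [:: i; j] = 0) ->
  (i + j)%N != (D + r)%N -> iter r zdiff b [:: i; j] = 0.
Proof.
move=> bD; elim: r i j => [|r IH] i j ij; first by apply: bD; rewrite addn0 in ij.
by rewrite iterS; case: i ij => [|i]; case: j => [|j] ij /=; rewrite ?IH ?subrr //; lia.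
Qed.

Lemma zdiff_low b r i j : (i + j < r)%N -> iter r zdiff b [:: i; j] = 0.
Proof.
elim: r i j => [//|r IH] i j ij.
by rewrite iterS; case: i ij => [|i]; case: j => [|j] ij /=; rewrite ?IH ?subrr //; lia.
Qed.

Lemma zdiff_delta p q r i j : (q + r < j)%N -> iter r zdiff (delta C [:: p; q]) [:: i; j] = 0.
Proof.
elim: r i j => [|r IH] i j ij /=.
  by rewrite /delta !eqseq_cons (gtn_eqF (n := j)) ?andbF //; lia.
by case: i => [|i]; case: j ij => [|j] ij //; rewrite !IH ?subrr //; lia.
Qed.

Lemma zdiff_delta_top p q r : iter r zdiff (delta C [:: p; q]) [:: p; (q + r)%N] = (-1) ^+ r.
Proof.
elim: r => [|r IH]; first by rewrite addn0 /delta /= eqxx.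
rewrite iterS addnS /= IH exprS mulN1r.
by case: (p) => [|p']; rewrite ?sub0r // zdiff_delta ?sub0r //; lia.
Qed.

End DiagonalMultiples.

#[local] Arguments cf : simpl never.

Section Irreducibility.
Variable R : realType.
Local Notation C := R[i].
Local Notation fn := ('rV[C]_2 -> C^o).
Variables (a1 be c0 : R) (H : hspace fn) (r : nat).
Hypothesis pos2 : all (fun a => 0 < a) [:: a1; be].
Hypothesis c0_gt0 : 0 < c0.
Hypothesis hrk : is_rkhs (@polydisc R 2)
  (fun z w => (c0%:C)%C * \prod_(j < 2) cpow (1 - z 0 j * (w 0 j)^*) (- nth 0 [:: a1; be] j)) H.
Hypothesis r_gt0 : (0 < r)%N.

Local Notation alC := (toC [:: a1; be]).
Local Notation cf := (cf [:: a1; be] c0 H).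
Local Notation Hq := (quotient_module H r).
Local Notation T := (Mq H r).

Let hH : is_hilbert H := rkhs_hilbert hrk.
Let hHq : is_hilbert Hq := quotient_hilbert r hrk.
Let posC : pos alC. Proof. by rewrite pos_toC. Qed.
Let c0C : 0 < (c0%:C)%C :> C. Proof. by rewrite ltcR. Qed.
Let phiH D b : H (phi D b) := phi_H (al := [:: a1; be]) erefl pos2 c0_gt0 hrk D b.
Let qsub (f : fn) : Hq f -> H f. Proof. by case. Qed.
Let MzH (f : fn) : H f -> H (Mz 1 f). Proof. exact: (Mz_H (al := [:: a1; be]) erefl pos2 c0_gt0 hrk isT). Qed.
Let TH (f : fn) : Hq f -> Hq (T f). Proof. exact: (Mq_in (al := [:: a1; be]) erefl pos2 c0_gt0 hrk isT). Qed.
Let hipT (f g : fn) : Hq f -> Hq g -> hip H (T f) g = hip H (Mz 1 f) g.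
Proof. exact: (hip_Mq (al := [:: a1; be]) erefl pos2 c0_gt0 hrk isT). Qed.
Let hipTk k (f g : fn) : Hq f -> Hq g -> hip H (iter k T f) g = hip H (iter k (Mz 1) f) g.
Proof. exact: (hip_iter_Mq (al := [:: a1; be]) erefl pos2 c0_gt0 hrk isT). Qed.
Let cfMz (f : fn) k : H f -> size k = 2 -> cf (Mz 1 f) k = zs (cf f) k.
Proof. exact: (cf_Mz (al := [:: a1; be]) erefl pos2 c0_gt0 hrk isT). Qed.
Let cfI (f g : fn) : H f -> H g -> (forall i j, cf f [:: i; j] = cf g [:: i; j]) -> f = g.
Proof.
move=> Hf Hg fg; apply: (cf_inj (al := [:: a1; be]) erefl pos2 c0_gt0 hrk) => //.
by case=> [|i [|j []]].
Qed.
Let hipS (f s : fn) : Hq f -> submodule H r s -> hip H f s = 0. Proof. by case=> _; apply. Qed.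

Let w i j : C := wt alC [:: i; j] / (c0%:C)%C.
Let w_gt0 i j : 0 < w i j. Proof. by rewrite divr_gt0 // wt_gt0. Qed.

Let mono i j : fn := phi (i + j) (delta C [:: i; j]).

Let hip_mono (f : fn) i j : H f -> hip H f (mono i j) = cf f [:: i; j] * w i j.
Proof.
move=> Hf; rewrite (hip_phi (al := [:: a1; be]) erefl pos2 c0_gt0 hrk) //.
by rewrite {1}(_ : (i + j)%N = sumn [:: i; j]) ?form_delta ?mulrA //= addn0.
Qed.

Let cf_mono i j p q : cf (mono i j) [:: p; q] = ((p == i) && (q == j))%:R.
Proof.
rewrite (cf_phi (al := [:: a1; be]) erefl pos2 c0_gt0 hrk) // /delta !eqseq_cons andbT /= addn0.
case: eqP => //; case: eqP => [->|//]; case: eqP => [->|//] //.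
Qed.

Let Mz_mono i j : Mz 1 (mono i j) = mono i.+1 j.
Proof.
apply: cfI => [||p q]; [exact/MzH/phiH|exact: phiH|].
rewrite cf_mono cfMz //; last exact: phiH.
by case: p => [|p] //=; rewrite mul1r cf_mono.
Qed.

(** Every L^N of a multiple of (z_1 - z_2)^r is again such a multiple, and has no term of degree <
    r. *)
Let submodule_zdiff i j : submodule H r (phi (i + j + r) (iter r (@zdiff C) (delta C [:: i; j]))).
Proof.
apply/(submoduleP (al := [:: a1; be]) erefl pos2 c0_gt0 hrk) => //; split=> // N k sk kr.
rewrite (@eq_iter_Lm _ _ _ (iter r (@zdiff C) (delta C [:: i; j]))) => [|y]; last first.
  rewrite sk => sy; rewrite (cf_phi (al := [:: a1; be]) erefl pos2 c0_gt0 hrk) //.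
  case: y sy => [|p [|q []]] // _; case: eqP => //= /eqP; rewrite addn0 => pq.
  rewrite (@zdiff_degree _ _ (i + j)) // => p' q' pq'; rewrite /delta !eqseq_cons andbT.
  by case: eqP => //= Ep; case: eqP => //= Eq; move: pq'; rewrite Ep Eq eqxx.
rewrite iter_Lm_zdiff_iter //.
by case: k sk kr => [|p [|q []]] //= _; rewrite addn0; apply: zdiff_low.
Qed.

(* f is orthogonal to z_1^p z_2^(q-r) (z_1 - z_2)^r. *)
Let cf_quotient (f : fn) p q : Hq f -> (r <= q)%N ->
  (forall p' q', (q' < q)%N -> (p' + q' = p + q)%N -> cf f [:: p'; q'] = 0) -> cf f [:: p; q] = 0.
Proof.
move=> Hqf rq f0; have := hipS Hqf (submodule_zdiff p (q - r)).
rewrite (hip_phi (al := [:: a1; be]) erefl pos2 c0_gt0 hrk); last exact: qsub.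
rewrite /form (msum_single (k0 := [:: p; q])) //; last 2 first.
- by rewrite /=; lia.
- case=> [|p' [|q' []]] // _; rewrite /= addn0 => pq ne.
  have {}pq : (p' + q' = p + q)%N by lia.
  case: (ltngtP q' q) => qq; first by rewrite f0 // !mul0r.
    by rewrite zdiff_delta ?conjC0 ?mulr0 ?mul0r //; lia.
  by case/negP: ne; rewrite qq (_ : p' = p) //; lia.
have := zdiff_delta_top C p (q - r) r; rewrite subnK // => ->.
move/eqP; rewrite mulf_eq0 invr_eq0 (gt_eqF c0C) orbF mulf_eq0 (gt_eqF (wt_gt0 _ posC)) orbF.
by rewrite mulf_eq0 conjC_eq0 signr_eq0 orbF => /eqP.
Qed.

(** By [cf_quotient] a coefficient with q >= r is forced to 0 by those of the same degree with
    smaller q. *)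
Let cf_quotient_gen (f : fn) : Hq f -> (forall p q, (q < r)%N -> cf f [:: p; q] = 0) -> f = 0.
Proof.
move=> Hqf f0; apply: (cf_total (al := [:: a1; be]) erefl pos2 c0_gt0 hrk); first exact: qsub.
suff F q p : cf f [:: p; q] = 0 by case=> [|p [|q []]].
have [n] := ubnP q; elim: n q p => // n IH q p qn.
by have [/f0|rq] := ltnP q r; [apply|apply: cf_quotient => // p' q' qq _; apply: IH; lia].
Qed.

(* The kernel of T^*, in which the components of every z_2^q with q < r lie. *)
Let coker (u : fn) := Hq u /\ forall x, Hq x -> hip H (T x) u = 0.

(** Modulo the submodule, z_1^(p+1) z_2^q is z_1 times a vector of the quotient, hence orthogonal to
    u. So u involves z_2 only, and [cf_quotient] excludes the powers from r on. *)
Let coker_cf (u : fn) p q : coker u -> ((0 < p) || (r <= q))%N -> cf u [:: p; q] = 0.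
Proof.
move=> [Hu u0]; have Hu' := qsub Hu.
have S p' q' : cf u [:: p'.+1; q'] = 0.
  have Hm : H (mono p' q') by exact: phiH.
  have [p1 _] := hproj_spec hH hHq (@qsub) erefl Hm.
  have S1 := submodule_Mz (al := [:: a1; be]) erefl pos2 c0_gt0 hrk isT
    (submodule_hproj r (al := [:: a1; be]) erefl pos2 c0_gt0 hrk isT Hm).
  have [HS1 _] := S1.
  have E : hip H (mono p'.+1 q') u = 0.
    rewrite -Mz_mono -[mono p' q'](addrNK (hproj Hq (mono p' q'))) addrC.
    rewrite -[hproj _ _ in X in Mz 1 X]scale1r Mz_linear !scale1r.
    have Hz : H (Mz 1 (hproj Hq (mono p' q'))) by apply/MzH/qsub.
    rewrite hipDl // -hipT // u0 // add0r (hipC hH Hu') // hipS // conjC0 //.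
  have := hip_mono p'.+1 q' Hu'; rewrite (hipC hH (phiH _ _) Hu') E conjC0.
  by move/esym/eqP; rewrite mulf_eq0 (gt_eqF (w_gt0 _ _)) orbF => /eqP.
case: p => [|p] //= rq; apply: cf_quotient => // -[|p'] q' qq //.
by rewrite !add0n => E; rewrite E ltnn in qq.
Qed.

Let coker_sum (u : fn) k : coker u ->
  iter k (Mz 1) u = \sum_(q < r) cf u [:: 0%N; nat_of_ord q] *: mono k q.
Proof.
move=> cu; have [Hu _] := cu; elim: k => [|k IH] /=.
  have cf_sum p q (I : Type) (s : seq I) (F : I -> fn) (x : I -> C) : (forall i, H (F i)) ->
      cf (\sum_(i <- s) x i *: F i) [:: p; q] = \sum_(i <- s) x i * cf (F i) [:: p; q].
    move=> HF; elim: s => [|i s IH].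
      rewrite !big_nil; have := cf_linear (al := [:: a1; be]) erefl pos2 c0_gt0 hrk (-1) (hspace0 hH) (hspace0 hH).
      by move=> /(_ [:: p; q] erefl); rewrite scaler0 addr0 mulN1r addNr.
    rewrite !big_cons (cf_linear (al := [:: a1; be]) erefl pos2 c0_gt0 hrk) ?IH //.
    by apply: hspace_sum => // j _; apply: hspaceZ.
  apply: cfI => [||p q]; first exact: qsub.
    by apply: hspace_sum => // q _; apply: hspaceZ => //; apply: phiH.
  rewrite cf_sum => [|q']; last exact: phiH.
  have [qr|qr] := ltnP q r; last first.
    rewrite coker_cf ?qr ?orbT // big1 // => q' _; rewrite cf_mono.
    by rewrite (gtn_eqF (m := q')) ?andbF ?mulr0 // (leq_trans (ltn_ord q')).
  rewrite (bigD1 (Ordinal qr)) //= big1 ?addr0 => [|q' qq].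
    by rewrite cf_mono eqxx andbT; case: p => [|p]; rewrite ?mulr1 // mulr0 coker_cf.
  rewrite cf_mono (_ : (q == q') = false) ?andbF ?mulr0 //.
  by apply: contraNF qq => /eqP qq; apply/eqP/val_inj.
rewrite IH (big_morph (Mz 1) (id1 := 0) (op1 := +%R)); last 2 first.
- by move=> x y; rewrite -[x]scale1r Mz_linear !scale1r.
- by apply/funext => z; rewrite /Mz mulr0.
apply: eq_bigr => q _; rewrite -Mz_mono -[X in Mz 1 X]addr0 Mz_linear.
by rewrite [X in _ + X](_ : _ = 0) ?addr0 //; apply/funext => z; rewrite /Mz mulr0.
Qed.

Let w_conj i j : (w i j)^* = w i j. Proof. exact/CrealP/gtr0_real. Qed.

Let hip_monol (g : fn) i j : H g -> hip H (mono i j) g = (cf g [:: i; j])^* * w i j.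
Proof. by move=> Hg; rewrite (hipC hH Hg (phiH _ _)) hip_mono // rmorphM /= w_conj. Qed.

Let hip_iter_coker (u g : fn) k : coker u -> H g ->
  hip H (iter k (Mz 1) u) g = \sum_(q < r) cf u [:: 0%N; nat_of_ord q] * ((cf g [:: k; nat_of_ord q])^* * w k q).
Proof.
move=> cu Hg; rewrite coker_sum // hip_suml // => [|q _]; last by apply: hspaceZ => //; exact: phiH.
by apply: eq_bigr => q _; rewrite hipZl ?hip_monol //; exact: phiH.
Qed.

(** This is (z_2 - z_1)^r, with the sign for which the coefficient of z_2^r is 1. *)
Let s : fn := phi r (low2 C r).

Let cf_s i j : cf s [:: i; j] = low2 C r [:: i; j].
Proof. by rewrite (cf_phi (al := [:: a1; be]) erefl pos2 c0_gt0 hrk) //= addn0; case: eqP. Qed.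

Let s_submodule : submodule H r s.
Proof.
apply/(submoduleP (al := [:: a1; be]) erefl pos2 c0_gt0 hrk) => //; split=> [|N k sk kr]; first exact: phiH.
rewrite (@eq_iter_Lm _ _ _ (low2 C r)) => [|y]; last first.
  by rewrite sk; case: y => [|p [|q []]] // _; rewrite cf_s.
case: N => [|N]; first by case: k sk kr => [|p [|q []]] //= _ kr; case: eqP => // E; move: kr; rewrite addn0 E ltnn.
rewrite iterSr (@eq_iter_Lm _ _ _ (fun=> 0)) => [|y]; last by rewrite sk => sy; exact: Lm_low2.
elim: N (k) => [//|N IH] x; rewrite iterS (@eq_Lm _ _ (fun=> 0)) ?Lm_0 // => y _ _; exact: IH.
Qed.

Let Hs : H s. Proof. exact: phiH. Qed.

Let cf_submodule_low (g : fn) i j : submodule H r g -> (i + j < r)%N -> cf g [:: i; j] = 0.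
Proof.
move=> /(submoduleP (al := [:: a1; be]) erefl pos2 c0_gt0 hrk r g isT)[_ h] ij.
by apply: (h 0%N); rewrite //= addn0.
Qed.

(** L g has no coefficient of degree r - 1, so the part of g of degree r is translation invariant,
    hence a multiple of [s]. *)
Let cf_submodule_top (g : fn) i j : submodule H r g -> (i + j = r)%N ->
  cf g [:: i; j] = cf g [:: 0%N; r] * low2 C r [:: i; j].
Proof.
move=> /(submoduleP (al := [:: a1; be]) erefl pos2 c0_gt0 hrk r g isT)[_ h].
elim: i j => [|i IH] j ij.
  by rewrite -ij add0n /= add0n eqxx bin0 expr0 !mulr1.
have : i.+1%:R * cf g [:: i.+1; j] + j.+1%:R * cf g [:: i; j.+1] = 0.
  have := h 1%N [:: i; j] erefl; rewrite [iter _ _ _ _]/= addr0; apply.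
  by rewrite /= addn0 -ij.
have : i.+1%:R * low2 C r [:: i.+1; j] + (j.+1%:R * low2 C r [:: i; j.+1] + 0) = 0.
  exact: (@Lm_low2 C r [:: i; j]).
rewrite (IH j.+1) ?addnS -?addSn // addr0; move/eqP; rewrite addr_eq0 => /eqP L0 /eqP.
rewrite addr_eq0 => /eqP E.
have i0 : i.+1%:R != 0 :> C by rewrite pnatr_eq0.
apply: (mulfI i0); rewrite E [RHS]mulrCA.
rewrite L0; by ring.
Qed.

(** [Nr] is the squared norm of [s], and [P] below is the inner product of z_1 z_2^(r-1) with
    [s]. *)
Let Nr : C := form alC r (low2 C r) (low2 C r) / (c0%:C)%C.
Let P : C := low2 C r [:: 1%N; r.-1] * w 1 r.-1.

Let Nr_gt0 : 0 < Nr.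
Proof. by rewrite divr_gt0 // form_low2_gt0 //; move: posC => /and3P[]. Qed.

Let low2_conj i j : (low2 C r [:: i; j])^* = low2 C r [:: i; j].
Proof.
rewrite /=; case: ifP => _; last by rewrite conjC0.
by rewrite rmorphM rmorphXn rmorphN1 /= conjC_nat.
Qed.

Let P_conj : P^* = P. Proof. by rewrite rmorphM /= w_conj [X in X * _]low2_conj. Qed.

Let P_neq0 : P != 0.
Proof.
rewrite mulf_eq0 negb_or (gt_eqF (w_gt0 _ _)) andbT /= add1n prednK // eqxx.
by rewrite mulf_eq0 negb_or signr_eq0 pnatr_eq0 bin1 -lt0n.
Qed.

Let hip_s (g : fn) : submodule H r g -> hip H g s = cf g [:: 0%N; r] * Nr.
Proof.
move=> Sg; have [Hg _] := Sg; rewrite (hip_phi (al := [:: a1; be]) erefl pos2 c0_gt0 hrk) //.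
rewrite (@eq_form _ _ _ _ _ (fun k => cf g [:: 0%N; r] * low2 C r k) (low2 C r)) ?formZl ?mulrA //.
by case=> [|i [|j []]] //= _; rewrite addn0 => ij; apply: cf_submodule_top.
Qed.

(** z_1 u has terms z_1 z_2^q with q < r only, and g starts in degree r; they meet in z_1 z_2^(r-1)
    alone. *)
Let hip_Mz_coker (u g : fn) : coker u -> submodule H r g ->
  hip H (Mz 1 u) g = cf u [:: 0%N; r.-1] * (cf g [:: 0%N; r])^* * P.
Proof.
move=> cu Sg; have [Hg _] := Sg; rewrite [LHS](hip_iter_coker 1 cu Hg).
have rr : (r.-1 < r)%N by rewrite prednK.
rewrite (bigD1 (Ordinal rr)) //= big1 ?addr0 => [|q qr]; last first.
  rewrite (cf_submodule_low Sg) ?conjC0 ?mul0r ?mulr0 // add1n ltn_neqAle ltn_ord andbT.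
  by apply: contraNneq qr => qr; apply/eqP/val_inj => /=; lia.
rewrite (cf_submodule_top Sg) ?add1n ?prednK // -[RHS]mulrA; congr (_ * _).
by rewrite rmorphM -mulrA; congr (_ * (_ * _)); exact: (low2_conj 1 r.-1).
Qed.

Let P_Nr_conj : (P / Nr)^* = P / Nr.
Proof.
rewrite -[LHS]/(Num.conj_op (P * Nr^-1)) rmorphM /= fmorphV /= P_conj.
by rewrite (CrealP (gtr0_real Nr_gt0)).
Qed.

(** Pairings with z_1 u and with [s] both depend on an element of the submodule only through its
    coefficient of z_2^r, so one multiple of [s] makes z_1 u orthogonal to the submodule. *)
Let T_coker (u : fn) : coker u ->
  T u = Mz 1 u - (cf u [:: 0%N; r.-1] * (P / Nr)) *: s.
Proof.
move=> cu; have [Hu _] := cu; have HMu : H (Mz 1 u) by exact/MzH/qsub.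
have Hks a : H (a *: s) by exact: hspaceZ.
apply: (hproj_unique hH hHq (@qsub) erefl) => // [|y Hy].
  apply: (quotient_intro hrk) => [|g Sg]; first exact: hspaceB.
  have [Hg _] := Sg; rewrite hipBr // (hipC hH HMu Hg) hip_Mz_coker // hipZr // hip_s //.
  have cM (x y z : C) : (x * y^* * z)^* = x^* * y * z^* by rewrite !rmorphM /= conjCK.
  have cM2 (x y : C) : (x * y)^* = x^* * y^* by rewrite rmorphM.
  rewrite cM cM2 P_conj P_Nr_conj.
  by have := Nr_gt0 => /lt0r_neq0 N0; field.
have Hy' := qsub Hy; rewrite hipBl // hipZl // (hipC hH Hy' Hs) (hipS Hy) // conjC0 mulr0 subr0 //.
Qed.

Let hip_T_coker (u v : fn) : coker u -> coker v ->
  hip H (T u) (T v) = wt1 (a1%:C)%C 1 * hip H u v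
    - cf u [:: 0%N; r.-1] * (cf v [:: 0%N; r.-1])^* * (P ^+ 2 / Nr).
Proof.
move=> cu cv; have [Hu _] := cu; have [Hv _] := cv; have Hv' := qsub Hv.
have HMu : H (Mz 1 u) by exact/MzH/qsub.
have HMv : H (Mz 1 v) by exact/MzH.
rewrite hipT //; last exact: TH.
rewrite T_coker // hipBr //; last exact: hspaceZ.
rewrite hipZr // (hip_Mz_coker cu s_submodule); congr (_ - _); last first.
  rewrite cf_s /= add0n eqxx expr0 bin0 mulr1 conjC1 mulr1.
  have cM2 (x y : C) : (x * y)^* = x^* * y^* by rewrite rmorphM.
  by rewrite cM2 P_Nr_conj; ring.
(* On functions of z_2 alone, multiplication by z_1 scales the inner product by the weight of
   z_1. *)
rewrite [LHS](hip_iter_coker 1 cu HMv) [X in _ * X](hip_iter_coker 0 cu Hv') mulr_sumr.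
apply: eq_bigr => q _; rewrite cfMz //= mul1r /w /=.
have -> : wt1 (a1%:C)%C 0 = 1 by rewrite /wt1 rf0 divr1.
by field; rewrite gt_eqF.
Qed.

Let e : fn := mono 0 r.-1.

Let mono_quotient q : (q < r)%N -> Hq (mono 0 q).
Proof. by move=> qr; exact: (quotient_phi (al := [:: a1; be]) erefl pos2 c0_gt0 hrk isT 0 (delta C [:: 0%N; q]) qr). Qed.

Let He : Hq e. Proof. by apply: mono_quotient; rewrite prednK. Qed.

Let coker_mono q : (q < r)%N -> coker (mono 0 q).
Proof.
move=> qr; split=> [|x Hx]; first exact: mono_quotient.
rewrite hipT //; last exact: mono_quotient.
by rewrite hip_mono ?cfMz ?mul0r //; [exact: qsub|exact/MzH/qsub].
Qed.

Let cf_e : cf e [:: 0%N; r.-1] = 1. Proof. by rewrite cf_mono !eqxx. Qed.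

(** A reducing subspace and its complement in a form symmetric in both, so that either one may play
    the role of A. *)
Definition splitting (A B : set fn) := [/\ A `<=` hcar Hq, B `<=` hcar Hq,
  (forall x, A x -> A (T x)) /\ (forall x, B x -> B (T x)),
  (forall x y, A x -> B y -> hip H x y = 0) &
  forall x, Hq x -> exists2 u, A u & exists2 v, B v & x = u + v].

Let splitting_sym A B : splitting A B -> splitting B A.
Proof.
case=> AH BH [TA TB] AB sp; split=> // [x y Bx Ay|x /sp[u Au [v Bv ->]]].
  by rewrite (hipC hH (qsub (AH _ Ay)) (qsub (BH _ Bx))) AB ?conjC0.
by exists v => //; exists u => //; rewrite addrC.
Qed.

(** By invariance, T maps each summand into itself, hence orthogonally to the component in the other
    summand. *)
Let splitting_coker A B u v : splitting A B -> A u -> B v -> coker (u + v) -> coker u.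
Proof.
case=> AH BH [TA TB] AB sp Au Bv [Huv uv0]; split=> [|x /sp[xa Aa [xb Bb ->]]]; first exact: AH.
have Ha := AH _ Aa; have Hb := BH _ Bb; have Hu := AH _ Au; have Hv := BH _ Bv.
have -> : T (xa + xb) = T xa + T xb.
  rewrite -[xa]scale1r (Mq_linear (al := [:: a1; be]) erefl pos2 c0_gt0 hrk isT) //.
  by rewrite !scale1r.
have [Ka Kb Ku Kv] : [/\ H (T xa), H (T xb), H u & H v] by split; do ?apply: qsub; do ?apply: TH.
rewrite hipDl // (hipC hH Ku Kb) (AB _ _ Au (TB _ Bb)) conjC0 addr0.
have := uv0 _ Ha; rewrite hipDr // [X in _ + X]AB ?addr0 //; exact: TA.
Qed.

(* If e lies in A, the cokernel of T on B is orthogonal to e and to every T^k+1 e. *)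
Let splitting_trivial A B : splitting A B -> A e -> forall x, B x -> x = 0.
Proof.
move=> spl Ae; have [AH BH [TA TB] AB sp] := spl.
have kill v : B v -> coker v -> v = 0.
  move=> Bv cv; have [Hv _] := cv; have Hv' := qsub Hv.
  apply: cf_quotient_gen => // p q qr; case: p => [|p]; last exact: coker_cf.
  have [qe|qe] := eqVneq q r.-1.
    have := AB _ _ Ae Bv; rewrite (hipC hH Hv' (qsub He)) /e hip_mono // => /eqP.
    by rewrite conjC_eq0 mulf_eq0 (gt_eqF (w_gt0 _ _)) orbF -qe => /eqP.
  (* With this exponent z_1^k z_2^q has degree r and occurs in [s], whereas the other terms of z_1^k
     v do not. As k > 1, they are also orthogonal to the term z_1 e of T e. *)
  pose k := (r - q)%N; have k2 : (1 < k)%N by rewrite /k; lia.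
  have ce : coker e by apply: coker_mono; rewrite prednK.
  have HTk : B (iter k T v) by elim: (k) => [//|j IH]; rewrite iterS; exact: (TB _ IH).
  have He' := qsub He; have HMe : H (Mz 1 e) by exact: MzH.
  have HMk j : H (iter j (Mz 1) v) by elim: j => [//|j IH]; exact: MzH.
  have := AB _ _ (TA _ Ae) HTk.
  rewrite (hipC hH (qsub (BH _ HTk)) (qsub (TH He))) hipTk //; last exact: TH.
  rewrite T_coker // cf_e mul1r hipBr //; last exact: hspaceZ.
  have -> : hip H (iter k (Mz 1) v) (Mz 1 e) = 0.
    rewrite Mz_mono hip_mono // -(prednK (ltnW k2)) iterS cfMz //= mul1r.
    rewrite -(prednK (_ : (0 < k.-1)%N)); last by lia.
    by rewrite iterS cfMz // !mul0r.
  rewrite hipZr // hip_iter_coker // sub0r (bigD1 (Ordinal qr)) //= big1 ?addr0 => [|q' qq]; last first.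
    rewrite cf_s /= ifF ?conjC0 ?mul0r ?mulr0 //.
    apply: contraNF qq => /eqP qq; apply/eqP/val_inj => /=; rewrite /k in qq; lia.
  have cancel (x y z t : C) : y != 0 -> z != 0 -> t != 0 -> (- (y * (x * (z * t))))^* = 0 -> x = 0.
    move=> y0 z0 t0 /eqP; rewrite conjC_eq0 oppr_eq0 !mulf_eq0.
    by rewrite (negPf y0) (negPf z0) (negPf t0) !orbF => /eqP.
  apply: cancel; last by rewrite gt_eqF.
    by rewrite P_Nr_conj mulf_neq0 // invr_eq0 gt_eqF.
  rewrite conjC_eq0 cf_s /= subnK ?eqxx; last exact: ltnW.
  by rewrite mulf_neq0 ?signr_eq0 // pnatr_eq0 -lt0n bin_gt0 leq_subr.
(* The B-component of z_2^q is in the cokernel, hence 0. The vectors T^p z_2^q, which then lie in A,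
   test all coefficients of x with second exponent below r. *)
have Am q : (q < r)%N -> A (mono 0 q).
  move=> qr; have [u Au [v Bv E]] := sp _ (mono_quotient qr).
  have cuv : coker (u + v) by rewrite -E; exact: coker_mono.
  have v0 : v = 0.
    by apply: kill => //; apply: (splitting_coker (splitting_sym spl) Bv Au); rewrite addrC.
  by rewrite E v0 addr0.
move=> x Bx; have Hx := BH _ Bx; apply: cf_quotient_gen => // p q qr.
have HTp : A (iter p T (mono 0 q)) by elim: p => [|p IH]; [exact: Am|rewrite iterS; exact: (TA _ IH)].
have := AB _ _ HTp Bx; rewrite hipTk //; last exact: mono_quotient.
have -> : iter p (Mz 1) (mono 0 q) = mono p q by elim: p {HTp} => [//|p IH]; rewrite iterS IH Mz_mono.
rewrite hip_monol; last exact: qsub.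
by move/eqP; rewrite mulf_eq0 conjC_eq0 (gt_eqF (w_gt0 _ _)) orbF => /eqP.
Qed.

(** Write e = u + v. As both u, v and T u, T v are orthogonal, [hip_T_coker] leaves <u, e> <e, v> =
    0; here <u, e> = |u|^2 and <v, e> = |v|^2. *)
Let splitting_alternative A B : splitting A B -> A e \/ B e.
Proof.
move=> spl; have [AH BH [TA TB] AB sp] := spl; have [u Au [v Bv E]] := sp _ He.
have ce : coker e by apply: coker_mono; rewrite prednK.
have cu : coker u by apply: (splitting_coker spl Au Bv); rewrite -E.
have cv : coker v by apply: (splitting_coker (splitting_sym spl) Bv Au); rewrite addrC -E.
have Ku := qsub (AH _ Au); have Kv := qsub (BH _ Bv).
have := hip_T_coker cu cv; rewrite (AB _ _ Au Bv) (AB _ _ (TA _ Au) (TB _ Bv)) mulr0 sub0r.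
have PN : P ^+ 2 / Nr != 0 by rewrite mulf_neq0 ?expf_neq0 // invr_eq0 gt_eqF.
have cancel (x y z : C) : z != 0 -> 0 = - (x * y^* * z) -> x = 0 \/ y = 0.
  move=> z0 /esym/eqP; rewrite oppr_eq0 !mulf_eq0 conjC_eq0 (negPf z0) orbF.
  by case/orP => /eqP; [left|right].
move/(cancel _ _ _ PN) => [] z0; [right|left].
  suff u0 : u = 0 by rewrite E u0 add0r.
  apply: (hip_def hH Ku); have := hip_mono 0 r.-1 Ku; rewrite z0 mul0r -/e E hipDr // (AB _ _ Au Bv) addr0.
  by [].
suff v0 : v = 0 by rewrite E v0 addr0.
apply: (hip_def hH Kv); have := hip_mono 0 r.-1 Kv; rewrite z0 mul0r -/e E hipDr //.
by rewrite (hipC hH Ku Kv) (AB _ _ Au Bv) conjC0 add0r.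
Qed.

Theorem Mq_irreducible : irreducible Hq T.
Proof.
move=> N [Ncl TN TB]; have [NH [N0 NL] _] := Ncl.
have spl : splitting N (hominus Hq N).
  split=> //; first by move=> x [].
    by move=> x y Nx [Hy yN]; rewrite (hipC hH (qsub Hy) (qsub (NH _ Nx))) [hip H y x]yN ?conjC0.
  move=> x Hx; have hN := is_hilbert_sub hHq Ncl.
  have [p1 p2] := @hproj_spec R _ Hq hHq (HSpace N (hip Hq)) hN NH erefl x Hx.
  exists (hproj (HSpace N (hip Hq)) x) => //; exists (x - hproj (HSpace N (hip Hq)) x).
    by split=> //; apply: hspaceB => //; apply: NH.
  by rewrite addrC subrK.
have [Ne|Be] := splitting_alternative spl; [right|left].
  apply/seteqP; split=> // x Hx; have [_ _ _ _ sp] := spl.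
  have [u Nu [v Bv ->]] := sp _ Hx.
  by rewrite (splitting_trivial spl Ne Bv) addr0.
apply/seteqP; split=> [x Nx|x -> //].
exact: (splitting_trivial (splitting_sym spl) Be Nx).
Qed.

End Irreducibility.

(** * The weights, kernels and constants of the statement *)

Section Weights.
Variables (R : realType) (m : nat) (alpha : 'rV[R]_m).
Hypothesis alpha_gt0 : forall j, 0 < alpha 0 j.

Definition weights : seq R := [seq alpha 0 j | j <- enum 'I_m].

Lemma size_weights : size weights = m.
Proof. by rewrite size_map size_enum_ord. Qed.

Lemma nth_weights (j : 'I_m) : nth 0 weights j = alpha 0 j.
Proof. by rewrite (nth_map j) ?nth_ord_enum // size_enum_ord. Qed.

Lemma weights_gt0 : all (fun a => 0 < a) weights.
Proof. by apply/allP => _ /mapP[j _ ->]. Qed.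

Lemma entE k : ent alpha k.+1 = nth 0 weights k.
Proof.
rewrite /ent /=; case: insubP => [j _ <-|km]; first by rewrite nth_weights.
by rewrite nth_default // size_weights leqNgt.
Qed.

Lemma ent_gt0 k : (0 < k <= m)%N -> 0 < ent alpha k.
Proof. by case: k => // k km; rewrite entE (nth_weights (Ordinal km)). Qed.

Lemma sum_behead_weights : \sum_(a <- behead weights) a = \sum_(2 <= k < m.+1) ent alpha k.
Proof.
rewrite (big_nth 0) size_behead size_weights (big_addn 0 m.+1 2) subSS subn1.
by apply: eq_bigr => k _; rewrite nth_behead addn2 entE.
Qed.

Lemma weighted_kernelE : weighted_kernel alpha =
  fun z w => ((1 : R)%:C)%C * \prod_(j < m) cpow (1 - z 0 j * (w 0 j)^*) (- nth 0 weights j).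
Proof.
apply/funext => z; apply/funext => w; rewrite mul1r.
by apply: eq_bigr => j _; rewrite nth_weights.
Qed.

Lemma KellE (l : 'rV[nat]_(m - 2)) : Kell alpha l =
  fun z w => ((Cell alpha l)%:C)%C * \prod_(j < 2) cpow (1 - z 0 j * (w 0 j)^*)
    (- nth 0 [:: ent alpha 1; \sum_(a <- behead weights) a + 2 * (absl l)%:R] j).
Proof.
apply/funext => z; apply/funext => w; rewrite sum_behead_weights.
rewrite big_ord_recl big_ord1 /= opprD /Kell !mulrA.
have e1 (v : 'rV[R[i]]_2) : ent v 1 = v 0 ord0.
  by rewrite /ent insubT //; congr (v _ _); apply: val_inj.
have e2 (v : 'rV[R[i]]_2) : ent v 2 = v 0 (lift ord0 ord0).
  by rewrite /ent insubT //; congr (v _ _); apply: val_inj.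
by rewrite !e1 !e2.
Qed.

Lemma cfactor_gt0 p (a b : R) : 0 < a -> 0 < b -> 0 < cfactor p a b.
Proof.
move=> a0 b0; have P x k : 0 < x -> 0 < poch x k by exact: poch_gt0.
rewrite mulr_gt0 ?ltr0n ?fact_gt0 // big_nat_recl // ltr_wpDr //.
  by rewrite sumr_ge0 // => i _; rewrite mulr_ge0 // ltW // divr_gt0 ?mulr_gt0 ?exprn_gt0 ?P.
by rewrite bin0 mul1r divr_gt0 ?mulr_gt0 ?exprn_gt0 ?P.
Qed.

Lemma Cell_gt0 (l : 'rV[nat]_(m - 2)) : 0 < Cell alpha l.
Proof.
rewrite /Cell big_nat_cond; apply: prodr_gt0 => j /andP[/andP[j1 jm] _].
apply: cfactor_gt0; first by apply: ent_gt0; lia.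
rewrite ltr_wpDr ?mulr_ge0 //; rewrite big_ltn; last by lia.
rewrite ltr_wpDr ?ent_gt0 //; last by lia.
by rewrite big_nat_cond sumr_ge0 // => k /andP[/andP[k1 k2] _]; rewrite ltW // ent_gt0; lia.
Qed.

End Weights.

(** * The index set of the iterated sum *)

Section Indices.
Variables (m n : nat).
Hypothesis hm : (3 <= m)%N.
Hypothesis hn : (0 < n)%N.

Definition ell_seq (x : ell_index m n) : seq nat := [seq ell x ord0 j | j <- enum 'I_(m - 2)].

Lemma size_ell_seq (x : ell_index m n) : size (ell_seq x) = (m - 2)%N.
Proof. by rewrite size_map size_enum_ord. Qed.

Lemma sumn_ell_seq (x : ell_index m n) : sumn (ell_seq x) = absl (ell x).
Proof. by rewrite sumnE big_map big_enum. Qed.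

Lemma ell_seq_inj : injective ell_seq.
Proof.
move=> x y /eq_in_map xy; apply: val_inj; apply/matrixP => i j; rewrite ord1.
by apply: val_inj; have := xy j; rewrite mem_enum !mxE; apply.
Qed.

(** The condition for the first entry of l already bounds the sum of all entries. *)
Lemma absl_lt (x : ell_index m n) : (absl (ell x) < n)%N.
Proof.
have m2 : (0 < m - 2)%N by lia.
have /forallP/(_ (Ordinal m2)) := valP x => h.
rewrite /absl (bigD1 (Ordinal m2)) //= mxE.
rewrite (eq_bigl (fun j : 'I_(m - 2) => (0 < j)%N)) => [|j]; last by rewrite lt0n.
rewrite (eq_bigr (fun j => nat_of_ord (val x ord0 j))) => [|j _]; last by rewrite mxE.
by rewrite -ltnS in h; apply: leq_trans h _; lia.
Qed.

Lemma ell_seq_onto l : size l = (m - 2)%N -> (sumn l < n)%N -> exists x, ell_seq x = l.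
Proof.
move=> sl ln; have E : sumn l = (\sum_(j < m - 2) nth 0 l j)%N.
  by rewrite sumnE (big_nth 0%N) big_mkord sl.
have lt j : (nth 0 l j < n)%N.
  have [jm|jm] := ltnP j (size l); last by rewrite nth_default.
  apply: leq_ltn_trans ln; rewrite E; rewrite sl in jm.
  by rewrite (bigD1 (Ordinal jm)) //= leq_addr.
pose v : 'rV['I_n]_(m - 2) := \row_j Ordinal (lt j).
have ok : index_ok v.
  apply/forallP => k; rewrite mxE -ltnS subn1 prednK //; apply: leq_ltn_trans ln.
  rewrite E [leqRHS](bigD1 k) //= leq_add2l big_mkcond [leqRHS]big_mkcond /=.
  apply: leq_sum => j _; rewrite mxE /=; case: ifP => // kj.
  by rewrite ifT //; apply: contraTneq kj => ->; rewrite ltnn.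
exists (exist _ v ok); apply: (@eq_from_nth _ 0%N); first by rewrite size_ell_seq sl.
move=> j; rewrite size_ell_seq => jm.
by rewrite (nth_map (Ordinal jm)) ?size_enum_ord // !mxE /= nth_enum_ord.
Qed.

End Indices.

Theorem theorem4p9 (R : realType) (m n : nat) (alpha : 'rV[R]_m)
    (hm : (3 <= m)%N) (hn : (1 <= n)%N) (halpha : forall j, 0 < alpha 0 j)
    (M : hspace ('rV[R[i]]_m -> R[i]^o))
    (hM : is_rkhs (@polydisc R m) (weighted_kernel alpha) M)
    (Mell : ell_index m n -> hspace ('rV[R[i]]_2 -> R[i]^o))
    (hMell : forall x : ell_index m n,
       is_rkhs (@polydisc R 2) (Kell alpha (ell x)) (Mell x)) :
  [/\ forall x : ell_index m n, 0 < Cell alpha (ell x),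
      unitarily_equivalent
        (quotient_module M n) (Mq M n)
        (hsum (fun x : ell_index m n =>
           quotient_module (Mell x) (n - absl (ell x))))
        (opsum (fun x : ell_index m n => Mq (Mell x) (n - absl (ell x)))) &
      forall x : ell_index m n,
        irreducible (quotient_module (Mell x) (n - absl (ell x)))
                    (Mq (Mell x) (n - absl (ell x)))].
Proof.
have C0 (x : ell_index m n) := Cell_gt0 halpha (ell x).
have [a1 [al' Eal]] : exists a1, exists al', weights alpha = a1 :: al'.
  have := size_weights alpha; case: (weights alpha) => [|a1 al' _]; last by exists a1, al'.
  by move=> /= E; move: hm; rewrite -E.
have sz : size (a1 :: al') = m by rewrite -Eal size_weights.
have pos : all (fun a => 0 < a) (a1 :: al') by rewrite -Eal; exact: weights_gt0.
have E1 : ent alpha 1 = a1 by rewrite entE Eal.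
(* With the constant 1 in front, the kernel of [M] has the same shape as those of the summands. *)
have {}hM : is_rkhs (@polydisc R m) (fun z w => ((1 : R)%:C)%C *
    \prod_(j < m) cpow (1 - z 0 j * (w 0 j)^*) (- nth 0 (a1 :: al') j)) M.
  by rewrite -Eal -weighted_kernelE.
pose be x := \sum_(a <- al') a + 2 * (sumn (ell_seq (m := m) (n := n) x))%:R.
have {}hMell (x : ell_index m n) : is_rkhs (@polydisc R 2) (fun z w => ((Cell alpha (ell x))%:C)%C *
    \prod_(j < 2) cpow (1 - z 0 j * (w 0 j)^*) (- nth 0 [:: a1; be x] j)) (Mell x).
  have := hMell x; rewrite KellE Eal E1 /=.
  by rewrite /be sumn_ell_seq.
have al'0 : al' != [::] by case: (al') sz => // E; move: hm; rewrite -E.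
have [a10 al'_pos] := andP pos.
split=> // [|x].
  have := @quotient_decomposition R m n a1 al' M sz al'0 pos hM (ell_index m n)
    (@ell_seq m n) (fun x : ell_index m n => Cell alpha (ell x)) Mell (@ell_seq_inj m n).
  have sE : (size al').-1 = (m - 2)%N by rewrite -sz /=; lia.
  rewrite sE => /(_ (@size_ell_seq m n) (ell_seq_onto hn) C0 hMell).
  have -> : (fun i => quotient_module (Mell i) (n - sumn (ell_seq i))) =
            (fun i => quotient_module (Mell i) (n - absl (ell i))).
    by apply/funext => x; rewrite sumn_ell_seq.
  have -> : (fun i => Mq (Mell i) (n - sumn (ell_seq i))) =
            (fun i => Mq (Mell i) (n - absl (ell i))).
    by apply/funext => x; rewrite sumn_ell_seq.
  by [].
have be_pos : 0 < be x.
  apply: ltr_wpDr; first by rewrite mulr_ge0.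
  case: (al') al'0 al'_pos => // a s _ /andP[a0 s0]; rewrite big_cons ltr_wpDr //.
  by rewrite big_seq sumr_ge0 // => b /(allP s0)/ltW.
apply: (@Mq_irreducible R a1 (be x) (Cell alpha (ell x))) => //.
- by rewrite /= a10 be_pos.
- by rewrite subn_gt0 absl_lt.
Qed.
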